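(* There exist absolute constants $C_1,C_2>0$ such that the following holds. For every $0<\beta<\frac14$ there exist $C,\gamma>0$ such that if $G=G(n,p)$ where $p\ge\frac Cn$, then for any integer $t$ with $\frac{C_1}{\log(1/\beta)}\cdot\log n\le t\le(1-C_2\beta)n$, with probability $1-e^{-\Omega(n)}$ the following holds: every subgraph $G'$ of $G$ with $$e(G')\ge\left(g^\gamma(t,n)+\beta\right)e(G)$$ contains a cycle of length $t$.
   Context: Graphs are finite and simple; $e(G)$ is the number of edges of $G$; $\log$ is the natural logarithm; the length of a cycle is its number of edges. $G(n,p)$ is the binomial random graph on vertex set $\{1,\dots,n\}$, in which each pair of vertices is an edge independently with probability $p=p(n)\in[0,1]$. Asymptotic notation is as $n\to\infty$: ''with probability $1-e^{-\Omega(n)}$'' means with probability at least $1-e^{-cn}$ for all sufficiently large $n$, for some constant $c>0$ (which may depend on $\beta$). The function $g^\gamma(t,n)$, for a parameter $\gamma>0$ (cases read in the order listed): if $t$ is odd, $g^\gamma(t,n)$ is defined by $$g^\gamma(t,n)\binom n2=\begin{cases}\binom{t-1}2+\binom{n-t+2}2+1,& t\ge \frac12(n+3),\\ \lfloor \frac14n^2\rfloor+1,& t<\frac12(n+3);\end{cases}$$ if $t$ is even, $$g^\gamma(t,n)\binom n2=\begin{cases}\binom{t-1}2+\binom{n-t+2}2+1,& t\ge \frac12(n+3),\\ \lfloor \frac12n(t-1)\rfloor+1,& \gamma n\le t<\frac12(n+3),\\ 0,& t<\gamma n.\end{cases}$$ *)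

(* Defs.v *)
From mathcomp Require Import all_boot all_order all_algebra.
From mathcomp Require Import reals.

Set Implicit Arguments.
Unset Strict Implicit.
Unset Printing Implicit Defensive.

Import Order.TTheory GRing.Theory Num.Theory.
Local Open Scope ring_scope.

(* A simple graph on the vertex set 'I_n is given by its edge set, a subset
   of [complete n].  Subgraphs are subsets of the edge set: isolated vertices
   affect neither the number of edges nor the cycles of a graph. *)
Definition complete (n : nat) : {set {set 'I_n}} :=
  [set e : {set 'I_n} | #|e| == 2%N].

Definition adj (n : nat) (G : {set {set 'I_n}}) : rel 'I_n :=
  fun x y => [set x; y] \in G.

(* The bound on t is needed: [ucycleb] also accepts a single edge traversed
   back and forth (t = 2) and the empty sequence (t = 0). *)
Definition has_cycle (n : nat) (G : {set {set 'I_n}}) (t : nat) : bool :=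
  (3 <= t)%N && [exists c : t.-tuple 'I_n, ucycleb (adj G) c].

(* Probability of the event E in G(n,p). *)
Definition gnp_prob (R : realType) (n : nat) (p : R)
    (E : pred {set {set 'I_n}}) : R :=
  \sum_(G : {set {set 'I_n}} | (G \subset complete n) && E G)
    \prod_(e in complete n) (if e \in G then p else 1 - p).

(* [gdens_num gamma t n] is g^gamma(t,n) * 'C(n, 2).  The natural number
   divisions are the floors of n^2 / 4 and n (t - 1) / 2, and the truncated
   subtractions are exact for 1 <= t <= n + 2. *)
Definition gdens_num (R : realType) (gamma : R) (t n : nat) : nat :=
  if (n%:R + 3) / 2 <= t%:R :> R then
    ('C(t - 1, 2) + 'C(n + 2 - t, 2) + 1)%N
  else if odd t then (n ^ 2 %/ 4 + 1)%N
  else if gamma * n%:R <= t%:R then (n * (t - 1) %/ 2 + 1)%N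
  else 0%N.

Definition gdens (R : realType) (gamma : R) (t n : nat) : R :=
  (gdens_num gamma t n)%:R / 'C(n, 2)%:R.

Definition all_dense_subgraphs_have_cycle (R : realType) (n : nat) (d : R)
    (t : nat) : pred {set {set 'I_n}} :=
  fun G => [forall G' : {set {set 'I_n}},
    (G' \subset G) ==> (d * #|G|%:R <= #|G'|%:R) ==> has_cycle G' t].

(* Main.v *)
Require Import Defs.
From mathcomp Require Import all_boot all_order all_algebra zify.

Set Implicit Arguments.
Unset Strict Implicit.
Unset Printing Implicit Defensive.

(* Chernoff and a union bound over pairs of vertex sets give, with probability
   1 - exp(-n), an upper bound close to the mean on the number of edges of G
   between any two sets; the rest is deterministic.

   Instead of the sparse regularity lemma we use a version without densities.
   Call (X, Y) hole-free if any two subsets of X and Y of proportional size span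
   an edge of G'.  As long as many nonempty pairs of blocks of a partition have
   a hole, refining by the holes increases the measure of the union of the
   empty pairs by a constant, so this stops after boundedly many rounds.  By the
   upper bound on G, the graph of nonempty hole-free pairs of blocks has almost
   the relative density of G'.

   In a graph of that density a counting argument with augmenting paths finds a
   connected component with a matching covering slightly more than a proportion
   t / n of the vertices; the component is not bipartite when t is odd.
   Depth-first search finds in every hole-free pair of the matching a path that
   is almost spanning, and these paths are linked through reserved vertices
   along walks in the component.  To close a segment of exact length, its ends
   are extended by trees that grow geometrically in reserved parts, hence reach
   linear size within O(log n / log (1 / beta)) steps, and the last layers are
   joined along a short walk; walks are taken in the bipartite double cover so
   as to control their parity. *)

(** * Hole-free pairs and depth-first search *)

(** An arbitrary $G'$ may have any density below that of $G$ between two blocks, but the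
    construction only ever asks for one edge between two large sets. So a pair of blocks counts
    fully once it is nonempty and hole-free, and the upper bound $p m^2$ for $G$ turns an edge count
    of $G'$ into a count of pairs. The obstacle is the exact length: depth-first search and the
    links do not end at prescribed vertices, so lengths are known only up to multiples of the hole
    threshold $k$. The remedy is to fix the closing link before the stretch of the long path that it
    closes. The number of its inner vertices is known from the walk alone, so the stretch must have
    one definite length $d$. Sliding a window of length $d$ gives $2k$ candidates, and fewer than
    $2k$ of them have an end from which no tree can be grown. The number $k = D^{2j}$, with $D$
    about $1/\beta$, is at once the hole threshold and the size of the last tree layer. Two trees of
    depth $2j$ with $D^{2j} \le n$ cost $4j \le 2\log n/\log(1/\beta)$ vertices; the other half of
    $C_1 = 4$ pays for a link of bounded length. *)

Ltac slia := clear; repeat match goal with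
  | |- context [@size ?T ?s] => let n := fresh "n" in set n := (@size T s); clearbody n
  | |- context [@card.body ?T ?s] => let n := fresh "n" in set n := (@card.body T s); clearbody n
  end; lia.

Definition edgeless (V : finType) (e : rel V) (A B : {set V}) : bool :=
  [forall x in A, forall y in B, ~~ e x y].

(** The threshold [k] is an absolute number, so that the property passes to subsets of [X] and [Y]
    unchanged. *)
Definition holefree (V : finType) (e : rel V) (k : nat) (X Y : {set V}) : bool :=
  [forall A : {set V}, forall B : {set V},
    [&& A \subset X, B \subset Y, k <= #|A| & k <= #|B|] ==> ~~ edgeless e A B].

Definition nbhd (V : finType) (e : rel V) (S : {set V}) : {set V} :=
  [set y | [exists x in S, e x y]].

Fixpoint alt (V : finType) (A B : {set V}) (s : seq V) : bool :=
  if s is x :: s' then (x \in A) && alt B A s' else true.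

Lemma subset_of_card (T : finType) (S : {set T}) (q : nat) :
  q <= #|S| -> exists2 A : {set T}, A \subset S & #|A| = q.
Proof.
move=> qS; exists [set x in take q (enum S)].
  by apply/subsetP=> x; rewrite inE => /mem_take; rewrite mem_enum.
rewrite cardsE (card_uniqP _) ?take_uniq ?enum_uniq // size_take -cardE.
by case: ltngtP qS.
Qed.

Section Holes.
Variables (V : finType) (e : rel V).
Hypothesis esym : symmetric e.

Lemma edgelessP (A B : {set V}) :
  reflect (forall x y, x \in A -> y \in B -> ~~ e x y) (edgeless e A B).
Proof.
apply: (iffP forall_inP) => [H x y xA yB|H x xA]; last first.
  by apply/forall_inP => y yB; apply: H.
by have /forall_inP/(_ y yB) := H x xA.
Qed.

Lemma edgelessPn (A B : {set V}) :
  reflect (exists x y, [/\ x \in A, y \in B & e x y]) (~~ edgeless e A B).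
Proof.
apply: (iffP idP) => [|[x [y [xA yB exy]]]]; last first.
  by apply/negP => /edgelessP/(_ x y xA yB); rewrite exy.
rewrite negb_forall_in => /exists_inP[x xA]; rewrite negb_forall_in.
by case/exists_inP => y yB; rewrite negbK => exy; exists x, y.
Qed.

Lemma edgelessC (A B : {set V}) : edgeless e A B = edgeless e B A.
Proof.
by apply/edgelessP/edgelessP => H x y xA yB; rewrite esym; apply: H.
Qed.

Lemma holefreeP k (X Y : {set V}) :
  reflect (forall A B : {set V}, A \subset X -> B \subset Y ->
             k <= #|A| -> k <= #|B| -> exists x y, [/\ x \in A, y \in B & e x y])
          (holefree e k X Y).
Proof.
apply: (iffP forallP) => [H A B AX BY kA kB|H A].
  by have /forallP/(_ B) := H A; rewrite AX BY kA kB => /edgelessPn.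
apply/forallP => B; apply/implyP => /and4P[AX BY kA kB].
by apply/edgelessPn; apply: H.
Qed.

Lemma holefreeC k (X Y : {set V}) : holefree e k X Y = holefree e k Y X.
Proof.
by apply/holefreeP/holefreeP => H A B AX BY kA kB;
  have [x [y [xA yB exy]]] := H B A BY AX kB kA; exists y, x; rewrite esym.
Qed.

Lemma holefreeS k k' (X Y X' Y' : {set V}) : X' \subset X -> Y' \subset Y ->
  k <= k' -> holefree e k X Y -> holefree e k' X' Y'.
Proof.
move=> sX sY kk /holefreeP H; apply/holefreeP => A B AX BY kA kB.
by apply: H; rewrite ?(subset_trans _ sX) ?(subset_trans _ sY) ?(leq_trans kk).
Qed.

Lemma few_non_neighbours k (X Y S : {set V}) : holefree e k X Y ->
  S \subset X -> k <= #|S| -> #|Y :\: nbhd e S| < k.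
Proof.
move=> /holefreeP H SX kS; rewrite ltnNge; apply/negP => kY.
have [x [y [xS]]] := H S _ SX (subsetDl Y (nbhd e S)) kS kY.
by rewrite !inE => /andP[/exists_inP Hn _] exy; apply: Hn; exists x.
Qed.

Lemma many_neighbours k (X Y S Z : {set V}) : holefree e k X Y ->
  S \subset X -> k <= #|S| -> Z \subset Y -> #|Z| < #|nbhd e S :&: Z| + k.
Proof.
move=> H SX kS ZY; have := few_non_neighbours (holefreeS (subxx _) ZY (leqnn k) H) SX kS.
rewrite -(cardsID (nbhd e S) Z) setIC => ?; lia.
Qed.

Lemma alt_cat (A B : {set V}) s s' : alt A B (s ++ s') =
  alt A B s && (if odd (size s) then alt B A s' else alt A B s').
Proof.
elim: s A B => [|x s IH] A B //=.
by rewrite IH -andbA; case: (odd (size s)).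
Qed.

Lemma alt_nth (A B : {set V}) x0 s i : alt A B s -> i < size s ->
  nth x0 s i \in (if odd i then B else A).
Proof.
elim: s A B i => [|x s IH] A B [|i] //= /andP[xA al] lt; first exact: xA.
by have := IH _ _ i al lt; case: (odd i).
Qed.

Lemma alt_subset (A B : {set V}) s : alt A B s -> {subset s <= A :|: B}.
Proof.
elim: s A B => [|x s IH] A B //= /andP[xA /IH sub] y.
rewrite !inE => /orP[/eqP->|/sub]; rewrite ?xA // !inE orbC //.
Qed.

Definition altrel (A B : {set V}) : rel V :=
  fun x y => e x y && ((x \in A) && (y \in B) || (x \in B) && (y \in A)).

Lemma altrel_sym A B : symmetric (altrel A B).
Proof.
by move=> x y; rewrite /altrel esym; congr (_ && _); do 4 case: (_ \in _).
Qed.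

(** The path alternates, so neither class gets more than half of it, rounded up for the class of the
    first vertex. Hence a branch that nearly exhausts one class is long. *)
Lemma altrel_count (A B : {set V}) x p : [disjoint A & B] ->
  path (altrel A B) x p -> (x \in A) || (x \in B) ->
  [/\ 2 * count (mem A) (x :: p) <= size (x :: p) + (x \in A) &
      2 * count (mem B) (x :: p) <= size (x :: p) + (x \in B)].
Proof.
move=> dAB; have dis z : z \in A -> z \in B -> false.
  by move=> zA zB; rewrite (disjointFr dAB zA) in zB.
elim: p x => [|y p IH] x /=; first by move=> _ _; case: (x \in A); case: (x \in B); split=> /=; lia.
case/andP => /andP[exy xy] pth xAB.
have yAB : (y \in A) || (y \in B) by case/orP: xy => /andP[_ ->]; rewrite ?orbT.
have [/= H1 H2] := IH y pth yAB.
move: (dis x) (dis y) xy xAB H1 H2.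
do 4 case: (_ \in _) => //=; move=> d1 d2 _ _; rewrite ?(d1 isT isT, d2 isT isT) => *;
  split; try lia; try by have := d1 isT isT; try by have := d2 isT isT.
all: try by have := d2 isT isT.
Qed.

Lemma altrel_alt (A B : {set V}) x p : [disjoint A & B] ->
  path (altrel A B) x p -> x \in A -> alt A B (x :: p).
Proof.
elim: p x A B => [|y p IH] x A B dAB /=; first by move=> _ ->.
case/andP => /andP[_ xy] pth xA; rewrite xA /=.
have xB : x \in B = false by apply: disjointFr dAB xA.
move: xy; rewrite xA xB orbF /= => yB.
apply: (IH y B A) => //; first by rewrite disjoint_sym.
by apply: sub_path pth => u v; rewrite /altrel orbC.
Qed.

(* Depth-first search, with [P] the current branch (head first), [S] the
   explored and [T] the untouched vertices: no edge joins [S] to [T]. *)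
Lemma dfs_branch k (A B : {set V}) : 0 < k -> k <= #|A| -> holefree e k A B ->
  [disjoint A & B] ->
  exists P, [/\ sorted (altrel A B) P, uniq P, {subset P <= A :|: B} &
   (#|A| <= count (mem A) P + 2 * k) || (#|B| <= count (mem B) P + 2 * k)].
Proof.
move=> k0 kA hf dAB; set f := altrel A B.
(* A vertex moves from [T] to [P] and later from [P] to [S]; each move lowers [2 * #|T| + size P] by
   one. *)
suff gen n : forall (S T : {set V}) P, 2 * #|T| + size P <= n ->
    sorted f P -> uniq P -> {subset P <= A :|: B} -> T \subset A :|: B ->
    {in P, forall x, x \notin T} ->
    {in A :|: B, forall x, [|| x \in S, x \in T | x \in P]} ->
    #|S :&: A| < k -> #|S :&: B| < k ->
    (forall x y, x \in S -> y \in T -> ~~ f x y) ->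
   exists P, [/\ sorted f P, uniq P, {subset P <= A :|: B} &
   (#|A| <= count (mem A) P + 2 * k) || (#|B| <= count (mem B) P + 2 * k)].
  apply: (gen _ set0 (A :|: B) [::] (leqnn _)) => //; rewrite ?set0I ?cards0 //.
    by move=> x ->; rewrite orbT.
  by move=> x y; rewrite inE.
have cnt (X : {set V}) (S T : {set V}) P : uniq P -> 
    {in X, forall x, [|| x \in S, x \in T | x \in P]} ->
    #|X| <= #|S :&: X| + #|T :&: X| + count (mem X) P.
  move=> uP cov; rewrite -size_filter -(card_uniqP (filter_uniq _ uP)).
  set W := [set x | x \in [seq x <- P | x \in X]].
  have -> : #|[seq x <- P | x \in X]| = #|W| by rewrite cardsE.
  apply: leq_trans (_ : #|(S :&: X) :|: (T :&: X) :|: W| <= _).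
    apply: subset_leq_card; apply/subsetP => x xX; have := cov x xX.
    by rewrite !inE mem_filter /= xX !andbT; case/or3P => ->; rewrite ?orbT.
  by rewrite (leq_trans (leq_card_setU _ _)) // leq_add2r leq_card_setU.
elim: n => [|n IH] S T P meas srt uP subP subT disPT cov cA cB noE.
  have T0 : T = set0 by apply/eqP; rewrite -cards_eq0; lia.
  have P0 : P = [::] by case: (P) meas => //= *; lia.
  have covA : {in A, forall x, [|| x \in S, x \in T | x \in P]}.
    by move=> x xA; apply: cov; rewrite inE xA.
  by have := cnt A S T P uP covA; rewrite T0 P0 set0I cards0 /=; lia.
case: P => [|v P] in meas srt uP subP disPT cov *.
  have [T0|[v vT]] := set_0Vmem T.
    have covA : {in A, forall x, [|| x \in S, x \in T | x \in [::]]}.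
      by move=> x xA; apply: cov; rewrite inE xA.
    by have := cnt A S T [::] uP covA; rewrite T0 set0I cards0 /=; lia.
  have vAB := subsetP subT v vT.
  apply: (IH S (T :\ v) [:: v]) => //.
  - by move: meas; rewrite (cardsD1 v T) vT /=; lia.
  - by move=> x; rewrite inE => /eqP->.
  - by apply: subset_trans subT; apply: subsetDl.
  - by move=> x; rewrite inE => /eqP->; rewrite !inE eqxx.
  - by move=> x /cov; rewrite !inE; case: (x =P v); rewrite //= ?orbT ?orbF.
  - by move=> x y xS; rewrite inE => /andP[_ yT]; apply: noE.
have [|none] := boolP [exists u in T, f v u].
  case/exists_inP => u uT fvu.
  have uAB := subsetP subT u uT.
  apply: (IH S (T :\ u) (u :: v :: P)) => //.
  - by move: meas; rewrite (cardsD1 u T) uT /=; lia.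
  - by move: srt => /= ->; rewrite andbT /f altrel_sym.
  - by rewrite cons_uniq uP andbT; apply/negP => /disPT; rewrite uT.
  - by move=> x; rewrite inE => /orP[/eqP-> //|/subP].
  - by apply: subset_trans subT; apply: subsetDl.
  - move=> x; rewrite inE => /orP[/eqP->|/disPT]; first by rewrite !inE eqxx.
    by rewrite !inE negb_and negbK => ->; rewrite orbT.
  - by move=> x /cov; rewrite !inE; case: (x =P u); rewrite //= ?orbT.
  - by move=> x y xS; rewrite inE => /andP[_ yT]; apply: noE.
have vAB : v \in A :|: B by apply: subP; rewrite inE eqxx.
have noE' x y : x \in v |: S -> y \in T -> ~~ f x y.
  rewrite in_setU1 => /orP[/eqP-> yT|]; last exact: noE.
  by move: none; rewrite negb_exists_in => /forall_inP; apply.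
(* The search stops when the explored set first reaches [k] vertices of a class. By hole-freeness
   fewer than [k] vertices of the other class are then untouched, and fewer than [k] of them are
   explored; the branch contains the rest. *)
have [big|smA] := leqP k #|(v |: S) :&: A|.
  exists (v :: P); split=> //; apply/orP; right.
  have TB : #|T :&: B| < k.
    rewrite ltnNge; apply/negP => TB.
    have [x [y []]] := holefreeP _ _ _ hf _ _ (subsetIr _ A) (subsetIr _ B) big TB.
    rewrite !in_setI => /andP[xS xA] /andP[yT yB] exy.
    by have := noE' _ _ xS yT; rewrite /f /altrel exy xA yB.
  suff /(cnt B S T (v :: P) uP) : {in B, forall x, [|| x \in S, x \in T | x \in v :: P]}.
    by lia.
  by move=> x xB; apply: cov; rewrite inE xB orbT.
have [big|smB] := leqP k #|(v |: S) :&: B|.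
  exists (v :: P); split=> //; apply/orP; left.
  have TB : #|T :&: A| < k.
    rewrite ltnNge; apply/negP => TB.
    rewrite holefreeC in hf.
    have [x [y []]] := holefreeP _ _ _ hf _ _ (subsetIr _ B) (subsetIr _ A) big TB.
    rewrite !in_setI => /andP[xS xA] /andP[yT yB] exy.
    by have := noE' _ _ xS yT; rewrite /f /altrel exy xA yB orbT.
  have := cnt A S T (v :: P) uP; move/(_ _)/wrap; case; last by lia.
  by move=> x xB; apply: cov; rewrite inE xB.
apply: (IH (v |: S) T P) => //.
- by move: meas => /=; lia.
- by move: srt => /= /path_sorted.
- by case/andP: uP.
- by move=> x xP; apply: subP; rewrite inE xP orbT.
- by move=> x xP; apply: disPT; rewrite inE xP orbT.
- by move=> x /cov; rewrite !inE; case: (x =P v); rewrite //= ?orbT.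
Qed.

End Holes.

(** * Long paths, links and trees *)

Section Paths.
Variables (V : finType) (e : rel V).
Hypothesis esym : symmetric e.

Lemma long_alternating_path k N q (A B : {set V}) : 0 < k ->
  holefree e k A B -> [disjoint A & B] -> N <= #|A| -> N <= #|B| ->
  2 * q + 4 * k + 2 <= 2 * N ->
  exists P, [/\ sorted e P, uniq P, alt A B P & size P = 2 * q].
Proof.
move=> k0 hf dAB NA NB qN.
have [|P [srt uP subP big]] := dfs_branch esym k0 _ hf dAB; first by lia.
suff [P' [srt' uP' al sz]] : exists P', [/\ sorted (altrel e A B) P', uniq P', alt A B P'
    & 2 * q <= size P'].
  exists (take (2 * q) P'); split.
  - apply: take_sorted; case: (P') srt' => //= x s; apply: sub_path => u v.
    by case/andP.
  - exact: take_uniq.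
  - by move: al; rewrite -{1}(cat_take_drop (2 * q) P') alt_cat => /andP[].
  - by rewrite size_takel.
case: P => [|x p] in srt uP subP big *; first by move: big => /=; lia.
have := subP x (mem_head _ _); rewrite in_setU => xAB.
have [cA cB] := altrel_count dAB srt xAB.
have [xA|xA] := boolP (x \in A).
  exists (x :: p); split => //; first exact: (altrel_alt (e := e)).
  have xB : x \in B = false by apply: disjointFr dAB xA.
  by rewrite xA xB in cA cB; case/orP: big; lia.
(* A branch starting in [B] gives up its first vertex; the [+ 2] in the hypothesis pays for this and
   for rounding. *)
have xB : x \in B by rewrite (negbTE xA) in xAB.
rewrite xB (negbTE xA) in cA cB.
have sz : 2 * q < size (x :: p) by case/orP: big; lia.
have /andP[_ al] : alt B A (x :: p).
  apply: (altrel_alt (e := e)) => //; first by rewrite disjoint_sym.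
  by apply: sub_path srt => u v; rewrite /altrel orbC.
exists p; split => //; first exact: path_sorted srt.
by case/andP: uP.
Qed.

(** At least [k] vertices of each reservoir [Z w] stay reachable, since a set of [k] vertices misses
    fewer than [k] of the at least [2 * k]. The ends are chosen by the path from sets of size [k].
    The index type is arbitrary because the walk will live in the double cover, where two indices
    share a block but have disjoint reservoirs. *)
Lemma linking_path (T : eqType) (r : rel T) (b Z : T -> {set V}) k :
  (forall u v, r u v -> holefree e k (b u) (b v)) ->
  (forall u, Z u \subset b u) -> (forall u, 2 * k <= #|Z u|) ->
  forall p u v (S S' : {set V}), path r u (rcons p v) ->
  S \subset b u -> k <= #|S| -> S' \subset b v -> k <= #|S'| ->
  exists x q y, [/\ x \in S, y \in S', path e x (rcons q y) &
                    all2 (fun z w => z \in Z w) q p].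
Proof.
move=> hf Zb Z2; elim=> [|w p IH] u v S S' /=.
  rewrite andbT => ruv Su kS Sv kS'.
  have [x [y [xS yS' exy]]] := holefreeP _ _ _ _ (hf _ _ ruv) _ _ Su Sv kS kS'.
  by exists x, [::], y; rewrite /= exy.
case/andP=> ruw pth Su kS Sv kS'.
have nb : k <= #|nbhd e S :&: Z w|.
  by have := many_neighbours (hf _ _ ruw) Su kS (Zb w); have := Z2 w; lia.
have [|x [q [y [xN yS' pxy al]]]] := IH w v (nbhd e S :&: Z w) S' pth _ nb Sv kS'.
  by rewrite (subset_trans (subsetIr _ _)).
move: xN; rewrite !inE => /andP[/exists_inP[s sS esx] xZ].
by exists s, (x :: q), y; split => //=; rewrite ?esx ?xZ.
Qed.

Definition expands D k (X Y : {set V}) :=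
  forall S : {set V}, S \subset X -> #|S| <= k -> D * #|S| <= #|nbhd e S :&: Y|.

(* Remove a maximal pair of small sets that both fail to expand; a set failing
   to expand in what is left could be added to this pair. *)
Lemma expanding_subpair D k N (X Y : {set V}) : 0 < k ->
  holefree e k X Y -> N <= #|X| -> N <= #|Y| -> (2 * D + 4) * k <= N ->
  exists X' Y' : {set V}, [/\ X' \subset X, Y' \subset Y,
    #|X| < #|X'| + k /\ #|Y| < #|Y'| + k, expands D k X' Y' & expands D k Y' X'].
Proof.
move=> k0 hf NX NY big.
pose P (st : {set V} * {set V}) := [&& st.1 \subset X, st.2 \subset Y,
   #|st.1| < k, #|st.2| < k, #|nbhd e st.1 :&: (Y :\: st.2)| <= D * #|st.1|
   & #|nbhd e st.2 :&: (X :\: st.1)| <= D * #|st.2|].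
have nb0 : nbhd e set0 = set0.
  by apply/setP => y; rewrite !inE; apply/exists_inP => -[x]; rewrite inE.
have P0 : P (set0, set0) by rewrite /P /= !sub0set !nb0 !set0I !cards0 muln0 k0.
have [[S T] /= /and5P[/= SX TY Sk Tk /andP[eS eT]] mx] :=
  @arg_maxnP _ (set0, set0) P (fun st => #|st.1| + #|st.2|) P0.
have nbU (A B : {set V}) : nbhd e (A :|: B) = nbhd e A :|: nbhd e B.
  apply/setP => y; rewrite !inE; apply/exists_inP/orP.
    move=> [x]; rewrite inE => /orP[] xx exy; [left|right];
      by apply/exists_inP; exists x.
  by case=> /exists_inP[x xx exy]; exists x; rewrite // inE xx ?orbT.
have core (X1 Y1 S1 T1 S0 : {set V}) : holefree e k X1 Y1 -> N <= #|Y1| ->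
   S1 \subset X1 -> T1 \subset Y1 -> #|S1| < k -> #|T1| < k ->
   #|nbhd e S1 :&: (Y1 :\: T1)| <= D * #|S1| ->
   S0 \subset X1 :\: S1 -> #|S0| <= k ->
   #|nbhd e S0 :&: (Y1 :\: T1)| < D * #|S0| ->
   [/\ #|S1 :|: S0| < k, #|nbhd e (S1 :|: S0) :&: (Y1 :\: T1)| <= D * #|S1 :|: S0|
     & #|S1| < #|S1 :|: S0|].
  move=> hf1 NY1 SX1 TY1 Sk1 Tk1 eS1 S0X S0k eS0.
  have dS : [disjoint S1 & S0].
    rewrite disjoint_sym; apply: disjointWl S0X _.
    by rewrite -setI_eq0 setIC; apply/eqP/setP => x; rewrite !inE; case: (x \in S1).
  have cS : #|S1 :|: S0| = #|S1| + #|S0|.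
    by rewrite cardsU (disjoint_setI0 dS) cards0 subn0.
  have S0pos : 0 < #|S0| by rewrite lt0n; apply: contraTneq eS0 => ->; rewrite muln0 ltn0.
  have le : #|nbhd e (S1 :|: S0) :&: (Y1 :\: T1)| <= D * #|S1 :|: S0|.
    rewrite nbU setIUl cS mulnDr.
    by apply: leq_trans (leq_card_setU _ _) _; rewrite leq_add // ltnW.
  split=> //; last by rewrite cS -[X in X < _]addn0 ltn_add2l.
  (* A union of size at least [k] has more than [N - 2 * k] neighbours in [Y1 :\: T1]. Being smaller
     than [2 * k] and not expanding, it has at most [2 * D * k]. *)
  rewrite ltnNge; apply/negP => kle.
  have sub : S1 :|: S0 \subset X1.
    by rewrite subUset SX1 (subset_trans S0X) // subsetDl.
  have h1 := many_neighbours hf1 sub kle (subsetDl Y1 T1).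
  have h2 : #|Y1| <= #|Y1 :\: T1| + #|T1|.
    by rewrite -(cardsID T1 Y1) addnC leq_add2l subset_leq_card // subsetIr.
  have h3 : D * #|S1 :|: S0| <= 2 * D * k.
    by rewrite [2 * D]mulnC -mulnA leq_mul2l cS mul2n -addnn leq_add ?orbT // ltnW.
  by move: big NY1 h1 h2 h3 le Tk1; clear; rewrite mulnDl; lia.
exists (X :\: S), (Y :\: T); split; rewrite ?subsetDl //.
- have dif (A B : {set V}) : #|B| < k -> #|A| < #|A :\: B| + k.
    move=> Bk; rewrite -(cardsID B A) addnC ltn_add2l (leq_ltn_trans _ Bk) //.
    by rewrite subset_leq_card // subsetIr.
  by split; apply: dif.
- move=> S0 S0X S0k; rewrite leqNgt; apply/negP => bad.
  have [lk le lt] := core X Y S T S0 hf NY SX TY Sk Tk eS S0X S0k bad.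
  suff /(mx (S :|: S0, T)) /= : P (S :|: S0, T) by rewrite leq_add2r leqNgt lt.
  rewrite /P /= TY Tk lk le /=; apply/andP; split.
    by rewrite subUset SX (subset_trans S0X) // subsetDl.
  apply: leq_trans eT; apply/subset_leq_card/setIS/setDS/subsetUl.
- move=> T0 T0Y T0k; rewrite leqNgt; apply/negP => bad.
  rewrite holefreeC // in hf.
  have [lk le lt] := core Y X T S T0 hf NX TY SX Tk Sk eT T0Y T0k bad.
  suff /(mx (S, T :|: T0)) /= : P (S, T :|: T0) by rewrite leq_add2l leqNgt lt.
  rewrite /P /= SX Sk lk le !andbT /=; apply/andP; split.
    by rewrite subUset TY (subset_trans T0Y) // subsetDl.
  apply: leq_trans eS; apply/subset_leq_card/setIS/setDS/subsetUl.
Qed.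

(** The tree is kept as its last layer [L], the set [U] of earlier vertices, and paths to the
    leaves. As [#|U| <= #|L|], at most [2 * #|L|] vertices are taken, so expansion by [D.+2] leaves
    [D * #|L|] new ones; [2 <= D] restores the bound on [U]. *)
Lemma tree_layer D k (X Y : {set V}) n x : 2 <= D ->
  expands D.+2 k X Y -> expands D.+2 k Y X -> x \in Y ->
  (forall i, i < n -> D ^ i <= k) ->
  exists U L : {set V}, [/\ L \subset (if odd n then X else Y), #|L| = D ^ n,
    #|U| <= #|L|, (U \subset X :|: Y) /\ [disjoint U & L] &
    forall z, z \in L -> exists q, [/\ path e x q, last x q = z, size q = n,
      uniq (x :: q) & {subset belast x q <= U}]].
Proof.
move=> D2 exX exY xY; elim: n => [|n IH] small.
  exists set0, [set x]; split; rewrite ?sub1set ?cards1 ?cards0 //.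
    by split; rewrite ?sub0set // disjoints_subset sub0set.
  by move=> z /set1P->; exists [::].
have [|U [L [LXY cL UL [UXY dUL] pth]]] := IH.
  by move=> i lt; apply: small; rewrite ltnS ltnW.
pose Y' := if odd n.+1 then X else Y.
have exL : D.+2 * #|L| <= #|nbhd e L :&: Y'|.
  have Lk : #|L| <= k by rewrite cL small.
  by rewrite /Y' /=; case: (odd n) LXY => /= sub; [apply: exX|apply: exY].
have [|L' L'sub cL'] := @subset_of_card _ ((nbhd e L :&: Y') :\: (U :|: L)) (D * #|L|).
  have h1 : #|U :|: L| <= #|U| + #|L| := leq_card_setU U L.
  have h2 := cardsID (U :|: L) (nbhd e L :&: Y').
  have h3 := subset_leq_card (subsetIr (nbhd e L :&: Y') (U :|: L)).
  rewrite !mulSn in exL; lia.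
exists (U :|: L), L'; split.
- by apply: subset_trans L'sub _; rewrite (subset_trans (subsetDl _ _)) ?subsetIr.
- by rewrite cL' cL expnS.
- rewrite cL'; apply: leq_trans (leq_card_setU _ _) _.
  by apply: (@leq_trans (2 * #|L|)); rewrite ?leq_mul // mul2n -addnn leq_add2r.
- split; last first.
    rewrite disjoint_sym disjoints_subset; apply: subset_trans L'sub _.
    by rewrite setDE subsetIr.
  rewrite subUset UXY (subset_trans LXY) //.
  by case: (odd n); rewrite ?subsetUl ?subsetUr.
move=> z zL'; have := subsetP L'sub z zL'.
rewrite in_setD in_setI => /andP[zUL /andP[]]; rewrite inE => /exists_inP[w wL ewz] _.
have [q [pq lq sq uq bq]] := pth w wL.
have sub : {subset x :: q <= U :|: L}.
  move=> v; rewrite lastI mem_rcons inE lq => /orP[/eqP->|/bq]; rewrite inE ?wL ?orbT //.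
  by move=> ->.
exists (rcons q z); split; rewrite ?last_rcons ?size_rcons ?sq //.
- by rewrite rcons_path pq lq ewz.
- rewrite -rcons_cons rcons_uniq uq andbT; apply: contra zUL; exact: sub.
- by rewrite belast_rcons.
Qed.

End Paths.

(** * Chains of paths *)

(** Changing the sheet at every step records the parity of a walk. That the component of [x] is not
    bipartite is expressed throughout as a connection from [(x, false)] to [(x, true)]. *)
Definition double_cover (I : finType) (r : rel I) : rel (I * bool) :=
  fun u v => r u.1 v.1 && (u.2 != v.2).

Section DoubleCover.
Variables (I : finType) (r : rel I).
Hypothesis rsym : symmetric r.
Local Notation dc := (double_cover r).

Lemma double_cover_sym : symmetric dc.
Proof. by move=> u v; rewrite /double_cover rsym eq_sym. Qed.

Lemma double_cover_parity u p : path dc u p -> (last u p).2 = u.2 (+) odd (size p).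
Proof.
elim: p u => [|w p IH] u /=; first by rewrite addbF.
case/andP => /andP[_ ne] /IH ->.
by move: ne; case: u.2; case: w.2; case: (odd _).
Qed.

Lemma connect_flip i a j b : connect dc (i, a) (j, b) -> connect dc (i, ~~ a) (j, ~~ b).
Proof.
case/connectP => p pth lst; apply/connectP.
pose f (u : I * bool) := (u.1, ~~ u.2); exists (map f p).
  apply: (homo_path (f := f)) pth => u v.
  by rewrite /double_cover /=; case: u.2; case: v.2.
by rewrite (last_map f p (i, a)) -lst.
Qed.

Lemma connect_double_cover i j a : connect r i j -> exists b, connect dc (i, a) (j, b).
Proof.
case/connectP => p; elim: p i a => [|x p IH] i a /=.
  by move=> _ ->; exists a; apply: connect0.
case/andP => rix /IH H /H{H} H; have [b cb] := H (~~ a).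
exists b; apply: connect_trans cb; apply: connect1.
by rewrite /double_cover /= rix; case: a.
Qed.

Lemma connect_of_double_cover u v : connect dc u v -> connect r u.1 v.1.
Proof.
case/connectP => p pth ->; apply/connectP; exists (map fst p).
  by apply: (homo_path (f := fst)) pth => w w' /andP[].
by rewrite (last_map fst p u).
Qed.

(** Simplicity matters twice: it bounds the cost of a link by the number of blocks, and it makes a
    link visit each connecting cell at most once. *)
Lemma connect_simple_path u v : connect dc u v -> u != v ->
  exists p, [/\ path dc u (rcons p v), uniq (rcons p v) & size p < 2 * #|I|].
Proof.
case/connectP => p0 pth0 ->; case/shortenP: pth0 => p pth up _ ne.
case/lastP: p => [|p w] in pth up ne *; first by rewrite eqxx in ne.
rewrite last_rcons in ne *; have up' : uniq (rcons p w) by case/andP: up.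
exists p; split => //.
by have := max_card (mem (rcons p w)); rewrite (card_uniqP up') size_rcons card_prod card_bool mulnC.
Qed.

End DoubleCover.

Lemma card_alt (V : finType) (A B : {set V}) s n : [disjoint A & B] ->
  alt A B s -> uniq s -> size s = 2 * n ->
  #|[set v in s | v \in A]| = n /\ #|[set v in s | v \in B]| = n.
Proof.
move=> dAB; elim: n s => [|n IH] s.
  rewrite muln0 => _ _ /size0nil->; split; apply/eqP; rewrite cards_eq0;
  by apply/eqP/setP => v; rewrite !inE.
case: s => [|x [|y s]] /= => [_ _ ?|_ _ ?|/and3P[xA yB al] /and3P[xN yN us] sz]; try lia.
have [|cA cB] := IH s al us; first by lia.
have xB : x \in B = false by apply: disjointFr dAB xA.
have yA : y \in A = false by apply: disjointFl dAB yB.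
rewrite inE negb_or in xN; case/andP: xN => xy xN.
split.
  have -> : [set v in x :: y :: s | v \in A] = x |: [set v in s | v \in A].
    apply/setP => v; rewrite !inE; case: eqP => [->|_] /=; first by rewrite xA.
    by case: eqP => [->|//]; rewrite yA !andbF.
  by rewrite cardsU1 cA inE (negbTE xN).
have -> : [set v in x :: y :: s | v \in B] = y |: [set v in s | v \in B].
  apply/setP => v; rewrite !inE; case: (v =P y) => [->|_] /=; first by rewrite yB orbT.
  by case: eqP => [->|//]; rewrite xB !andbF.
by rewrite cardsU1 cB inE (negbTE yN).
Qed.

Lemma all2_uniq (V T : eqType) (P : V -> T -> bool) q p :
  (forall v u u', P v u -> P v u' -> u = u') -> all2 P q p -> uniq p -> uniq q.
Proof.
move=> inj; elim: q p => [|v q IH] [|u p] //= /andP[Pvu al] /andP[uN up].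
rewrite (IH _ al up) andbT; apply: contra uN => vq.
elim: q p al vq {IH up} => [|w q IH] [|u' p] //= /andP[Pwu al].
rewrite !inE => /orP[/eqP vw|/(IH _ al) ->]; last by rewrite orbT.
by rewrite (inj v u u') ?eqxx // vw.
Qed.

Lemma all2_in (V T : eqType) (P : V -> T -> bool) q p :
  all2 P q p -> forall v, v \in q -> exists u, P v u.
Proof.
elim: q p => [|w q IH] [|u p] //= /andP[Pwu al] v; rewrite inE.
by case/orP => [/eqP->|/(IH _ al) //]; exists u.
Qed.

Section Chain.
Variables (V I : finType) (e : rel V) (r : rel I) (b : I -> {set V}).
Variables (slot : V -> nat) (k : nat).
Hypothesis esym : symmetric e.
Hypothesis rsym : symmetric r.
Hypothesis rirr : irreflexive r.
Hypothesis k0 : 0 < k.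
Hypothesis b_inj : forall i j v, v \in b i -> v \in b j -> i = j.
Hypothesis hole : forall i j, r i j -> holefree e k (b i) (b j).

(* Slot 0 of a block is used by the long paths, slots 1 and 2 by the links (one
   for each sheet of the double cover), slots 3 and 4 by the trees grown from
   the two ends of the segment to be closed. *)
Definition cell s i := [set v in b i | slot v == s].
Local Notation main := (cell 0).
Definition conn (u : I * bool) := cell (if u.2 then 2 else 1) u.1.
Local Notation dc := (double_cover r).

Hypothesis conn_big : forall u, 3 * k <= #|conn u|.

Lemma cellP s i v : (v \in cell s i) = (v \in b i) && (slot v == s).
Proof. by rewrite inE. Qed.

Lemma cell_inj s s' i i' v : v \in cell s i -> v \in cell s' i' -> s = s' /\ i = i'.
Proof.
by rewrite !cellP => /andP[vi /eqP<-] /andP[vi' /eqP<-]; rewrite (b_inj vi vi').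
Qed.

Lemma disjoint_cell s s' i i' : (s != s') || (i != i') -> [disjoint cell s i & cell s' i'].
Proof.
move=> ne; apply/pred0P => v /=; apply/negP => /andP[v1 v2].
by have [ss ii] := cell_inj v1 v2; rewrite ss ii !eqxx in ne.
Qed.

Lemma conn_inj v u u' : v \in conn u -> v \in conn u' -> u = u'.
Proof.
case: u u' => [i a] [i' a'] /= v1 v2; have [] := cell_inj v1 v2.
by case: a {v1}; case: a' {v2} => //= _ ->.
Qed.

Lemma conn_slot v u : v \in conn u -> 0 < slot v < 3.
Proof. by rewrite cellP => /andP[_ /eqP->]; case: u.2. Qed.

Lemma cell_sub s i : cell s i \subset b i.
Proof. by apply/subsetP => v; rewrite cellP => /andP[]. Qed.

(* The interior of the linking path consists of unused connecting vertices, one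
   for each inner vertex of the simple path [p] of the double cover. *)
Lemma fresh_path (F : seq V) u v p (S S' : {set V}) :
  count (fun x => slot x != 0) F <= k -> path dc u (rcons p v) -> uniq p ->
  S \subset b u.1 -> k <= #|S| -> S' \subset b v.1 -> k <= #|S'| ->
  exists x q y, [/\ x \in S, y \in S', path e x (rcons q y), uniq q &
    [/\ {in q, forall z, z \notin F}, {in q, forall z, 0 < slot z < 3} &
     size q = size p]].
Proof.
move=> cF pth up Su kS Sv kS'.
(* [F] occupies at most [k] vertices outside slot 0, so [2 * k] of the [3 * k] connecting vertices
   of each cell remain, as [linking_path] requires. *)
pose Z w := conn w :\: [set x in F].
have Zb w : Z w \subset b w.1 by apply: subset_trans (subsetDl _ _) (cell_sub _ _).
have Zk w : 2 * k <= #|Z w|.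
  have := conn_big w; rewrite -(cardsID [set x in F] (conn w)) -/(Z w).
  suff : #|conn w :&: [set x in F]| <= k by slia.
  apply: leq_trans cF; rewrite -size_filter.
  apply: leq_trans (card_size _); apply: subset_leq_card; apply/subsetP => x.
  by rewrite inE mem_filter => /andP[/conn_slot/andP[xs _]]; rewrite inE -lt0n xs.
have hf w w' : dc w w' -> holefree e k (b w.1) (b w'.1) by case/andP => /hole.
have [x [q [y [xS yS pxy al]]]] := linking_path (b := fun w => b w.1) hf Zb Zk pth Su kS Sv kS'.
exists x, q, y; split => //.
  by apply: all2_uniq al up => z w w' /setDP[z1 _] /setDP[z2 _]; apply: conn_inj z1 z2.
split.
- by move=> z /(all2_in al)[w]; rewrite !inE => /andP[].
- by move=> z /(all2_in al)[w] /setDP[/conn_slot].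
- by elim: (q) (p) al => [|? ? IH] [|? ?] //= /andP[_ /IH->].
Qed.

Lemma fresh_link (F : seq V) u v (S S' : {set V}) :
  count (fun x => slot x != 0) F <= k -> connect dc u v -> u != v ->
  S \subset b u.1 -> k <= #|S| -> S' \subset b v.1 -> k <= #|S'| ->
  exists x q y, [/\ x \in S, y \in S', path e x (rcons q y), uniq q &
    [/\ {in q, forall z, z \notin F}, {in q, forall z, 0 < slot z < 3},
     size q < 2 * #|I| & v.2 = u.2 (+) ~~ odd (size q)]].
Proof.
move=> cF cuv ne Su kS Sv kS'.
have [p [pth up sp]] := connect_simple_path cuv ne.
have up' : uniq p by move: up; rewrite rcons_uniq => /andP[].
have [x [q [y [xS yS pxy uq [qF qs sz]]]]] := fresh_path cF pth up' Su kS Sv kS'.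
exists x, q, y; split; rewrite // sz; split=> //.
by have := double_cover_parity pth; rewrite last_rcons size_rcons.
Qed.

Variables (A1 B1 : I).

(* [F] starts with [n1] vertices alternating between [A1] and [B1], ends with
   [4 * k] vertices alternating between [A] and [B], and uses at most [n2]
   linking vertices; the sheet of [B] records the parity of its length. *)
Definition chain n1 n2 A B (F : seq V) :=
  [/\ sorted e F, uniq F, alt (main A1) (main B1) (take n1 F),
    exists F0 Q, [/\ F = F0 ++ Q, alt (main A) (main B) Q & size Q = 4 * k] &
    [/\ r A B, connect dc (A1, false) (B, ~~ odd (size F)),
      count (fun v => slot v != 0) F <= n2 & all (fun v => slot v < 3) F]].

(** A link needs [k] candidates at each end: the vertices in [B] among the last [2 * k] of [F], and
    those in [A'] among the first [2 * k] of a new path of length [2 * l]. What lies beyond the ends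
    that the link picks is cut off, at most [2 * k] vertices on either side. *)
Lemma chain_step n1 n2 A B F A' B' l : chain n1 n2 A B F ->
  n2 <= k -> n1 + 2 * k <= size F -> r A' B' -> (exists a, connect dc (A1, false) (A', a)) ->
  {in F, forall v, v \notin main A' :|: main B'} -> B != A' ->
  2 * l + 4 * k + 2 <= 2 * #|main A'| -> 2 * l + 4 * k + 2 <= 2 * #|main B'| ->
  3 * k <= l ->
  exists F', [/\ chain n1 (n2 + 2 * #|I|) A' B' F',
    size F + 2 * l <= size F' + 4 * k, size F' <= size F + 2 * l + 2 * #|I|,
    size F <= size F' + 2 * k &
    {in F', forall v, slot v = 0 -> (v \in F) || (v \in main A' :|: main B')}].
Proof.
case=> srt uF al1 [F0 [Q [defF alQ sQ]]] [rA cF cntF allF] n2k n1F rAB [a ca] disF BA lA lB kl.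
have ne i j : r i j -> i != j by apply: contraTneq => ->; rewrite rirr.
have dis i j : r i j -> [disjoint main i & main j].
  by move=> rij; apply: disjoint_cell; rewrite ne // orbT.
have hfAB : holefree e k (main A') (main B').
  by apply: holefreeS (hole rAB) => //; apply: cell_sub.
have [P [srtP uP alP sP]] : exists P, [/\ sorted e P, uniq P, alt (main A') (main B') P & size P = 2 * l].
  apply: (long_alternating_path esym k0 hfAB (dis _ _ rAB) (geq_minl _ _) (geq_minr _ _)).
  by rewrite /minn; case: ltnP.
have sTk : size (take (2 * k) P) = 2 * k by rewrite size_takel // sP; move: kl; slia.
have sDk : size (drop (2 * k) Q) = 2 * k by rewrite size_drop sQ; slia.
have sQk : size (take (2 * k) Q) = 2 * k by rewrite size_takel // sQ; slia.
have o2 n : odd (2 * n) = false by rewrite mul2n odd_double.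
move: (alP); rewrite -{1}(cat_take_drop (2 * k) P) alt_cat sTk o2 => /andP[alPt alPd].
move: (alQ); rewrite -{1}(cat_take_drop (2 * k) Q) alt_cat sQk o2 => /andP[alQt alQd].
have uQ : uniq Q by move: uF; rewrite defF cat_uniq => /and3P[].
have [_ cS] := card_alt (dis _ _ rA) alQd (drop_uniq _ uQ) sDk.
have [cT _] := card_alt (dis _ _ rAB) alPt (take_uniq _ uP) sTk.
have cBA : connect dc (B, ~~ odd (size F)) (A', a).
  by apply: connect_trans ca; rewrite (sym_connect_sym (double_cover_sym rsym)).
have [|||||x [q [y [xS yT pxy uq [qF qs sq par]]]]] :=
  @fresh_link F _ _ [set v in drop (2 * k) Q | v \in main B]
    [set v in take (2 * k) P | v \in main A'] (leq_trans cntF n2k) cBA.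
- by rewrite xpair_eqE negb_and BA.
- by apply/subsetP => v; rewrite !inE => /andP[_ /andP[]].
- by rewrite cS.
- by apply/subsetP => v; rewrite !inE => /andP[_ /andP[]].
- by rewrite cT.
rewrite inE in xS; rewrite inE in yT.
case/andP: xS => xQ xB; case/andP: yT => yP yA.
have [Q1 [Q2 defQ]] : exists Q1 Q2, drop (2 * k) Q = Q1 ++ x :: Q2.
  by case/splitPr: xQ => Q1 Q2; exists Q1, Q2.
have [P1 [P2 defP]] : exists P1 P2, take (2 * k) P = P1 ++ y :: P2.
  by case/splitPr: yP => P1 P2; exists P1, P2.
have sQ12 : size Q1 + (size Q2).+1 = 2 * k by rewrite -sDk defQ size_cat.
have oQ1 : odd (size Q1).
  move: alQd; rewrite defQ alt_cat => /andP[_]; case: odd => // /andP[xA _].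
  by rewrite (disjointFr (dis _ _ rA) xA) in xB.
have sP12 : size P1 + (size P2).+1 = 2 * k by rewrite -sTk defP size_cat.
have oP1 : ~~ odd (size P1).
  move: alPt; rewrite defP alt_cat => /andP[_]; case: odd => // /andP[yB _].
  by rewrite (disjointFr (dis _ _ rAB) yA) in yB.
pose R := P2 ++ drop (2 * k) P.
have defP' : P = P1 ++ y :: R.
  by rewrite -{1}(cat_take_drop (2 * k) P) defP -catA.
have alR : alt (main A') (main B') (y :: R).
  by move: alP; rewrite {1}defP' alt_cat (negbTE oP1) => /andP[].
clearbody R.
have sR : size P1 + (size R).+1 = 2 * l by rewrite -sP defP' size_cat.
pose X := F0 ++ take (2 * k) Q ++ Q1.
have defF' : F = X ++ x :: Q2.
  by rewrite defF -{1}(cat_take_drop (2 * k) Q) defQ /X -!catA.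
clearbody X.
have sX : size F = size X + (size Q2).+1 by rewrite defF' size_cat.
have RP v : v \in y :: R -> v \in P by rewrite defP' mem_cat => ->; rewrite orbT.
have PAB v : v \in y :: R -> v \in main A' :|: main B'.
  by move/RP; apply: alt_subset alP v.
have P0 v : v \in y :: R -> slot v = 0.
  by move/PAB; rewrite !inE => /orP[]/andP[_ /eqP].
have XF v : v \in rcons X x -> v \in F.
  by rewrite mem_rcons defF' mem_cat !inE => /orP[->|->]; rewrite ?orbT.
exists (rcons X x ++ q ++ y :: R); split.
- split.
  + move: srt; rewrite defF' cat_rcons !sorted_cat_cons => /andP[-> _] /=.
    rewrite -cat_rcons cat_path pxy last_rcons /=.
    by move: srtP; rewrite defP'; case: (P1) => //= z s; rewrite cat_path => /andP[_ /andP[]].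
  + have uX : uniq (rcons X x).
      by move: uF; rewrite defF' -cat_rcons cat_uniq => /andP[].
    have uR : uniq (y :: R) by move: uP; rewrite defP' cat_uniq => /and3P[].
    rewrite cat_uniq uX cat_uniq uq uR andbT !andTb; apply/andP; split; last first.
      by apply/hasPn => v vR; apply/negP => /qs; rewrite P0.
    rewrite has_cat; apply/norP; split; apply/hasPn => v vv; apply/negP => /XF vF.
      by have := qF v vv; rewrite vF.
    by have := disF v vF; rewrite PAB.
  + rewrite cat_rcons takel_cat; last by move: n1F sX sQ12; slia.
    by move: al1; rewrite defF' takel_cat //; move: n1F sX sQ12; slia.
  (* The last [4 * k] vertices start at an even place of [y :: R], hence in [A']. *)
  + have [R1 [R2 [defR sR1 sR2]]] : exists R1 R2, [/\ y :: R = R1 ++ R2,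
      ~~ odd (size R1) & size R2 = 4 * k].
      exists (take ((size R).+1 - 4 * k) (y :: R)), (drop ((size R).+1 - 4 * k) (y :: R)).
      rewrite cat_take_drop size_drop size_takel /= ?leq_subr //; split=> //; last by move: sR sP12 kl; slia.
      move: oP1; rewrite oddB; last by move: sR sP12 kl; slia.
      by move/(congr1 odd): sR; rewrite oddD o2 /= -[4]/(2 * 2) -mulnA o2; case: odd; case: odd.
    exists (rcons X x ++ q ++ R1), R2; split => //; first by rewrite defR !catA.
    by move: alR; rewrite defR alt_cat (negbTE sR1) => /andP[].
  + split=> //.
    * have cAB : connect dc (A1, false) (B', ~~ a).
        by apply: connect_trans ca _; apply: connect1; rewrite /double_cover /= rAB; case: (a).
      suff <- : ~~ a = ~~ odd (size (rcons X x ++ q ++ y :: R)) by [].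
      move: par; rewrite /= => ->; rewrite !size_cat size_rcons /= sX.
      move/(congr1 odd): sQ12; move/(congr1 odd): sR; rewrite !o2 !oddD /= oQ1 (negbTE oP1).
      by do 4 case: (odd _).
    * rewrite -cats1 -catA !count_cat.
      have -> : count (fun v => slot v != 0) (y :: R) = 0.
        by apply/eqP; rewrite -leqn0 leqNgt -has_count; apply/hasPn => v /P0->.
      have := count_size (fun v => slot v != 0) q.
      by move: cntF sq; rewrite defF' count_cat /=; slia.
    * rewrite !all_cat; apply/and3P; split; apply/allP => v.
      - by move/XF; move/allP: allF; apply.
      - by move/qs => /andP[].
      - by move/P0->.
- by rewrite !size_cat size_rcons /=; move: sX sR sQ12 sP12 sq; slia.
- by rewrite !size_cat size_rcons /=; move: sX sR sQ12 sP12 sq; slia.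
- by rewrite !size_cat size_rcons /=; move: sX sR sQ12 sP12 sq; slia.
- move=> v; rewrite !mem_cat => /or3P[/XF-> //|/qs|/PAB->]; last by rewrite orbT.
  by move=> vs v0; rewrite v0 in vs.
Qed.

(** The extension stops as soon as the length reaches [d0 + 4 * k]. The last step overshoots by at
    most [2 * l + 2 * #|I|], which the last hypothesis makes small against [n1]: a window of about
    [d0] vertices ending in the last path then starts among the first [n1] vertices. Each pair
    contributes at least [2 * l - 4 * k]. *)
Lemma chain_long d0 n1 l L : forall n2 A B F,
  chain n1 n2 A B F -> n1 + 2 * k <= size F -> size F < d0 + 4 * k ->
  n2 + 2 * #|I| * size L <= k -> 3 * k <= l ->
  {in L, forall u, [/\ r u.1 u.2, exists a, connect dc (A1, false) (u.1, a),
     2 * l + 4 * k + 2 <= 2 * #|main u.1| & 2 * l + 4 * k + 2 <= 2 * #|main u.2|]} ->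
  uniq (B :: flatten [seq [:: u.1; u.2] | u <- L]) ->
  {in L & F, forall u v, v \notin main u.1 :|: main u.2} ->
  d0 + 4 * k <= size F + size L * (2 * l - 4 * k) ->
  2 * l + 4 * k + 4 * #|I| <= n1 ->
  exists A' B' F', [/\ chain n1 k A' B' F', d0 + 4 * k <= size F',
     size F' + 2 * #|I| <= d0 + n1, n1 <= size F' & (A', B') \in (A, B) :: L].
Proof.
elim: L => [|[A' B'] L IH] n2 A B F ch n1F Fd n2k kl allL uL disL tot ln1.
  by rewrite mul0n addn0 in tot; move: tot; rewrite leqNgt Fd.
have AL : (A', B') \in (A', B') :: L by rewrite inE eqxx.
have [/= rAB cA lA lB] := allL _ AL.
move: uL; rewrite /= !inE !negb_or => /andP[/and3P[BA BB BL] /andP[/andP[AB' AL'] /andP[BL' uL]]].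
have n2k' : n2 <= k by move: n2k; slia.
have [F' [ch' s1 s2 s3 dF']] := chain_step ch n2k' n1F rAB cA (disL _ ^~ AL) BA lA lB kl.
have n1F' : n1 + 2 * k <= size F' by move: n1F s1 kl; slia.
have [F'd|dF] := ltnP (size F') (d0 + 4 * k); last first.
  exists A', B', F'; split => //.
  - case: ch' => ? ? ? ? [? ? cnt ?]; split=> //; split=> //.
    apply: leq_trans cnt _; apply: leq_trans n2k; rewrite leq_add2l /= mulnS.
    by rewrite leq_addr.
  - by move: s2 Fd ln1; slia.
  - by move: n1F'; slia.
  - by rewrite !inE eqxx orbT.
suff [A2 [B2 [F2 [h1 h2 h3 h4 h5]]]] : exists A2 B2 F2, [/\ chain n1 k A2 B2 F2,
    d0 + 4 * k <= size F2, size F2 + 2 * #|I| <= d0 + n1, n1 <= size F2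
    & (A2, B2) \in (A', B') :: L].
  by exists A2, B2, F2; split=> //; rewrite inE h5 orbT.
apply: (IH (n2 + 2 * #|I|) A' B' F') => //.
- by move: n2k; rewrite /= mulnS addnA.
- by move=> u uL'; apply: allL; rewrite inE uL' orbT.
- by rewrite /= BL'.
- move=> u v uL' vF'; apply/negP => vu.
  have v0 : slot v = 0 by move: vu; rewrite !inE => /orP[]/andP[_ /eqP].
  case/orP: (dF' v vF' v0) => [vF|vAB].
    by have := disL u v; rewrite inE uL' orbT vu => /(_ isT vF).
  have uf : (u.1 \in flatten [seq [:: u.1; u.2] | u <- L]) &&
            (u.2 \in flatten [seq [:: u.1; u.2] | u <- L]).
    by apply/andP; split; apply/flatten_mapP; exists u; rewrite // !inE eqxx ?orbT.
  case/andP: uf => u1 u2; move: vu vAB; rewrite !in_setU.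
  by case/orP => vu /orP[] vu'; have [_ ee] := cell_inj vu vu'; subst;
     rewrite ?u1 ?u2 in AL' BL'.
- move: kl tot s1; rewrite /= (mulSn (size L)); move: (size L * _) => z; slia.
Qed.

Lemma chain_exists d0 q L : r A1 B1 -> 2 * #|I| <= d0 ->
  2 * #|I| * (size L).+1 <= k -> 8 * k <= q ->
  (forall i, q + 2 * k + 1 <= #|main i|) ->
  {in L, forall u, r u.1 u.2 /\ exists a, connect dc (A1, false) (u.1, a)} ->
  uniq (flatten [seq [:: u.1; u.2] | u <- (A1, B1) :: L]) ->
  d0 + 4 * k <= (size L).+1 * (2 * q - 14 * k) ->
  exists n1 A B F, [/\ chain n1 k A B F, d0 + 4 * k <= size F,
     size F + 2 * #|I| <= d0 + n1, n1 <= size F & (A, B) \in (A1, B1) :: L].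
Proof.
move=> rAB Id0 Lk kq qm allL uL tot.
have ne : A1 != B1 by apply: contraTneq rAB => ->; rewrite rirr.
have dis : [disjoint main A1 & main B1] by apply: disjoint_cell; rewrite ne orbT.
have hfAB : holefree e k (main A1) (main B1).
  by apply: holefreeS (hole rAB) => //; apply: cell_sub.
have start q' n1 : q' <= q -> 2 * k <= q' -> exists F, [/\ chain n1 0 A1 B1 F, size F = 2 * q'
     & {in F, forall v, v \in main A1 :|: main B1}].
  move=> qq kq'.
  have [|F [srt uF al sF]] := long_alternating_path (q := q') esym k0 hfAB dis (qm A1) (qm B1).
    by move: qq; slia.
  have F0 v : v \in F -> slot v = 0.
    by move/(alt_subset al); rewrite !inE => /orP[]/andP[_ /eqP].
  exists F; split=> //; last by move=> v; apply: alt_subset al v.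
  split=> //.
  - by move: al; rewrite -{1}(cat_take_drop n1 F) alt_cat => /andP[].
  - exists (take (2 * q' - 4 * k) F), (drop (2 * q' - 4 * k) F).
    rewrite cat_take_drop size_drop sF; split=> //; last by move: kq'; slia.
    move: al; rewrite -{1}(cat_take_drop (2 * q' - 4 * k) F) alt_cat => /andP[_].
    rewrite size_takel; last by rewrite sF leq_subr.
    by rewrite -[4]/(2 * 2) -mulnA -mulnBr mul2n odd_double.
  - split=> //.
    + by rewrite sF mul2n odd_double; apply: connect1; rewrite /double_cover /= rAB.
    + by rewrite leqn0 -leqn0 leqNgt -has_count; apply/hasPn => v /F0->.
    + by apply/allP => v /F0->.
have mono n1 A B F : chain n1 0 A B F -> chain n1 k A B F.
  by case=> ? ? ? ? [? ? cnt ?]; split=> //; split=> //; apply: leq_trans cnt _.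
(* If one path is long enough, it is the whole chain, and all of it serves as the initial part. *)
have [small|big] := leqP (d0 + 4 * k) (2 * q).
  have [||F [ch sF _]] := start (uphalf (d0 + 4 * k)) (2 * uphalf (d0 + 4 * k)).
  - by move: small; rewrite uphalf_half mul2n; have := odd_double_half (d0 + 4 * k); slia.
  - by rewrite uphalf_half; have := odd_double_half (d0 + 4 * k); slia.
  exists (2 * uphalf (d0 + 4 * k)), A1, B1, F; split; first exact: mono.
  - by rewrite sF uphalf_half; have := odd_double_half (d0 + 4 * k); slia.
  - by rewrite sF; move: Id0; slia.
  - by rewrite sF.
  - by rewrite inE eqxx.
have [||F [ch sF FA]] := start q (2 * q - 2 * k); [by [] | by move: kq; slia |].
(* Later paths are shorter than the first by [10 * k], so that one step cannot overshoot the initial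
   part; [2 * l - 4 * k] becomes the [2 * q - 14 * k] of the statement. *)
have [|||||||||A [B [F' H]]] := @chain_long d0 (2 * q - 2 * k) (q - 5 * k) L 0 A1 B1 F ch.
- by rewrite sF; move: kq; slia.
- by rewrite sF.
- by rewrite add0n; apply: leq_trans Lk; rewrite leq_mul2l leqnSn orbT.
- by move: kq; slia.
- move=> u /allL[ru cu]; have h1 := qm u.1; have h2 := qm u.2.
  by split=> //; [move: h1 kq|move: h2 kq]; slia.
- by move: uL => /= /and3P[_ -> ->].
- move=> u v uL' vF; apply/negP => vu.
  have uf : (u.1 \in flatten [seq [:: u.1; u.2] | u <- L]) &&
            (u.2 \in flatten [seq [:: u.1; u.2] | u <- L]).
    by apply/andP; split; apply/flatten_mapP; exists u; rewrite // !inE eqxx ?orbT.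
  case/andP: uf => u1 u2; move: uL; rewrite /= !inE !negb_or.
  case/and3P => /andP[_ A1L] B1L _; have vAB := FA v vF; move: vu vAB; rewrite !in_setU.
  by case/orP => vu /orP[] vu'; have [_ ee] := cell_inj vu vu'; move: A1L B1L;
     rewrite -ee ?u1 ?u2.
- rewrite sF; move: tot kq; rewrite (mulSn (size L)).
  have -> : 2 * (q - 5 * k) - 4 * k = 2 * q - 14 * k by slia.
  by move: (size L * _) => z; slia.
- by move: Lk; rewrite mulnS; move: kq; move: (2 * #|I| * size L) => z; slia.
by exists (2 * q - 2 * k), A, B, F'.
Qed.

End Chain.

(** * Closing a cycle *)

Section Closing.
Variables (V I : finType) (e : rel V) (r : rel I) (b : I -> {set V}).
Variables (slot : V -> nat) (D j : nat).
Local Notation k := (D ^ (2 * j)).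
Hypothesis D2 : 2 <= D.
Hypothesis esym : symmetric e.
Hypothesis rsym : symmetric r.
Hypothesis rirr : irreflexive r.
Hypothesis b_inj : forall i i' v, v \in b i -> v \in b i' -> i = i'.
Hypothesis hole : forall i i', r i i' -> holefree e k (b i) (b i').
Local Notation cell := (cell b slot).
Local Notation main := (cell 0).
Local Notation conn := (conn b slot).
Local Notation dc := (double_cover r).
Hypothesis conn_big : forall u, 3 * k <= #|conn u|.
Hypothesis tree_big : forall i, (2 * D + 8) * k <= #|cell 3 i| /\ (2 * D + 8) * k <= #|cell 4 i|.

Let k0 : 0 < k. Proof. by rewrite expn_gt0; case: D D2. Qed.

(** The cells contain an expanding pair [X], [Y], and all but fewer than [k] vertices of [main A]
    have a neighbour in [Y]. From this neighbour a tree of even depth [2 * j] ends in [Y] again,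
    with [D ^ (2 * j) = k] leaves, enough to start a link. The size [(2 * D + 8) * k] is the one
    [expanding_subpair] needs for expansion by [D.+2]. *)
Lemma rooted_tree (s : nat) A B : r A B -> (2 * D + 8) * k <= #|cell s A| ->
  (2 * D + 8) * k <= #|cell s B| ->
  exists W : {set V}, #|W| < k /\ forall x, x \in main A -> x \notin W ->
    exists L : {set V}, [/\ L \subset cell s B, k <= #|L| & forall z, z \in L ->
      exists q, [/\ path e x q, last x q = z, size q = (2 * j).+1, uniq q &
        {in q, forall v, slot v = s}]].
Proof.
move=> rAB bA bB.
have hf : holefree e k (cell s A) (cell s B).
  by apply: holefreeS (hole rAB) => //; apply: cell_sub.
have [|X [Y [XA YB [cX cY] exX exY]]] := expanding_subpair (D := D.+2) esym k0 hf bA bB.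
  by rewrite leq_mul2r; apply/orP; right; clear; lia.
have kY : k <= #|Y| by move: bB cY; rewrite mulnDl; slia.
exists (main A :\: nbhd e Y); split.
  rewrite (@few_non_neighbours _ _ k (b B)) //.
    by apply: holefreeS (hole (_ : r B A)); rewrite ?subxx ?cell_sub // rsym.
  by apply: subset_trans YB (cell_sub _ _ _ _).
move=> x xA; rewrite in_setD xA andbT negbK inE => /exists_inP[x' x'Y ex'].
have [|U [L [LY cL UL [UXY dUL] pth]]] := tree_layer (n := 2 * j) D2 exX exY x'Y.
  by move=> i lt; rewrite leq_exp2l // ltnW.
rewrite mul2n odd_double in LY.
exists L; rewrite cL; split => //; first exact: subset_trans LY YB.
move=> z zL; have [q [pq lq sq uq bq]] := pth z zL.
exists (x' :: q); split => //=; rewrite ?sq // 1?esym ?ex' //.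
move=> v; rewrite lastI mem_rcons inE lq.
have XY u : u \in X :|: Y -> slot u = s.
  by rewrite inE => /orP[/(subsetP XA)|/(subsetP YB)]; rewrite inE => /andP[_ /eqP].
case/orP => [/eqP->|/bq vU]; apply: XY; last exact: (subsetP UXY).
by rewrite inE (subsetP LY) ?orbT.
Qed.

Variables (A1 B1 : I).
Local Notation chain := (chain e r b slot k A1 B1).

(** The cycle consists of a stretch of the chain from [A1] to [B], a branch of a tree grown from
    each end of it, and a link between the two sets of leaves. The trees use slots 3 and 4, which
    the chain and the link avoid. *)
Lemma close_cycle d0 n1 A B F : r A1 B1 -> chain n1 k A B F ->
  d0 + 4 * k <= size F -> size F + 2 * #|I| <= d0 + n1 -> n1 <= size F ->
  2 * #|I| <= d0 -> B1 != A ->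
  ~~ odd d0 || connect dc (A1, false) (A1, true) ->
  exists c, [/\ cycle e c, uniq c & size c = d0 + 4 * j + 2].
Proof.
move=> r1 [srt uF al1 [F0 [Q [defF alQ sQ]]] [rAB cF cntF allF]] dF Fn nF Id0 B1A par.
have ne i i' : r i i' -> i != i' by apply: contraTneq => ->; rewrite rirr.
have dis i i' : r i i' -> [disjoint main i & main i'].
  by move=> rii; apply: disjoint_cell; rewrite // ne // orbT.
have [WX [cWX treeX]] := rooted_tree r1 (tree_big A1).1 (tree_big B1).1.
have rBA : r B A by rewrite rsym.
have [WY [cWY treeY]] := rooted_tree rBA (tree_big B).2 (tree_big A).2.
have dcsym := sym_connect_sym (double_cover_sym rsym).
(* The link leads from leaves in [A] to leaves in [B1]. Its target sheet is chosen so that the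
   window will start at an even place of the chain, hence in [A1]. For even [d0] walking back along
   the chain has this parity; for odd [d0] an odd closed walk is inserted. *)
have cl : connect dc (A, ~~ odd (size F)) (B1, odd d0).
  have c1 : connect dc (A1, false) (B1, true).
    by apply: connect1; rewrite /double_cover /= r1.
  have c2 : connect dc (B, ~~ odd (size F)) (A, odd (size F)).
    by apply: connect1; rewrite /double_cover /= rBA; case: odd.
  have c3 : connect dc (A, odd (size F)) (B1, true).
    rewrite dcsym; apply: connect_trans (connect_trans cF c2).
    by rewrite dcsym.
  have /= c4 := connect_flip c3; apply: connect_trans c4 _.
  case: (boolP (odd d0)) par => [_ /= c5|_ _]; last exact: connect0.
  have /= c6 := connect_flip c1; rewrite dcsym in c6.
  by apply: connect_trans c6 _; rewrite dcsym in c5; apply: connect_trans c5 c1.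
have [|p [pth up sp]] := connect_simple_path cl.
  by rewrite xpair_eqE negb_and eq_sym B1A.
have up' : uniq p by move: up; rewrite rcons_uniq => /andP[].
have parp : odd d0 = ~~ odd (size F) (+) ~~ odd (size p).
  by have := double_cover_parity pth; rewrite last_rcons size_rcons.
(* The stretch has [d + 1] vertices, the link [size p] inner ones and each branch [2 * j + 1], in
   all [d0 + 4 * j + 2]. *)
pose d := d0 - (size p).+1.
have dd0 : d + (size p).+1 = d0 by rewrite /d; move: sp Id0; slia.
have sF : size F = size F0 + 4 * k by rewrite defF size_cat sQ.
have oF : odd (size F) = odd (size F0).
  by rewrite sF oddD -[4]/(2 * 2) -mulnA mul2n odd_double addbF.
have od : odd d = odd (size F0).+1.
  move: parp; rewrite -dd0 oddD oF /=.
  by case: (odd d); case: (odd (size p)); case: odd.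
have F_gt0 : 0 < size F by apply: leq_trans dF; rewrite addn_gt0 muln_gt0 k0 orbT.
have [x0 _] : exists x0 : V, true by case: (F) F_gt0 => // x0 ?; exists x0.
pose yy (q : 'I_(2 * k)) := nth x0 F (size F0 + (2 * q).+1).
pose xx (q : 'I_(2 * k)) := nth x0 F (size F0 + (2 * q).+1 - d).
have q4 (q : 'I_(2 * k)) : (2 * q).+1 < 4 * k.
  by have := ltn_ord q; move: (nat_of_ord q) => z; move: (k) => kk; slia.
have yyB q : yy q \in main B.
  rewrite /yy defF nth_cat ltnNge leq_addr /= addKn.
  have := alt_nth x0 alQ (i := (2 * q).+1); rewrite sQ q4 => /(_ isT).
  by rewrite /= mul2n odd_double.
have ixx (q : 'I_(2 * k)) : size F0 + (2 * q).+1 - d < n1.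
  have := q4 q; move: (nat_of_ord q) => z; move: sF Fn dF dd0 sp.
  move: k0; move: (k) => kk; slia.
have dF0 : d <= size F0 by move: dF dd0 sF; move: (k) => kk; slia.
have xxA q : xx q \in main A1.
  have := alt_nth x0 al1 (i := size F0 + (2 * q).+1 - d).
  rewrite size_takel // ixx => /(_ isT); rewrite nth_take //.
  have -> // : odd (size F0 + (2 * q).+1 - d) = false.
  rewrite oddB; last by apply: leq_trans dF0 (leq_addr _ _).
  by rewrite od oddD /= mul2n odd_double; case: odd.
(* Of the [2 * k] windows fewer than [k] start at a vertex without a tree and fewer than [k] end at
   one. *)
have [q /andP[qx qy]] : exists q, (xx q \notin WX) && (yy q \notin WY).
  case: (pickP (fun q => (xx q \notin WX) && (yy q \notin WY))) => [q qq|none].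
    by exists q.
  exfalso.
  have inj f (W : {set V}) : injective f -> #|[set q : 'I_(2 * k) | f q \in W]| <= #|W|.
    move=> fi; rewrite -(card_imset _ fi); apply/subset_leq_card/subsetP => v.
    by case/imsetP => u; rewrite inE => uW ->.
  have injx : injective xx.
    move=> u v /eqP; rewrite nth_uniq //; try by apply: leq_trans (ixx _) nF.
    move=> /eqP uv; apply/val_inj => /=; move: uv dF0; clear; lia.
  have injy : injective yy.
    move=> u v /eqP; rewrite nth_uniq //; try by rewrite sF ltn_add2l q4.
    move=> /eqP uv; apply/val_inj => /=; move: uv; clear; lia.
  have := leq_add (inj _ WX injx) (inj _ WY injy).
  suff : 2 * k <= #|[set q | xx q \in WX]| + #|[set q | yy q \in WY]|.
    move=> h1 h2; have := leq_trans (leq_add cWX (ltnW cWY)) (leqnn _).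
    by rewrite addSn ltnNge addnn -mul2n (leq_trans h1 h2).
  apply: (@leq_trans #|[set: 'I_(2 * k)]|); first by rewrite cardsT card_ord.
  apply: leq_trans (leq_card_setU _ _).
  apply/subset_leq_card/subsetP => u _; have := negbT (none u).
  by rewrite !inE negb_and !negbK.
have [LX [LXB kLX pX]] := treeX _ (xxA q) qx.
have [LY [LYA kLY pY]] := treeY _ (yyB q) qy.
have [||||zy [qc [zx [zyL zxL pc uc [qcF qcs sqc]]]]] :=
  @fresh_path _ _ _ _ b slot k b_inj hole conn_big F _ _ p LY LX cntF pth up'.
- exact: subset_trans LYA (cell_sub _ _ _ _).
- by [].
- exact: subset_trans LXB (cell_sub _ _ _ _).
- by [].
have [qx' [px lx sx ux slx]] := pX zx zxL.
have [qy' [py ly sy uy sly]] := pY zy zyL.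
pose ix := size F0 + (2 * q).+1 - d.
have ixF : ix + d < size F.
  by rewrite /ix subnK; [rewrite sF ltn_add2l q4|apply: leq_trans dF0 (leq_addr _ _)].
pose G := take d (drop ix.+1 F).
have sG : size G = d by rewrite size_takel // size_drop; move: ixF; slia.
have defG : drop ix F = (xx q :: G) ++ drop (ix + d).+1 F.
  rewrite (drop_nth x0); last by apply: leq_ltn_trans ixF; rewrite leq_addr.
  by rewrite /= -/(xx q) -addSn addnC -drop_drop cat_take_drop.
have lG : last (xx q) G = yy q.
  rewrite (last_nth x0) sG /yy; have <- : ix + d = size F0 + (2 * q).+1.
    by rewrite /ix subnK // (leq_trans dF0) ?leq_addr.
  rewrite -nth_drop defG nth_cat /= sG ltnS leqnn.
  by [].
have pG : path e (xx q) G.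
  by have := drop_sorted ix srt; rewrite defG /= cat_path => /andP[].
have uG : uniq (xx q :: G).
  by have := drop_uniq ix uF; rewrite defG cat_uniq => /andP[].
have GF v : v \in xx q :: G -> v \in F.
  by move=> vG; apply: (mem_drop (n0 := ix)); rewrite defG mem_cat vG.
case/lastP: qx' => [|qx' z] in px lx sx ux slx *; first by [].
rewrite last_rcons in lx; subst z.
exists ((xx q :: G) ++ qy' ++ qc ++ rev (rcons qx' zx)); split.
- rewrite /= rcons_cat cat_path pG lG /= rcons_cat cat_path py ly /=.
  rewrite rcons_cat rev_rcons /= -cat_rcons cat_path pc last_rcons /=.
  rewrite -rev_cons; have := rev_path e (xx q) (rcons qx' zx).
  rewrite last_rcons belast_rcons => ->.
  by rewrite (eq_path (e' := e)) // => u v; rewrite esym.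
- rewrite cat_uniq uG cat_uniq uy cat_uniq uc rev_uniq ux !andbT !andTb.
  apply/and3P; split.
  + apply/hasPn => v; rewrite !mem_cat mem_rev => vv; apply/negP => /GF vF.
    have v3 := allP allF v vF.
    case/or3P: vv => [/sly vs|/qcF|/slx vs]; first by rewrite vs in v3.
      by rewrite vF.
    by rewrite vs in v3.
  + apply/hasPn => v; rewrite mem_cat mem_rev => vv; apply/negP => /sly vs.
    by case/orP: vv => [/qcs|/slx]; rewrite vs.
  + by apply/hasPn => v; rewrite mem_rev => /slx vs; apply/negP => /qcs; rewrite vs.
- rewrite !size_cat size_rev sx sy /= sG sqc; move: dd0; slia.
Qed.

End Closing.

Lemma slots_of_card (V : finType) (S : {set V}) (ns : seq nat) : sumn ns <= #|S| ->
  exists slot : V -> nat, forall s, s < size ns ->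
    nth 0 ns s <= #|[set v in S | slot v == s]|.
Proof.
elim: ns S => [|n ns IH] S /= cS; first by exists (fun=> 0).
have [|A AS cA] := @subset_of_card _ S n; first exact: leq_trans (leq_addr _ _) cS.
have [|slot sP] := IH (S :\: A).
  by rewrite cardsDS // cA; move: cS; slia.
exists (fun v => if v \in A then 0 else (slot v).+1) => -[_|s /sP] /=.
  rewrite -cA; apply/subset_leq_card/subsetP => v vA.
  by rewrite inE vA (subsetP AS).
move=> /leq_trans; apply; apply/subset_leq_card/subsetP => v.
by rewrite !inE => /andP[/andP[/negbTE-> ->] sv]; rewrite eqSS sv.
Qed.

(** The block size is the sum of the five slots: [q + 2 * k + 1] for the long path, twice [3 * k]
    for links and twice [(2 * D + 8) * k] for trees. *)
Lemma cycle_of_matching (V I : finType) (e : rel V) (r : rel I) (b : I -> {set V})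
    D j i0 (M : seq (I * I)) q d0 : let k := D ^ (2 * j) in
  2 <= D -> symmetric e -> symmetric r -> irreflexive r ->
  (forall i i' v, v \in b i -> v \in b i' -> i = i') ->
  (forall i i', r i i' -> holefree e k (b i) (b i')) ->
  (forall i, q + 1 + (4 * D + 24) * k <= #|b i|) ->
  M != [::] -> {in M, forall u, r u.1 u.2 && connect r i0 u.1} ->
  uniq (flatten [seq [:: u.1; u.2] | u <- M]) ->
  8 * k <= q -> 2 * #|I| <= d0 -> 2 * #|I| * size M <= k ->
  d0 + 4 * k <= size M * (2 * q - 14 * k) ->
  ~~ odd d0 || connect (double_cover r) (i0, false) (i0, true) ->
  exists c, [/\ cycle e c, uniq c & size c = d0 + 4 * j + 2].
Proof.
move=> k D2 esym rsym rirr b_inj hole bq M0 MP uM kq Id0 IM tot par.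
pose ns := [:: q + 2 * k + 1; 3 * k; 3 * k; (2 * D + 8) * k; (2 * D + 8) * k].
have /fin_all_exists[f fP] i : exists slot : V -> nat, forall s, s < 5 ->
    nth 0 ns s <= #|[set v in b i | slot v == s]|.
  apply: (@slots_of_card _ (b i) ns); apply: leq_trans (bq i).
  by rewrite /= addn0 !mulnDl; clear; lia.
pose slot v := if [pick i | v \in b i] is Some i then f i v else 0.
have slotE i s : s < 5 -> nth 0 ns s <= #|cell b slot s i|.
  move=> s5; apply: leq_trans (fP i s s5) _; apply/subset_leq_card/subsetP => v.
  rewrite !inE /slot => /andP[vi sv]; rewrite vi /=.
  by case: pickP => [i' vi'|/(_ i)]; rewrite ?vi // -(b_inj _ _ _ vi vi').
have conn_big u : 3 * k <= #|conn b slot u|.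
  by case: u => i [] /=; [apply: (slotE i 2)|apply: (slotE i 1)].
case: M M0 MP uM IM tot => // -[A1 B1] L _ MP uM IM tot.
have inh : (A1, B1) \in (A1, B1) :: L by rewrite inE eqxx.
have /andP[/= r1 c1] := MP _ inh.
have k0 : 0 < k by rewrite expn_gt0; case: (D) D2.
have rc := sym_connect_sym rsym.
have [||n1 [A [B [F [ch dF Fn nF AB]]]]] := chain_exists esym rsym rirr
  k0 b_inj hole conn_big r1 Id0 IM kq _ _ uM tot.
- by move=> i; have := slotE i 0 isT; rewrite /= addnAC.
- move=> u uL; have := MP u; rewrite inE uL orbT => /(_ isT)/andP[ru cu]; split=> //.
  by apply: connect_double_cover; apply: connect_trans cu; rewrite rc.
have B1A : B1 != A.
  move: uM; rewrite /= !inE negb_or => /and3P[/andP[nAB _] B1L _].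
  move: AB; rewrite inE => /orP[/eqP[-> _]|AL]; first by rewrite eq_sym.
  apply: contraNneq B1L => ->; apply/flatten_mapP; exists (A, B) => //.
  by rewrite inE eqxx.
apply: (close_cycle D2 esym rsym rirr b_inj hole conn_big) ch dF Fn nF Id0 B1A _ => //.
  by move=> i; split; [apply: (slotE i 3)|apply: (slotE i 4)].
case/orP: par => [->//|cc]; apply/orP; right.
(* The odd closed walk at [i0] is carried to [A1], on whichever sheet [A1] is reached. *)
have [a ca] := connect_double_cover false c1.
have ca' := connect_flip ca.
have rdc := sym_connect_sym (double_cover_sym rsym).
have key a1 : connect (double_cover r) (i0, a1) (i0, ~~ a1).
  by case: a1 => //=; rewrite rdc.
have [h1 h2] : connect (double_cover r) (i0, a) (A1, false) /\
               connect (double_cover r) (i0, ~~ a) (A1, true).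
  by move: ca ca'; case: (a) => /= x y; split.
by rewrite rdc in h1; apply: connect_trans h1 (connect_trans (key a) h2).
Qed.

(** * Partitions with few holed pairs *)

Lemma card_set_type (T : finType) : #|{: {set T}}| = 2 ^ #|T|.
Proof. by have := card_powerset [set: T]; rewrite powersetT !cardsT. Qed.

Section Refinement.
Variables (V : finType) (e : rel V).

(** The blocks need not cover the vertices: exactly equal sizes are bought with an uncovered rest,
    measured by [waste]. *)
Definition blocks (m : nat) (P : {set {set V}}) : bool :=
  trivIset P && [forall A in P, #|A| == m].

Definition waste (P : {set {set V}}) : nat := #|~: cover P|.

Definition holed (E : nat) (A B : {set V}) : bool :=
  ~~ edgeless e A B &&
  [exists X : {set V}, exists Y : {set V}, [&& X \subset A, Y \subset B,
     #|A| <= E * #|X|, #|B| <= E * #|Y| & edgeless e X Y]].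

Definition nholed (E : nat) (P : {set {set V}}) : nat :=
  #|[set AB in setX P P | holed E AB.1 AB.2]|.

(* The potential of the refinement process is [#|void P|]. *)
Definition void (P : {set {set V}}) : {set V * V} :=
  [set xy | [exists A in P, exists B in P,
               [&& xy.1 \in A, xy.2 \in B & edgeless e A B]]].

Lemma voidP (P : {set {set V}}) x y :
  reflect (exists A B : {set V}, [/\ A \in P, B \in P, x \in A, y \in B & edgeless e A B])
  ((x, y) \in void P).
Proof.
rewrite inE; apply: (iffP exists_inP) => [[A AP /exists_inP[B BP /and3P[]]]|[A [B [AP BP xA yB eAB]]]].
  by move=> xA yB eAB; exists A, B.
by exists A => //; apply/exists_inP; exists B; rewrite // xA yB eAB.
Qed.

Lemma blocksP m (P : {set {set V}}) : reflect (trivIset P /\ forall A : {set V}, A \in P -> #|A| = m) (blocks m P).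
Proof.
apply: (iffP andP) => -[tP H]; split=> //.
  by move=> A AP; apply/eqP; apply: (forall_inP H).
by apply/forall_inP => A /H->.
Qed.

Lemma blocks_cover m P : blocks m P -> #|P| * m = #|cover P|.
Proof.
case/blocksP => /eqP <- H; rewrite (eq_bigr (fun=> m)) ?sum_nat_const //.
Qed.

Lemma trivIset_unique (P : {set {set V}}) A B x : trivIset P -> A \in P -> B \in P ->
  x \in A -> x \in B -> A = B.
Proof. by move=> tP AP BP xA xB; rewrite -(def_pblock tP AP xA) (def_pblock tP BP xB). Qed.

Lemma edgelessS (A B A' B' : {set V}) : A' \subset A -> B' \subset B ->
  edgeless e A B -> edgeless e A' B'.
Proof.
move=> sA sB /edgelessP H; apply/edgelessP => x y xA yB.
by apply: H; [apply: (subsetP sA)|apply: (subsetP sB)].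
Qed.

(** In a largest family of disjoint monochromatic [m]-sets, fewer than [m] vertices of each colour
    are left over. *)
Lemma chop (F : finType) (col : V -> F) (S : {set V}) m : 0 < m ->
  exists P : {set {set V}}, [/\ blocks m P, cover P \subset S,
    forall (A : {set V}) x y, A \in P -> x \in A -> y \in A -> col x = col y &
    #|S :\: cover P| <= #|F| * m].
Proof.
move=> m0.
pose ok P := [&& blocks m P, cover P \subset S &
  [forall A in P, forall x in A, forall y in A, col x == col y]].
have ok0 : ok set0.
  apply/and3P; split; last by apply/forall_inP => A; rewrite inE.
    by apply/blocksP; split=> [|A]; rewrite ?inE //; apply/trivIsetP => A B; rewrite inE.
  by rewrite /cover big_set0 sub0set.
have [P /and3P[bP PS mono] mx] := @arg_maxnP _ set0 ok (fun P => #|P|) ok0.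
exists P; split=> //.
  move=> A x y AP xA yA; apply/eqP.
  by have /forall_inP/(_ x xA)/forall_inP/(_ y yA) := forall_inP mono A AP.
rewrite leqNgt; apply/negP => big.
have [c cbig] : exists c, m <= #|[set x in S :\: cover P | col x == c]|.
  case: (pickP (fun c => m <= #|[set x in S :\: cover P | col x == c]|)) => [c ?|none].
    by exists c.
  move: big; rewrite ltnNge; case/negP.
  rewrite -sum1_card (partition_big col xpredT) //= -sum_nat_const.
  apply: leq_sum => c _; have /negbT := none c; rewrite -ltnNge => /ltnW.
  apply: leq_trans; rewrite -[X in _ <= X]sum1_card; apply/eq_leq/eq_bigl => x.
  by rewrite !inE.
have [A AS cA] := subset_of_card cbig.
have AD x : x \in A -> [/\ x \in S, x \notin cover P & col x = c].
  by move/(subsetP AS); rewrite !inE => /andP[/andP[-> ->] /eqP->].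
have [tP cP] := blocksP _ _ bP.
have dA : {in P, forall B : {set V}, [disjoint A & B]}.
  move=> B BP; apply/pred0P => x /=; apply/negP => /andP[xA xB].
  by have [_ /bigcupP[]] := AD x xA; exists B.
have P0 : set0 \notin P.
  by apply/negP => /cP; rewrite cards0 => m0'; rewrite -m0' in m0.
have [tU AP] := trivIsetU1 dA tP P0.
suff /mx : ok (A |: P) by rewrite /geq /= cardsU1 AP add1n ltnn.
apply/and3P; split.
- apply/blocksP; split=> // B; rewrite in_setU1 => /orP[/eqP->|/cP] //.
- apply/bigcupsP => B; rewrite in_setU1 => /orP[/eqP->|BP].
    by apply/subsetP => x /AD[].
  by apply: subset_trans PS; apply: (bigcup_max B).
- apply/forall_inP => B; rewrite in_setU1 => /orP[/eqP->|BP]; last exact: (forall_inP mono).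
  by apply/forall_inP => x /AD[_ _ ->]; apply/forall_inP => y /AD[_ _ ->].
Qed.

(** A vertex is coloured by its block and by the sides of the chosen holes that contain it, which
    gives at most [f] colours. Monochromatic blocks make every hole a union of edgeless pairs, up to
    leftover vertices. So [void] gains the area of all holes, at least [m ^ 2 / E ^ 2] each, and
    loses only pairs with a leftover coordinate. *)
Lemma refine E m m' P : blocks m P -> 0 < m' ->
  let f := 2 ^ (#|P| + 2 * #|P| ^ 2) in
  exists P', [/\ blocks m' P', waste P' <= waste P + f * m' &
    E ^ 2 * #|void P| + nholed E P * m ^ 2 <=
    E ^ 2 * #|void P'| + 2 * E ^ 2 * #|V| * (f * m')].
Proof.
move=> bP m0 f; have [tP cP] := blocksP _ _ bP.
pose b (i : 'I_#|P|) := enum_val i.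
have bP' i : b i \in P by apply: enum_valP.
have binj i i' x : x \in b i -> x \in b i' -> i = i'.
  by move=> xi xi'; apply: enum_val_inj; apply: trivIset_unique tP (bP' i) (bP' i') xi xi'.
have /fin_all_exists[h hP] (ii : 'I_#|P| * 'I_#|P|) : exists XY : {set V} * {set V},
    [/\ XY.1 \subset b ii.1, XY.2 \subset b ii.2, edgeless e XY.1 XY.2 &
     holed E (b ii.1) (b ii.2) -> m ^ 2 <= E ^ 2 * (#|XY.1| * #|XY.2|)].
  case: (boolP (holed E (b ii.1) (b ii.2))) => [/andP[_ /existsP[X /existsP[Y]]]|_].
    case/and5P => Xb Yb cX cY eXY; exists (X, Y); split=> // _ /=.
    by have := leq_mul cX cY; rewrite !(cP _ (bP' _)) mulnACA -!mulnn.
  exists (set0, set0); rewrite /= !sub0set; split=> //.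
  by apply/edgelessP => x y; rewrite inE.
pose col x := ([set i | x \in b i], [set ii | x \in (h ii).1], [set ii | x \in (h ii).2]).
have [P' [bP'' P'P mono Dbig]] := chop col (cover P) m0.
have cF : #|{: {set 'I_#|P|} * {set 'I_#|P| * 'I_#|P|} * {set 'I_#|P| * 'I_#|P|}}| = f.
  by rewrite !card_prod !card_set_type !card_prod card_ord /f -!expnD mul2n -addnn addnA -mulnn.
rewrite cF in Dbig.
exists P'; split => //.
  rewrite /waste; apply: leq_trans (_ : #|(~: cover P) :|: (cover P :\: cover P')| <= _).
    by apply/subset_leq_card/subsetP => x; rewrite !inE => ->; case: (x \in cover P).
  by apply: leq_trans (leq_card_setU _ _) _; rewrite leq_add2l.
pose bad := [set ii : 'I_#|P| * 'I_#|P| | holed E (b ii.1) (b ii.2)].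
pose Hl := [set xy : V * V | [exists ii in bad, (xy.1 \in (h ii).1) && (xy.2 \in (h ii).2)]].
have cbad : nholed E P <= #|bad|.
  rewrite /nholed -(card_imset (mem bad) (f := fun ii => (b ii.1, b ii.2))); last first.
    by move=> [i j] [i' j'] [/enum_val_inj-> /enum_val_inj->].
  apply/subset_leq_card/subsetP => -[A B]; rewrite !inE /= => /andP[/andP[AP BP] hAB].
  apply/imsetP; exists (enum_rank_in AP A, enum_rank_in BP B); rewrite ?inE /= /b !enum_rankK_in //.
have cH : nholed E P * m ^ 2 <= E ^ 2 * #|Hl|.
  apply: (@leq_trans (\sum_(ii in bad) E ^ 2 * #|setX (h ii).1 (h ii).2|)).
    rewrite -big_distrr /= big_distrr /=.
    apply: (@leq_trans (\sum_(ii in bad) m ^ 2)); first by rewrite sum_nat_const leq_mul2r cbad orbT.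
    by apply: leq_sum => ii; rewrite inE cardsX => hh; case: (hP ii) => _ _ _; apply.
  rewrite -big_distrr leq_mul2l; apply/orP; right.
  have -> : \sum_(ii in bad) #|setX (h ii).1 (h ii).2| =
            \sum_(ii in bad) \sum_(xy in Hl) (xy \in setX (h ii).1 (h ii).2).
    apply: eq_bigr => ii iib; rewrite -sum1_card big_mkcond [RHS]big_mkcond /=.
    apply: eq_bigr => -[x y] _; rewrite in_setX /=; case: ifP => xy; last by rewrite if_same.
    by rewrite inE ifT //; apply/exists_inP; exists ii.
  rewrite exchange_big /= -[X in _ <= X]sum1_card; apply: leq_sum => -[x y] _.
  case: (pickP (fun ii => (ii \in bad) && ((x, y) \in setX (h ii).1 (h ii).2))) => [ii /andP[iib xyi]|none].
    rewrite (bigD1 ii) //= xyi big1 // => jj /andP[_ ne]; apply/eqP; rewrite eqb0.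
    apply: contra ne; rewrite !in_setX /= => /andP[xj yj].
    move: xyi; rewrite in_setX /= => /andP[xi yi].
    have [/subsetP i1 /subsetP i2 _ _] := hP ii; have [/subsetP j1 /subsetP j2 _ _] := hP jj.
    rewrite (surjective_pairing ii) (surjective_pairing jj).
    by rewrite (binj _ _ x (j1 _ xj) (i1 _ xi)) (binj _ _ y (j2 _ yj) (i2 _ yi)).
  by rewrite big1 // => ii iib; apply/eqP; rewrite eqb0; have := none ii; rewrite iib /= => ->.
(* A holed pair spans an edge, so its hole is not yet counted in [void P]. *)
have dSH : [disjoint void P & Hl].
  apply/pred0P => -[x y] /=; apply/negP => /andP[/voidP[A [B [AP BP xA yB eAB]]]].
  rewrite inE => /exists_inP[ii]; rewrite inE => /andP[ne _] /andP[xi yi].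
  have [/subsetP i1 /subsetP i2 _ _] := hP ii; move: ne.
  rewrite (trivIset_unique tP (bP' _) AP (i1 _ xi) xA).
  by rewrite (trivIset_unique tP (bP' _) BP (i2 _ yi) yB) eAB.
pose U := cover P :\: cover P'.
have sub : void P :|: Hl \subset void P' :|: (setX U setT :|: setX setT U).
  apply/subsetP => -[x y] xyS; rewrite !in_setU !in_setX !in_setT andbT /=.
  have [xP yP] : x \in cover P /\ y \in cover P.
    move: xyS; rewrite in_setU => /orP[/voidP[A [B [AP BP xA yB _]]]|].
      by split; apply/bigcupP; [exists A|exists B].
    rewrite inE => /exists_inP[ii _ /andP[/= xi yi]]; have [/subsetP i1 /subsetP i2 _ _] := hP ii.
    by split; apply/bigcupP; [exists (b ii.1); rewrite ?i1|exists (b ii.2); rewrite ?i2].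
  case: (boolP (x \in U)) => xU; first by rewrite orbT.
  case: (boolP (y \in U)) => yU; first by rewrite !orbT.
  rewrite !orbF; move: xU yU; rewrite !in_setD xP yP !andbT !negbK.
  move=> /bigcupP[A' AP' xA'] /bigcupP[B' BP' yB'].
  apply/voidP; exists A', B'; split=> //.
  have c1 z i : z \in A' -> (x \in b i) = (z \in b i).
    by move=> zA; have [/setP/(_ i)] := mono _ _ _ AP' xA' zA; rewrite !inE.
  have c2 z i : z \in B' -> (y \in b i) = (z \in b i).
    by move=> zB; have [/setP/(_ i)] := mono _ _ _ BP' yB' zB; rewrite !inE.
  move: xyS; rewrite in_setU => /orP[/voidP[A [B [AP BP xA yB eAB]]]|].
    have [i defA] : exists i, A = b i by exists (enum_rank_in AP A); rewrite /b enum_rankK_in.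
    have [i' defB] : exists i, B = b i by exists (enum_rank_in BP B); rewrite /b enum_rankK_in.
    apply: edgelessS eAB; apply/subsetP => z zz; rewrite ?defA ?defB.
      by rewrite -(c1 z) // -defA.
    by rewrite -(c2 z) // -defB.
  rewrite inE => /exists_inP[ii _ /andP[/= xi yi]]; have [_ _ eh _] := hP ii.
  apply: edgelessS eh; apply/subsetP => z zz.
    by have [_ /setP/(_ ii)] := mono _ _ _ AP' xA' zz; rewrite !inE xi => <-.
  by have [_ _ /setP/(_ ii)] := mono _ _ _ BP' yB' zz; rewrite !inE yi => <-.
have := subset_leq_card sub; rewrite cardsU (disjoint_setI0 dSH) cards0 subn0.
have u1 := leq_card_setU (void P') (setX U setT :|: setX setT U).
have u2 := leq_card_setU (setX U [set: V]) (setX [set: V] U).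
rewrite !cardsX cardsT in u2 => ineq.
have ineq2 : #|void P| + #|Hl| <= #|void P'| + 2 * #|V| * (f * m').
  apply: leq_trans ineq _; apply: leq_trans u1 _; rewrite leq_add2l.
  apply: leq_trans u2 _; rewrite mulnC -mulnDr addnn -mul2n mulnA [#|V| * 2]mulnC.
  by rewrite leq_mul2l Dbig orbT.
apply: (@leq_trans (E ^ 2 * (#|void P| + #|Hl|))); first by rewrite mulnDr leq_add2l.
apply: (@leq_trans (E ^ 2 * (#|void P'| + 2 * #|V| * (f * m')))).
  by rewrite leq_mul2l ineq2 orbT.
by rewrite mulnDr leq_add2l [2 * E ^ 2]mulnC -!mulnA.
Qed.

End Refinement.

(** While the last condition fails, the holes have total area above [#|V| ^ 2 / c] with
    [c = 4 * E ^ 2 * H], where the 4 comes from blocks covering at least half of the vertices.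
    Leftover vertices cost at most half of this gain, so [void] grows by [#|V| ^ 2 / (2 * c)] per
    round. *)
Theorem hole_regularity E H Q K0 : 0 < E -> 0 < H ->
  exists Kmax, forall (V : finType) (e : rel V), Kmax <= #|V| ->
    exists P m, [/\ blocks m P, 0 < m, K0 <= #|P| <= Kmax,
      waste P * Q <= #|V| & nholed e E P * H <= #|P| ^ 2].
Proof.
move=> E0 H0.
pose c := 4 * E ^ 2 * H; pose R := 2 * c + 1.
(* One round wastes at most the fraction [1 / Th]. The three summands keep the total waste below
   [1 / Q] and [1 / 2], the loss in a round below half of its gain, and the number of blocks above
   [K0]. *)
pose Th := (R + 1) * (Q + 2) + 4 * c + 2 * K0.
have c0 : 0 < c by rewrite /c !muln_gt0 E0 H0.
have Th0 : 0 < Th by rewrite /Th /R; clear -c0; lia.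
have ThQ : (R + 1) * Q <= Th by rewrite /Th mulnDr; clear; lia.
have Th2 : (R + 1) * 2 <= Th by rewrite /Th mulnDr; clear; lia.
(* [T] is the number of rounds still allowed and [Kb] bounds the current number of blocks. The final
   bound [Kmax] is produced before the graph, since it must not depend on it. *)
suff loop T Kb : T <= R -> exists Kmax, forall (V : finType) (e : rel V) P m,
    blocks m P -> 0 < m -> #|P| <= Kb -> Kmax <= #|V| ->
    0 < #|V| -> m * (2 * K0) <= #|V| ->
    waste P * Th <= (R + 1 - T) * #|V| -> (R - T) * #|V| ^ 2 <= 2 * c * #|void e P| ->
    exists P' m', [/\ blocks m' P', 0 < m', K0 <= #|P'| <= Kmax,
      waste P' * Q <= #|V| & nholed e E P' * H <= #|P'| ^ 2].
  have [K1 K1P] := loop R (2 * Th) (leqnn _).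
  exists (K1 + Th) => V e Vbig.
  have V0 : 0 < #|V| by move: Vbig Th0; slia.
  pose m := #|V| %/ Th.
  have m0 : 0 < m by rewrite divn_gt0 //; move: Vbig; slia.
  have mTh : m * Th <= #|V| by apply: leq_trunc_div.
  have [P [bP _ _ wP]] := chop (fun _ : V => tt) setT m0.
  have cP := blocks_cover bP.
  have PK : #|P| <= 2 * Th.
    rewrite -(leq_pmul2r m0) cP; apply: leq_trans (max_card _) _.
    have := ltn_ceil #|V| Th0; rewrite -/m mulSn => h.
    have h2 : Th <= m * Th by rewrite leq_pmull.
    by rewrite -mulnA mul2n -addnn [Th * m]mulnC; apply: ltnW (leq_trans h _); rewrite leq_add2r.
  have [||||P' [m' [bP' m'0 PK' w' n']]] := K1P V e P m bP m0 PK _ V0.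
  - by move: Vbig; slia.
  - by apply: leq_trans mTh; rewrite leq_mul2l /Th; apply/orP; right; clear; lia.
  - rewrite addnC addnK mul1n; apply: leq_trans mTh; rewrite leq_mul2r.
    by rewrite /waste -setTD (leq_trans wP) ?card_unit ?mul1n ?orbT.
  - by rewrite subnn mul0n.
  exists P', m'; split=> //; case/andP: PK' => -> h; rewrite (leq_trans h) //.
  by rewrite leq_addr.
elim: T Kb => [|T IH] Kb TR.
  (* After [R = 2 * c + 1] rounds [void] would exceed [#|V| ^ 2]. *)
  exists 0 => V e P m bP m0 _ _ V0 _ _; rewrite subn0 => h.
  exfalso; move: h; rewrite leqNgt => /negP; apply.
  apply: (@leq_ltn_trans (2 * c * #|V| ^ 2)).
    rewrite leq_mul2l -[X in _ <= X]mulnn -card_prod; apply/orP; right; exact: max_card.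
  by rewrite ltn_mul2r expn_gt0 V0 /R; clear; lia.
pose f := 2 ^ (Kb + 2 * Kb ^ 2).
have f0 : 0 < f by rewrite expn_gt0.
have Tf0 : 0 < Th * f by rewrite muln_gt0 Th0.
have [K1 K1P] := IH (2 * (Th * f)) (ltnW TR).
exists (K1 + Th * f + Kb) => V e P m bP m0 PKb Vbig V0 mK0 wP vP.
have wR : waste P * Th <= (R + 1) * #|V|.
  by apply: leq_trans wP _; rewrite leq_mul2r leq_subr orbT.
have wQ : waste P * Q <= #|V|.
  rewrite -(leq_pmul2l (_ : 0 < R + 1)); last by rewrite addn1.
  by apply: leq_trans wR; rewrite mulnCA leq_mul2l ThQ orbT.
have w2 : 2 * waste P <= #|V|.
  rewrite -(leq_pmul2l (_ : 0 < R + 1)); last by rewrite addn1.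
  by apply: leq_trans wR; rewrite mulnA [waste P * _]mulnC leq_mul2r Th2 orbT.
have cP := blocks_cover bP.
have Vw : #|V| = #|P| * m + waste P by rewrite cP /waste cardsC.
have V2 : #|V| <= 2 * (#|P| * m) by move: Vw w2; move: (_ * m) => z; slia.
have KP : K0 <= #|P|.
  rewrite -(leq_pmul2r m0) -(leq_pmul2l (_ : 0 < 2)) //.
  by apply: leq_trans V2; rewrite mulnA mulnC.
have [good|badP] := leqP (nholed e E P * H) (#|P| ^ 2).
  exists P, m; split=> //; rewrite KP (leq_trans PKb) // leq_addl //.
pose m' := #|V| %/ (Th * f).
have m'0 : 0 < m' by rewrite divn_gt0 //; move: Vbig; move: (Th * f) => z; slia.
have m'Th : m' * (Th * f) <= #|V| by apply: leq_trunc_div.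
have [P' [bP' w' vo]] := refine e E bP m'0.
set f' := 2 ^ _ in w' vo.
have ff : f' <= f by rewrite leq_exp2l // leq_add // leq_mul2l leq_exp2r.
have fm : f' * m' * Th <= #|V|.
  by apply: leq_trans m'Th; rewrite mulnAC [Th * f]mulnC [m' * _]mulnC leq_mul2r leq_mul2r ff !orbT.
have PK' : #|P'| <= 2 * (Th * f).
  rewrite -(leq_pmul2r m'0) (blocks_cover bP'); apply: leq_trans (max_card _) _.
  have := ltn_ceil #|V| Tf0; rewrite -/m' mulSn => h.
  have h2 : Th * f <= m' * (Th * f) by rewrite leq_pmull.
  by rewrite -mulnA mul2n -addnn [Th * f * m']mulnC; apply: ltnW (leq_trans h _); rewrite leq_add2r.
have RT : R + 1 - T = (R + 1 - T.+1).+1 by move: TR; clear; lia.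
have RT' : R - T = (R - T.+1).+1 by move: TR; clear; lia.
have [||||Q1 [m1 [b1 m10 K1' w1 n1]]] := K1P V e P' m' bP' m'0 PK' _ V0.
- by move: Vbig; move: (Th * f) => z; slia.
- apply: leq_trans m'Th; rewrite leq_mul2l; apply/orP; right.
  by apply: leq_trans (leq_pmulr _ f0); rewrite /Th; clear; lia.
- rewrite RT (mulSn (R + 1 - T.+1)) addnC; apply: (@leq_trans ((waste P + f' * m') * Th)).
    by rewrite leq_mul2r w' orbT.
  by rewrite mulnDl leq_add.
- rewrite RT' (mulSn (R - T.+1)).
  set v := #|void e P| in vo vP *; set v' := #|void e P'| in vo *.
  have h1 : c * v + #|V| ^ 2 <= c * v' + 2 * c * #|V| * (f' * m').
    have e1 : #|V| ^ 2 <= 4 * H * (nholed e E P * m ^ 2).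
      apply: (@leq_trans (4 * (#|P| ^ 2 * m ^ 2))).
        by rewrite -expnMn -[4]/(2 ^ 2) -expnMn leq_exp2r.
      by rewrite -[4 * H * _]mulnA leq_mul2l /= [H * (_ * _)]mulnA leq_mul2r [H * _]mulnC ltnW ?orbT.
    have := leq_mul (leqnn (4 * H)) vo; rewrite !mulnDr.
    have -> : 4 * H * (E ^ 2 * v) = c * v by rewrite mulnA /c [4 * _ * H]mulnAC.
    have -> : 4 * H * (E ^ 2 * v') = c * v' by rewrite mulnA /c [4 * _ * H]mulnAC.
    have -> : 4 * H * (2 * E ^ 2 * #|V| * (f' * m')) = 2 * c * #|V| * (f' * m').
      by rewrite /c; move: (E ^ 2) (f' * m') (#|V|) => x y z; clear; lia.
    by apply: leq_trans; rewrite leq_add2l.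
  have h2 : 4 * c * (f' * m') <= #|V|.
    by apply: leq_trans fm; rewrite mulnC leq_mul2l /Th; apply/orP; right; clear; lia.
  have h3 : 2 * (2 * c * #|V| * (f' * m')) <= #|V| ^ 2.
    rewrite -mulnn; apply: leq_trans (leq_mul (leqnn _) h2); apply/eq_leq.
    by rewrite -[4]/(2 * 2); move: (f' * m') => z; clear; nia.
  move: vP h1 h3; rewrite -[2 * c * v]mulnA -[2 * c * v']mulnA.
  set a := (R - T.+1) * _; set q := 2 * c * _ * _; clearbody a q.
  move: (c * v) (c * v') (#|V| ^ 2); clear; lia.
exists Q1, m1; split=> //; case/andP: K1' => -> h; rewrite (leq_trans h) //.
by rewrite -addnA leq_addr.
Qed.

(** * Matchings by augmenting paths *)

(** With [s = a + w] matching edges and [u] unmatched vertices, the two terms of [maxn] are, up to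
    [O(s)], twice the edge numbers of the Erdős-Gallai extremal graphs: a clique on [2 * s]
    vertices, and [s] vertices joined to everything. Which of them wins is decided by comparing [w]
    with [2 * u]. *)
Lemma matching_arith a w u xAA xAB xAW xAU xWW xWU xWB :
  xAA <= a * a -> xAB <= a * a -> xAW <= a * (2 * w) -> xAU <= a * u ->
  xWW <= 2 * w * (2 * w) -> xWU <= 2 * w -> xWB <= w * (a + 2) ->
  xAA + (xAB + (xAW + xAU)) + (xAB + (0 + (xWB + 0)) +
    (xAW + (xWB + (xWW + xWU)) + (xAU + (0 + (xWU + 0))))) <=
  maxn (4 * (a + w) ^ 2) (3 * (a + w) ^ 2 + 2 * (a + w) * u) + 8 * (a + w).
Proof.
move=> *; rewrite -!mulnn; case: (leqP w (2 * u)) => wu.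
  apply: leq_trans (leq_add (leq_maxr _ _) (leqnn _)).
  have h : w * w <= 2 * (w * u) by rewrite mulnCA leq_mul2l wu orbT.
  nia.
apply: leq_trans (leq_add (leq_maxl _ _) (leqnn _)).
have h : 2 * (a * u) <= a * w by rewrite mulnCA leq_mul2l ltnW ?orbT.
nia.
Qed.

Ltac perm_lia := let a := fresh "a" in apply/permP => a /=;
  repeat match goal with |- context [nat_of_bool ?b] => generalize (nat_of_bool b) end;
  clear; lia.

Section Matching.
Variables (T : finType) (e : rel T).
Hypothesis esym : symmetric e.
Hypothesis eirr : irreflexive e.

Definition ends (M : seq (T * T)) : seq T := flatten [seq [:: u.1; u.2] | u <- M].

Definition matching (C : {set T}) (M : seq (T * T)) : bool :=
  [&& all (fun u => e u.1 u.2) M, uniq (ends M) & all (mem C) (ends M)].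

(** Ordered pairs are counted, so [adjs (enum C) (enum C)] is twice the number of edges inside
    [C]. *)
Definition adjs (X Y : seq T) : nat := \sum_(x <- X) count (e x) Y.

Lemma ends_cat M M' : ends (M ++ M') = ends M ++ ends M'.
Proof. by rewrite /ends map_cat flatten_cat. Qed.

Lemma ends_cons u M : ends (u :: M) = u.1 :: u.2 :: ends M. Proof. by []. Qed.

Lemma size_ends M : size (ends M) = 2 * size M.
Proof. by elim: M => // u M IH; rewrite ends_cons /= IH mulnS. Qed.

Lemma perm_ends M M' : perm_eq M M' -> perm_eq (ends M) (ends M').
Proof. by move=> p; apply: perm_flatten; apply: perm_map. Qed.

Lemma perm_matching C M M' : perm_eq M M' -> matching C M = matching C M'.
Proof.
move=> p; rewrite /matching (perm_all _ p) (perm_uniq (perm_ends p)).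
by rewrite (perm_all _ (perm_ends p)).
Qed.

Lemma adjs_catl X Y Z : adjs (X ++ Y) Z = adjs X Z + adjs Y Z.
Proof. by rewrite /adjs big_cat. Qed.

Lemma adjs_catr X Y Z : adjs X (Y ++ Z) = adjs X Y + adjs X Z.
Proof. by rewrite /adjs -big_split; apply: eq_bigr => x _; rewrite count_cat. Qed.

Lemma adjsC X Y : adjs X Y = adjs Y X.
Proof.
have E Z W : adjs Z W = \sum_(x <- Z) \sum_(y <- W) (e x y : nat).
  by apply: eq_bigr => x _; rewrite -sum1_count big_mkcond.
by rewrite !E exchange_big; apply: eq_bigr => y _; apply: eq_bigr => x _; rewrite esym.
Qed.

Lemma perm_adjs X X' Y Y' : perm_eq X X' -> perm_eq Y Y' -> adjs X Y = adjs X' Y'.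
Proof.
move=> pX pY; rewrite /adjs (perm_big _ pX) /=.
by apply: eq_bigr => x _; apply/permP.
Qed.

Lemma adjs_le X Y : adjs X Y <= size X * size Y.
Proof.
rewrite -(count_predT X) -sum1_count big_distrl /=.
by apply: leq_sum => x _; rewrite mul1n count_size.
Qed.

Lemma adjs_eq0 X Y : (forall x y, x \in X -> y \in Y -> e x y -> False) -> adjs X Y = 0.
Proof.
move=> H; rewrite /adjs big_seq big1 // => x xX; apply/eqP.
rewrite -leqn0 leqNgt -has_count; apply/hasPn => y yY; apply/negP; exact: H.
Qed.

(** If [x] and [y] both have neighbours in [S], every neighbour of one equals every neighbour of the
    other, so they share a single one. *)
Lemma crossing_count S x y : uniq S ->
  (forall s s', s \in S -> s' \in S -> s != s' -> e x s -> e y s' -> False) ->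
  [|| count (e x) S == 0, count (e y) S == 0 | (count (e x) S <= 1) && (count (e y) S <= 1)].
Proof.
move=> uS H.
have one x' s0 : (forall s, s \in S -> e x' s -> s = s0) -> count (e x') S <= 1.
  move=> h; apply: (@leq_trans (count_mem s0 S)); last by rewrite count_uniq_mem ?leq_b1.
  rewrite -!size_filter; apply: uniq_leq_size; first exact: filter_uniq.
  by move=> s; rewrite !mem_filter => /andP[xs sS]; rewrite /= (h s sS xs) eqxx -(h s sS xs).
have [/hasP[s sS xs]|] := boolP (has (e x) S); last by rewrite has_count -leqNgt leqn0 => ->.
have [/hasP[s' sS' ys']|] := boolP (has (e y) S); last first.
  by rewrite [X in ~~ X]has_count -leqNgt leqn0 => ->; rewrite orbT.
rewrite (one x s') ?(one y s) ?orbT // => z zS ez; apply/eqP; apply: contraT => ne; exfalso.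
  by apply: (H s z sS zS _ xs ez); rewrite eq_sym.
by apply: (H z s' zS sS' _ ez ys').
Qed.

Section Maximal.

Variables (C : {set T}) (M : seq (T * T)).
Hypothesis mM : matching C M.
Hypothesis maxM : forall M', matching C M' -> size M' <> (size M).+1.

Let U := [seq x <- enum C | x \notin ends M].

(** An augmentation in list form: the edges [S] of the matching are replaced by one edge more, on
    the same ends and two or more unmatched vertices. It is applied to augmenting paths of lengths
    1, 3, 5 and 7. *)
Lemma maximal_no_augment S S' X R : perm_eq M (S ++ R) ->
  all (fun u => e u.1 u.2) S' -> perm_eq (ends S') (ends S ++ X) -> uniq X ->
  {subset X <= U} -> size S' = (size S).+1 -> False.
Proof.
move=> pM eS' pE uX XU sz; apply: (maxM (M' := S' ++ R)); last first.
  by rewrite size_cat sz (perm_size pM) size_cat.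
move: mM; rewrite (perm_matching _ pM) => /and3P[eM uM CM].
move: eM uM CM; rewrite all_cat ends_cat all_cat cat_uniq => /andP[_ eR] /and3P[uS dSR uR] /andP[CS CR].
have UM x : x \in U -> (x \notin ends M) && (x \in C) by rewrite mem_filter mem_enum.
have SRM x : x \in ends S ++ ends R -> x \in ends M.
  by rewrite -ends_cat (perm_mem (perm_ends pM)).
apply/and3P; split.
- by rewrite all_cat eS'.
- rewrite ends_cat cat_uniq uR andbT (perm_uniq pE) cat_uniq uS uX andbT andTb.
  apply/andP; split.
    apply/hasPn => x /XU/UM/andP[xM _]; apply: contra xM => xS.
    by apply: SRM; rewrite mem_cat xS.
  apply/hasPn => x xR; rewrite (perm_mem pE) mem_cat negb_or.
  apply/andP; split; first exact: (hasPn dSR).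
  apply/negP => /XU/UM/andP[/negP xM _]; apply: xM; apply: SRM.
  by rewrite mem_cat xR orbT.
- rewrite ends_cat all_cat CR andbT (perm_all _ pE) all_cat CS.
  by apply/allP => x /XU/UM/andP[_ xC].
Qed.

Let split_off u : u \in M -> exists R, perm_eq M (u :: R).
Proof. by move=> uM; exists (rem u M); apply: perm_to_rem. Qed.

Let uM : uniq M.
Proof.
have [_ + _] := and3P mM; elim: (M) => //= u L IH /and3P[u1 _ /IH->].
rewrite andbT; apply: contra u1 => uL; rewrite inE; apply/orP; right.
by apply/flatten_mapP; exists u; rewrite // !inE eqxx.
Qed.

Let uU : uniq U. Proof. by rewrite filter_uniq ?enum_uniq. Qed.

Lemma unmatched_independent x y : x \in U -> y \in U -> e x y -> False.
Proof.
move=> xU yU exy; apply: (@maximal_no_augment [::] [:: (x, y)] [:: x; y] M) => //=.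
- by rewrite exy.
- by rewrite inE andbT; apply: contraTneq exy => ->; rewrite eirr.
- by move=> z; rewrite !inE => /orP[]/eqP->.
Qed.

Lemma matched_crossing u s s' : u \in M -> s \in U -> s' \in U -> s != s' ->
  e u.1 s -> e u.2 s' -> False.
Proof.
move=> uM' sU sU' ne e1 e2; have [R pR] := split_off uM'.
apply: (@maximal_no_augment [:: u] [:: (u.1, s); (u.2, s')] [:: s; s'] R) => //=.
- by rewrite e1 e2.
- by perm_lia.
- by rewrite inE andbT.
- by move=> z; rewrite !inE => /orP[]/eqP->.
Qed.

Let two_unmatched (u w : T * T) : 3 <= count (e u.1) U -> 3 <= count (e w.1) U ->
  exists s s', [/\ s \in U, s' \in U, s != s', e u.1 s & e w.1 s'].
Proof.
move=> cu cw; have /hasP[s sU us] : has (e u.1) U by rewrite has_count; lia.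
have [/hasP[s' sU' /andP[ws' ne]]|] := boolP (has (predI (e w.1) (predC1 s)) U).
  by exists s, s'; rewrite eq_sym.
move/hasPn => none; exfalso; move: cw; rewrite ltnNge => /negP; apply.
apply: (@leq_trans (count_mem s U)); last by rewrite count_uniq_mem //; case: (_ \in _).
rewrite -!size_filter; apply: uniq_leq_size; first exact: filter_uniq.
move=> z zz; have /andP[wz zU] : e w.1 z && (z \in U) by rewrite -mem_filter.
rewrite mem_filter; have := none z zU.
by rewrite /= wz /= negbK => /eqP->; rewrite eqxx sU.
Qed.

Let split_off2 u w : u \in M -> w \in M -> u != w -> exists R, perm_eq M [:: u, w & R].
Proof.
move=> uM' wM ne; have [R pR] := split_off uM'.
have wR : w \in R by move: wM; rewrite (perm_mem pR) inE eq_sym (negbTE ne).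
exists (rem w R); apply: perm_trans pR _; rewrite perm_cons; exact: perm_to_rem.
Qed.

Lemma heavy_crossing u w : u \in M -> w \in M -> u != w ->
  3 <= count (e u.1) U -> 3 <= count (e w.1) U -> e u.2 w.2 -> False.
Proof.
move=> uM' wM ne cu cw euw; have [R pR] := split_off2 uM' wM ne.
have [s [s' [sU sU' nes us ws]]] := two_unmatched cu cw.
apply: (@maximal_no_augment [:: u; w] [:: (u.1, s); (u.2, w.2); (w.1, s')] [:: s; s'] R) => //=.
- by rewrite us ws euw.
- by perm_lia.
- by rewrite inE andbT.
- by move=> z; rewrite !inE => /orP[]/eqP->.
Qed.

Lemma heavy_light_crossing u w z : u \in M -> w \in M -> z \in M -> u != w ->
  z != u -> z != w ->
  3 <= count (e u.1) U -> 3 <= count (e w.1) U -> e z.1 u.2 -> e z.2 w.2 -> False.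
Proof.
move=> uM' wM zM ne zu zw cu cw e1 e2; have [R pR] := split_off2 uM' wM ne.
have zR : z \in R by move: zM; rewrite (perm_mem pR) !inE (negbTE zu) (negbTE zw).
have [s [s' [sU sU' nes us ws]]] := two_unmatched cu cw.
apply: (@maximal_no_augment [:: u; w; z]
  [:: (u.1, s); (u.2, z.1); (w.1, s'); (w.2, z.2)] [:: s; s'] (rem z R)) => //=.
- by apply: perm_trans pR _; rewrite /= !perm_cons; apply: perm_to_rem.
- by rewrite us ws esym e1 esym e2.
- by perm_lia.
- by rewrite inE andbT.
- by move=> v; rewrite !inE => /orP[]/eqP->.
Qed.

Hypothesis orient : forall u, u \in M -> count (e u.2) U <= count (e u.1) U.

(** An edge of [M] is heavy if its ends send at least 3 edges to the unmatched set [U]; by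
    [crossing_count] all of them leave the first end. Augmenting paths then show that the second
    ends [B] of heavy edges form an independent set together with [U], and that a light edge sends
    at most 2 edges to [U] and hardly more than [size B] to [B]. Elsewhere the trivial bounds
    suffice. *)
Lemma oriented_matching_bound : 2 * size M <= #|C| /\
  adjs (enum C) (enum C) <=
    maxn (4 * size M ^ 2) (3 * size M ^ 2 + 2 * size M * (#|C| - 2 * size M)) + 8 * size M.
Proof.
have [eM uE CM] := and3P mM.
pose hv (u : T * T) := 3 <= count (e u.1) U + count (e u.2) U.
pose M1 := filter hv M; pose M2 := filter (predC hv) M.
pose A := [seq u.1 | u <- M1]; pose B := [seq u.2 | u <- M1]; pose W := ends M2.
have pM : perm_eq M (M1 ++ M2) by rewrite perm_sym; apply/permPl; apply: perm_filterC.
have sM : size M = size M1 + size M2 by rewrite (perm_size pM) size_cat.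
have pAB : perm_eq (ends M1) (A ++ B).
  rewrite /A /B; elim: (M1) => //= u L IH; rewrite ends_cons perm_cons.
  by rewrite perm_sym -(cat1s u.2) perm_catCA /= perm_cons perm_sym.
have pC : perm_eq (enum C) (A ++ B ++ W ++ U).
  have pCM : perm_eq (enum C) (ends M ++ U).
    apply: uniq_perm; rewrite ?enum_uniq //.
      rewrite cat_uniq uE uU andbT; apply/hasPn => x; rewrite mem_filter.
      by case/andP.
    have memU x : (x \in U) = (x \notin ends M) && (x \in C) by rewrite mem_filter mem_enum.
    move=> x; rewrite mem_cat memU mem_enum.
    by case: (boolP (x \in ends M)) => [/(allP CM)|].
  apply: perm_trans pCM _; rewrite !catA perm_cat2r.
  apply: perm_trans (perm_ends pM) _; rewrite ends_cat perm_cat2r.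
  exact: pAB.
have heavy u : u \in M1 -> [/\ u \in M, 3 <= count (e u.1) U & count (e u.2) U = 0].
  rewrite mem_filter => /andP[hu uM']; have or := orient uM'.
  have := crossing_count uU (fun s s' => @matched_crossing u s s' uM').
  have arith p q : 3 <= p + q -> q <= p -> [|| p == 0, q == 0 | (p <= 1) && (q <= 1)] ->
    3 <= p /\ q = 0 by clear; lia.
  by case/(arith _ _ hu or).
have sC : #|C| = 2 * size M + size U.
  by rewrite cardE (perm_size pC) !size_cat size_ends !size_map sM addnA addnn -mul2n addnA mulnDr.
split; first by rewrite sC leq_addr.
have BU : adjs B U = 0.
  by rewrite /adjs big_map big_seq big1 // => u /heavy[].
have BB : adjs B B = 0.
  apply: adjs_eq0 => x y /mapP[u /heavy[uM' cu _] ->] /mapP[w /heavy[wM cw _] ->].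
  have [->|ne] := eqVneq u w; first by rewrite eirr.
  exact: heavy_crossing.
have UU : adjs U U = 0 by apply: adjs_eq0; apply: unmatched_independent.
have WU : adjs W U <= 2 * size M2.
  rewrite /W; have : {subset M2 <= predC hv} by move=> u; rewrite mem_filter => /andP[].
  elim: (M2) => [|u L IH] sub; first by rewrite /adjs big_nil.
  have := sub u (mem_head _ _); rewrite inE /hv -ltnNge => hu.
  have /IH : {subset L <= predC hv} by move=> w wL; apply: sub; rewrite inE wL orbT.
  rewrite /adjs ends_cons !big_cons /= mulnS; move: hu; clear; lia.
have uB : uniq B.
  have : uniq (A ++ B ++ W ++ U) by rewrite -(perm_uniq pC) enum_uniq.
  by rewrite !cat_uniq => /and3P[_ _ /and3P[]].
have WB : adjs W B <= size M2 * (size M1 + 2).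
  have : {subset M2 <= [pred z | (z \in M) && ~~ hv z]}.
    by move=> z; rewrite mem_filter inE andbC.
  rewrite /W; elim: (M2) => [|z L IH] sub; first by rewrite /adjs big_nil.
  have /= /andP[zM lz] := sub z (mem_head _ _).
  have /IH : {subset L <= [pred z | (z \in M) && ~~ hv z]}.
    by move=> w wL; apply: sub; rewrite inE wL orbT.
  have sB : size B = size M1 by rewrite size_map.
  have : [|| count (e z.1) B == 0, count (e z.2) B == 0
    | (count (e z.1) B <= 1) && (count (e z.2) B <= 1)].
    apply: crossing_count uB _ => s s' /mapP[u uM1 ds] /mapP[w wM1 ds'] ne.
    rewrite ds ds' => e1 e2.
    have [uM' cu _] := heavy u uM1; have [wM cw _] := heavy w wM1.
    have zn v : v \in M1 -> z != v.
      by move=> vM1; apply: contraNneq lz => ->; move: vM1; rewrite mem_filter => /andP[].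
    by apply: (heavy_light_crossing uM' wM zM _ (zn _ uM1) (zn _ wM1) cu cw e1 e2);
      apply: contraNneq ne => uw; rewrite ds ds' uw.
  have := count_size (e z.1) B; have := count_size (e z.2) B; rewrite sB.
  rewrite /adjs ends_cons !big_cons mulSn.
  move: (count (e z.1) B) (count (e z.2) B) (size M1) (\sum_(_ <- _) _) (size L * _).
  clear; lia.
have sizes : [/\ size A = size M1, size B = size M1 & size W = 2 * size M2].
  by rewrite !size_map size_ends.
case: sizes => sA sB sW.
rewrite (perm_adjs pC pC) !adjs_catl !adjs_catr (adjsC B A) (adjsC W A) (adjsC U A)
  (adjsC B W) (adjsC U B) (adjsC U W) BU BB UU.
have l1 := adjs_le A A; have l2 := adjs_le A B; have l3 := adjs_le A W.
have l4 := adjs_le A U; have l5 := adjs_le W W; rewrite sA sB sW in l1 l2 l3 l4 l5.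
by rewrite sC sM addKn; apply: matching_arith.
Qed.

End Maximal.

Lemma matching_or_sparse (C : {set T}) s :
  (exists M, matching C M /\ size M = s) \/
  exists2 a, a < s & 2 * a <= #|C| /\ adjs (enum C) (enum C) <=
     maxn (4 * a ^ 2) (3 * a ^ 2 + 2 * a * (#|C| - 2 * a)) + 8 * a.
Proof.
elim: s => [|s [[M [mM sM]]|[a as_ H]]]; first by left; exists [::].
  have [/existsP[M' mM']|none] := boolP [exists M' : s.+1.-tuple (T * T), matching C M'].
    by left; exists M'; rewrite size_tuple.
  right; exists s => //.
  pose U := [seq x <- enum C | x \notin ends M].
  pose flip (u : T * T) := if count (e u.2) U <= count (e u.1) U then u else (u.2, u.1).
  pose M0 := map flip M.
  have pM0 : perm_eq (ends M0) (ends M).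
    rewrite /M0; elim: (M) => //= u L IH; rewrite !ends_cons /flip; case: ifP => _ /=.
      by rewrite !perm_cons.
    by rewrite (perm_catCA [:: u.2] [:: u.1]) /= !perm_cons.
  have mM0 : matching C M0.
    case/and3P: mM => eM uM CM; apply/and3P; split.
    - rewrite all_map; apply: sub_all eM => u /= eu.
      by rewrite /flip; case: ifP => //= _; rewrite esym.
    - by rewrite (perm_uniq pM0).
    - by rewrite (perm_all _ pM0).
  have sM0 : size M0 = s by rewrite size_map.
  rewrite -sM0; apply: oriented_matching_bound mM0 _ _.
    move=> M' mM'; rewrite sM0 => sM'; case/negP: none; apply/existsP.
    by exists (Tuple (introT eqP sM')).
  have UE : [seq x <- enum C | x \notin ends M0] = U.
    by apply: eq_filter => x; rewrite (perm_mem pM0).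
  rewrite UE => u /mapP[w _ ->]; rewrite /flip; case: ifP => //= /negbT.
  by rewrite -ltnNge => /ltnW.
by right; exists a => //; apply: ltnW.
Qed.

End Matching.

(** * Components with large matchings *)

(** The right side is, to leading order, twice the number of edges of two disjoint cliques on
    [2 * s] and [K - 2 * s] vertices, the extremal graph behind the case $t \ge (n+3)/2$ of
    $g^\gamma$. The left side bounds a graph with a component of order [c] whose largest matching
    has [a] edges. *)
Lemma woodall_arith (a c s K : nat) : a <= s -> 2 * a <= c -> c <= K -> K <= 2 * c ->
  2 * s <= K -> K <= 4 * s ->
  maxn (4 * a ^ 2) (3 * a ^ 2 + 2 * a * (c - 2 * a)) + (K - c) ^ 2 <=
  4 * s ^ 2 + (K - 2 * s) ^ 2.
Proof.
move=> as_ ac cK Kc sK Ks; rewrite -!mulnn addn_maxl geq_max.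
have [d defc] : exists d, c = 2 * a + d by exists (c - 2 * a); lia.
have [f defK] : exists f, K = c + f by exists (K - c); lia.
have [g defg] : exists g, K = 2 * s + g by exists (K - 2 * s); lia.
have -> : c - 2 * a = d by lia.
have -> : K - c = f by lia.
have -> : K - 2 * s = g by lia.
case: (leqP c (2 * s)) => cs.
  have [h def2s] : exists h, 2 * s = c + h by exists (2 * s - c); lia.
  have fE : f = g + h by lia.
  have key : c * c + f * f <= (2 * s) * (2 * s) + g * g.
    by rewrite def2s fE; have : h * (g + f) <= h * (2 * s + c); [rewrite leq_mul2l; lia|rewrite fE; nia].
  by apply/andP; split; nia.
have [h defc2] : exists h, c = 2 * s + h by exists (c - 2 * s); lia.
have gE : g = f + h by lia.
have [u defs] : exists u, s = a + u by exists (s - a); lia.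
apply/andP; split; first by rewrite gE defs; nia.
have sq : 2 * (s * h) <= s * s + h * h by have := (nat_Cauchy s h).1; rewrite -!mulnn.
have inc : 3 * (a * a) + 2 * a * d <= 3 * (s * s) + 2 * (s * h).
  have -> : d = h + 2 * u by lia.
  by rewrite defs; nia.
by rewrite gE; nia.
Qed.

(** With [f = K - c < c], the bounds give [2 * N' <= c ^ 2 + 2 * f ^ 2 <= (c + f) ^ 2]. *)
Lemma bipartite_arith N' N c K : c <= K -> K < 2 * c -> N' <= N + (K - c) ^ 2 ->
  2 * N <= c ^ 2 -> K * K < 2 * N' -> False.
Proof.
move=> cK cbig out bip big2.
have [f defK] : exists f, K = c + f by exists (K - c); lia.
have fE : K - c = f by lia.
by rewrite fE -!mulnn in out bip *; subst K; nia.
Qed.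

Section Components.
Variables (I : finType) (r : rel I).
Hypothesis rsym : symmetric r.
Hypothesis rirr : irreflexive r.
Local Notation dc := (double_cover r).
Local Notation edges2 := (adjs r (enum I) (enum I)).

Definition component (x : I) : {set I} := [set y | connect r x y].

Let rc := sym_connect_sym rsym.

Lemma adjs_set (C : {set I}) : adjs r (enum C) (enum C) = \sum_(x in C) #|[set y in C | r x y]|.
Proof.
rewrite /adjs big_enum /=; apply: eq_bigr => x _.
rewrite -size_filter cardE; apply: perm_size; apply: uniq_perm.
- by rewrite filter_uniq ?enum_uniq.
- exact: enum_uniq.
- by move=> y; rewrite mem_filter !mem_enum inE andbC.
Qed.

Lemma adjs_total : edges2 = \sum_x #|[set y | r x y]|.
Proof.
have -> : enum I = enum [set: I] by apply: eq_enum => x; rewrite !inE.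
rewrite adjs_set; apply: eq_big => x; rewrite ?inE // => _.
by apply: eq_card => y; rewrite !inE.
Qed.

Lemma component_closed x y z : y \in component x -> r y z -> z \in component x.
Proof. by rewrite !inE => xy yz; apply: connect_trans xy (connect1 yz). Qed.

Lemma component_degree x y : y \in component x ->
  [set z in component x | r y z] = [set z | r y z].
Proof.
move=> yC; apply/setP => z; rewrite !inE; case: (boolP (r y z)) => yz; rewrite ?andbF //.
by have := component_closed yC yz; rewrite inE => ->.
Qed.

(** Some component has average degree above [2 * s + 2]. If its largest matching had [a < s] edges,
    the average degree would be at most [2 * a + 4]. *)
Lemma component_with_matching s : (2 * s + 2) * #|I| < edges2 ->
  exists x M, matching r (component x) M /\ size M = s.
Proof.
move=> big.
have [x xbig] : exists x, (2 * s + 2) * #|component x| <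
    adjs r (enum (component x)) (enum (component x)).
  case: (pickP (fun x => (2 * s + 2) * #|component x| <
    adjs r (enum (component x)) (enum (component x)))) => [x xP|none]; first by exists x.
  exfalso; move: big; rewrite ltnNge => /negP; apply.
  rewrite adjs_total -[#|I|]sum1_card big_distrr /=.
  rewrite (partition_big (fingraph.root r) xpredT) //= [X in _ <= X](partition_big (fingraph.root r) xpredT) //=.
  apply: leq_sum => x _.
  have [rx|rx] := eqVneq (fingraph.root r x) x; last first.
    rewrite big_pred0 // => y; apply: contraNF rx => /eqP <-.
    by rewrite fingraph.root_root.
  have cE y : (fingraph.root r y == x) = (y \in component x).
    by rewrite inE -{1}rx (fingraph.root_connect rc) rc.
  rewrite (eq_bigl _ _ cE) [X in _ <= X](eq_bigl _ _ cE) muln1 sum_nat_const.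
  rewrite mulnC; have := none x; rewrite adjs_set ltnNge => /negbFE; apply: leq_trans.
  by apply: leq_sum => y /component_degree->.
exists x; have [[M MP]|[a as_ [ac ub]]] := matching_or_sparse rsym rirr (component x) s.
  by exists M.
exfalso; move: xbig ub as_ ac; move: (adjs _ _ _) #|_| => N c; clear.
rewrite -!mulnn => *.
have [d defc] : exists d, c = 2 * a + d by exists (c - 2 * a); lia.
have dE : c - 2 * a = d by lia.
have h1 : 4 * (a * a) <= 2 * a * c by subst c; nia.
have h2 : 3 * (a * a) + 2 * a * (c - 2 * a) <= 2 * a * c by rewrite dE; subst c; nia.
have h3 : 2 * a * c + 4 * c <= (2 * s + 2) * c by nia.
have : maxn (4 * (a * a)) (3 * (a * a) + 2 * a * (c - 2 * a)) <= 2 * a * c by rewrite geq_max h1.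
lia.
Qed.

(** The vertices reached on either sheet are the two colour classes: a vertex reached on both would
    connect [(x, false)] to [(x, true)]. *)
Lemma bipartite_component x : ~~ connect dc (x, false) (x, true) ->
  2 * adjs r (enum (component x)) (enum (component x)) <= #|component x| ^ 2.
Proof.
move=> nc; have dsym := sym_connect_sym (double_cover_sym rsym).
pose S a := [set y | connect dc (x, false) (y, a)].
have SC : component x \subset S false :|: S true.
  apply/subsetP => y; rewrite inE => /(connect_double_cover false)[[] cy];
  by rewrite !inE cy ?orbT.
have SD : [disjoint S false & S true].
  apply/pred0P => y /=; apply/negP; rewrite !inE => /andP[c0 c1].
  have /= c2 := connect_flip c1; rewrite dsym in c2.
  by case/negP: nc; apply: connect_trans c0 c2.
have step a y z : y \in S a -> r y z -> z \in S (~~ a).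
  rewrite !inE => cy yz; apply: connect_trans cy (connect1 _).
  by rewrite /double_cover /= yz; case: a.
have bound : adjs r (enum (component x)) (enum (component x)) <= 2 * (#|S false| * #|S true|).
  rewrite adjs_set.
  apply: (@leq_trans (\sum_(y in S false :|: S true) #|[set z | r y z]|)).
    rewrite [X in _ <= X](bigID (mem (component x))) /=.
    apply: leq_trans (leq_addr _ _).
    rewrite [X in _ <= X](eq_bigl (mem (component x))); last first.
      by move=> y /=; rewrite andbC; case: (boolP (y \in component x)) => // /(subsetP SC)->.
    by apply: leq_sum => y /component_degree->.
  rewrite (eq_bigl (mem [predU S false & S true])); last by move=> y; rewrite !inE.
  rewrite bigU //= mul2n -addnn [X in _ <= _ + X]mulnC; apply: leq_add;
  rewrite -sum_nat_const; apply: leq_sum => y yS; apply/subset_leq_card/subsetP => z;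
  by rewrite inE => /(step _ _ _ yS).
have cS : #|S false| + #|S true| <= #|component x|.
  have <- : #|S false :|: S true| = #|S false| + #|S true|.
    by rewrite cardsU (disjoint_setI0 SD) cards0 subn0.
  apply/subset_leq_card/subsetP => y; rewrite !inE.
  by case/orP => /connect_of_double_cover.
apply: leq_trans (_ : (#|S false| + #|S true|) ^ 2 <= _); last by rewrite leq_exp2r.
apply: leq_trans (leq_mul (leqnn 2) bound) _; move: #|_| #|_|; clear => p q.
by have := (nat_Cauchy p q).1; rewrite sqrnD; lia.
Qed.

Lemma edges_outside x : edges2 <=
  adjs r (enum (component x)) (enum (component x)) + (#|I| - #|component x|) ^ 2.
Proof.
rewrite adjs_total (bigID (mem (component x))) /= adjs_set; apply: leq_add.
  by apply: leq_sum => y /component_degree->.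
have -> : #|I| - #|component x| = #|~: component x| by rewrite -(cardsC (component x)) addKn.
rewrite -mulnn -sum_nat_const [X in _ <= X](eq_bigl (fun y => y \notin component x)); last first.
  by move=> y; rewrite inE.
apply: leq_sum => y yC; apply/subset_leq_card/subsetP => z; rewrite inE => yz.
by rewrite in_setC; apply: contra yC => zC; apply: component_closed zC _; rewrite rsym.
Qed.

(** The hypothesis exceeds [#|I| ^ 2 / 2], so some vertex is adjacent to more than half of all
    vertices. Its component is too large to be bipartite by [bipartite_arith], and too large to lack
    the matching by [woodall_arith]. *)
Lemma nonbipartite_component_with_matching s : 2 * s <= #|I| -> #|I| <= 4 * s ->
  4 * s ^ 2 + (#|I| - 2 * s) ^ 2 + 8 * s < edges2 ->
  exists x M, [/\ matching r (component x) M, size M = s & connect dc (x, false) (x, true)].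
Proof.
move=> sI Is big; set K := #|I| in sI Is big.
have big2 : K * K < 2 * edges2.
  apply: leq_trans (leq_mul (leqnn 2) big).
  have [g defg] : exists g, K = 2 * s + g by exists (K - 2 * s); lia.
  have -> : K - 2 * s = g by lia.
  rewrite -!mulnn defg; have := (nat_Cauchy (2 * s) g).1; rewrite -!mulnn; nia.
have [x xdeg] : exists x, K < 2 * #|[set y | r x y]|.
  case: (pickP (fun x => K < 2 * #|[set y | r x y]|)) => [x xP|none]; first by exists x.
  exfalso; move: big2; rewrite ltnNge => /negP; apply.
  rewrite adjs_total big_distrr /= -sum_nat_const; apply: leq_sum => x _.
  by rewrite leqNgt none.
have cbig : K < 2 * #|component x|.
  apply: leq_trans xdeg _; rewrite leq_mul2l; apply/subset_leq_card/subsetP => y.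
  by rewrite !inE => /connect1.
have cK : #|component x| <= K by apply: max_card.
have out := edges_outside x; rewrite -/K in out.
exists x; have [[M [mM sM]]|[a as_ [ac ub]]] := matching_or_sparse rsym rirr (component x) s.
  exists M; split => //; apply: contraT => /bipartite_component bip; exfalso.
  exact: bipartite_arith cK cbig out bip big2.
exfalso; move: big; rewrite ltnNge => /negP; apply; apply: leq_trans out _.
apply: leq_trans (leq_add ub (leqnn _)) _; rewrite addnAC; apply: leq_add; last by rewrite leq_mul2l ltnW.
by apply: woodall_arith => //; apply: ltnW.
Qed.

End Components.

From mathcomp Require Import ring lra.
From mathcomp Require Import reals sequences exp.

Import Order.TTheory GRing.Theory Num.Theory.

(** * The reduced graph *)

(** A set of possible edges rather than of pairs: [A] and [B] may overlap without double counting,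
    and the number of its members in $G(n,p)$ is binomial. *)
Definition edges_between (n : nat) (A B : {set 'I_n}) : {set {set 'I_n}} :=
  [set f in complete n | [exists x in A, exists y in B, f == [set x; y]]].

Lemma card_edges_between n (A B : {set 'I_n}) : #|edges_between A B| <= #|A| * #|B|.
Proof.
rewrite -cardsX; apply: leq_trans (leq_imset_card (fun u => [set u.1; u.2]) _).
apply/subset_leq_card/subsetP => f; rewrite inE => /andP[_ /exists_inP[x xA /exists_inP[y yB /eqP->]]].
by apply/imsetP; exists (x, y); rewrite // in_setX xA.
Qed.

Lemma adj_sym n (G : {set {set 'I_n}}) : symmetric (adj G).
Proof. by move=> x y; rewrite /adj setUC. Qed.

Lemma adj_edge n (G : {set {set 'I_n}}) f : G \subset complete n -> f \in G ->
  exists x y, [/\ f = [set x; y], x != y & adj G x y].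
Proof.
move=> sG fG; have := subsetP sG f fG; rewrite inE => /cards2P[x [y [ne def]]].
by exists x, y; rewrite /adj -def.
Qed.

Section Reduced.
Variables (n : nat) (G : {set {set 'I_n}}) (P : {set {set 'I_n}}) (E m : nat).
Hypothesis sG : G \subset complete n.
Hypothesis bP : blocks m P.
Local Notation e := (adj G).
Local Notation I := 'I_#|P|.

Definition block (i : I) : {set 'I_n} := enum_val i.

Definition reduced : rel I := fun i j =>
  [&& i != j, ~~ edgeless e (block i) (block j) & ~~ holed e E (block i) (block j)].

Lemma card_block i : #|block i| = m.
Proof. by have [_] := blocksP _ _ bP; apply; apply: enum_valP. Qed.

Lemma block_inj i j v : v \in block i -> v \in block j -> i = j.
Proof.
have [tP _] := blocksP _ _ bP => vi vj; apply: enum_val_inj.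
by apply: trivIset_unique tP _ _ vi vj; apply: enum_valP.
Qed.

Lemma holedC A B : holed e E A B = holed e E B A.
Proof.
rewrite /holed (edgelessC (@adj_sym _ G)); congr (_ && _).
by apply/existsP/existsP => -[X /existsP[Y /and5P[h1 h2 h3 h4 h5]]]; exists Y;
  apply/existsP; exists X; rewrite h1 h2 h3 h4 (edgelessC (@adj_sym _ G)).
Qed.

Lemma reduced_sym : symmetric reduced.
Proof.
by move=> i j; rewrite /reduced eq_sym (edgelessC (@adj_sym _ G)) holedC.
Qed.

Lemma reduced_irr : irreflexive reduced.
Proof. by move=> i; rewrite /reduced eqxx. Qed.

Lemma reduced_holefree k i j : m <= E * k -> reduced i j -> holefree e k (block i) (block j).
Proof.
move=> mk /and3P[_ ne]; rewrite /holed ne /= negb_exists => /forallP H.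
apply/forallP => A; apply/forallP => B; apply/implyP => /and4P[AX BY kA kB].
have := H A; rewrite negb_exists => /forallP/(_ B).
rewrite AX BY !card_block !(leq_trans mk) ?leq_mul2l ?kA ?kB ?orbT //.
Qed.

Definition linked : {set I * I} :=
  [set ij | (ij.1 != ij.2) && ~~ edgeless e (block ij.1) (block ij.2)].

Lemma card_linked : #|linked| <= adjs reduced (enum I) (enum I) + nholed e E P.
Proof.
have -> : adjs reduced (enum I) (enum I) = #|[set ij : I * I | reduced ij.1 ij.2]|.
  rewrite adjs_total; transitivity (\sum_i \sum_(j | reduced i j) 1).
    by apply: eq_bigr => i _; rewrite sum1dep_card.
  by rewrite pair_big_dep /= sum1dep_card.
pose Hd := [set ij : I * I | holed e E (block ij.1) (block ij.2)].
apply: (@leq_trans (#|[set ij : I * I | reduced ij.1 ij.2]| + #|Hd|)).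
  apply: leq_trans (leq_card_setU _ _); apply/subset_leq_card/subsetP => ij.
  by rewrite !inE /reduced => /andP[-> ->]; case: (holed _ _ _ _).
rewrite leq_add2l /nholed -(card_imset (mem Hd) (f := fun ij => (block ij.1, block ij.2))).
  apply/subset_leq_card/subsetP => AB /imsetP[ij ijH ->]; rewrite !inE in ijH *.
  by rewrite ijH andbT /= !enum_valP.
by move=> [i j] [i' j'] [/enum_val_inj-> /enum_val_inj->].
Qed.

(** An edge meets the uncovered set, or lies inside a block, or joins two linked blocks. In the last
    case it is seen from both ordered pairs, whence the factor 2. *)
Lemma double_edge_count : 2 * #|G| <= 2 * #|G :&: edges_between (~: cover P) setT| +
  2 * \sum_(i : I) #|G :&: edges_between (block i) (block i)| +
  \sum_(ij in linked) #|G :&: edges_between (block ij.1) (block ij.2)|.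
Proof.
have cE (S : {set {set 'I_n}}) : #|G :&: S| = \sum_(f in G) (f \in S).
  rewrite -sum1_card [LHS]big_mkcond [RHS]big_mkcond /=; apply: eq_bigr => f _.
  by rewrite inE; case: (f \in G).
have sE (J : finType) (Q : pred J) (S : J -> {set {set 'I_n}}) :
    \sum_(i | Q i) #|G :&: S i| = \sum_(f in G) \sum_(i | Q i) (f \in S i).
  by rewrite (eq_bigr _ (fun i _ => cE _)) exchange_big.
rewrite cE !sE !big_distrr /= -!big_split /=.
rewrite -sum1_card big_distrr /=; apply: leq_sum => f fG.
have [x [y [ef ne xy]]] := adj_edge sG fG; rewrite muln1.
have fK := subsetP sG f fG.
have btw (A B : {set 'I_n}) : (x \in A) && (y \in B) -> f \in edges_between A B.
  move=> /andP[xA yB]; rewrite inE fK; apply/exists_inP; exists x => //.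
  by apply/exists_inP; exists y; rewrite // ef.
have btw' (A B : {set 'I_n}) : (y \in A) && (x \in B) -> f \in edges_between A B.
  move=> /andP[yA xB]; rewrite inE fK; apply/exists_inP; exists y => //.
  by apply/exists_inP; exists x; rewrite // ef setUC.
have [xP|xP] := boolP (x \in cover P); last first.
  by rewrite (btw (~: cover P) setT) ?in_setC ?xP ?inE // muln1 -addnA leq_addr.
have [yP|yP] := boolP (y \in cover P); last first.
  by rewrite (btw' (~: cover P) setT) ?in_setC ?yP ?inE // muln1 -addnA leq_addr.
have blk z : z \in cover P -> exists i, z \in block i.
  by case/bigcupP => B BP zB; exists (enum_rank_in BP B); rewrite /block enum_rankK_in.
have [[i xi] [j yj]] := (blk x xP, blk y yP).
have [ij|ij] := eqVneq i j.
  subst j; rewrite (bigD1 i) //= (btw (block i) (block i)) ?xi ?yj //.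
  by apply: leq_trans (leq_addr _ _); apply: leq_trans (leq_addl _ _); rewrite mulnDr leq_addr.
rewrite addnC; apply: leq_trans (leq_addr _ _).
rewrite (bigD1 (i, j)) /=; last first.
  by rewrite inE ij; apply/edgelessPn; exists x, y.
rewrite (bigD1 (j, i)) /=; last first.
  rewrite inE /= eq_sym ij /= xpair_eqE eq_sym (negbTE ij) /= andbT.
  by apply/edgelessPn; exists y, x; rewrite adj_sym.
by rewrite (btw (block i) (block j)) ?xi ?yj // (btw' (block j) (block i)) ?xi ?yj // addnA leq_addr.
Qed.

End Reduced.


Local Open Scope ring_scope.

(** Each pair of blocks carries an error [eps * p * n ^ 2], and there are of the order of [#|P| ^ 2]
    pairs; so [eps] will be taken small against the inverse square of the number of blocks. *)
Lemma reduced_edge_bound (R : realFieldType) (n : nat) (p eps : R)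
    (G G' : {set {set 'I_n}}) (P : {set {set 'I_n}}) (E m : nat) :
  0 <= p -> 0 <= eps -> G' \subset G -> G \subset complete n -> blocks m P ->
  (forall A B : {set 'I_n}, #|G :&: edges_between A B|%:R <=
     p * #|edges_between A B|%:R + eps * p * n%:R ^+ 2) ->
  2 * #|G'|%:R <= 2 * (p * ((waste P)%:R * n%:R) + eps * p * n%:R ^+ 2) +
    (2 * #|P|%:R + (adjs (@reduced n G' P E) (enum 'I_#|P|) (enum 'I_#|P|))%:R + (nholed (adj G') E P)%:R) * (p * m%:R ^+ 2 + eps * p * n%:R ^+ 2).
Proof.
move=> p0 eps0 sG' sG bP upper.
set N := adjs _ _ _.
have cl : (#|linked G' P| <= N + nholed (adj G') E P)%N by apply: card_linked.
clearbody N.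
have sG2 : G' \subset complete n := subset_trans sG' sG.
have ub (A B : {set 'I_n}) a c : (#|A| <= a)%N -> (#|B| <= c)%N ->
    #|G' :&: edges_between A B|%:R <= p * (a%:R * c%:R) + eps * p * n%:R ^+ 2.
  move=> Aa Bc; apply: le_trans (_ : #|G :&: edges_between A B|%:R <= _).
    by rewrite ler_nat subset_leq_card ?setSI.
  apply: le_trans (upper A B) _; rewrite lerD2r ler_wpM2l // -natrM ler_nat.
  by apply: leq_trans (card_edges_between A B) _; apply: leq_mul.
set d := p * m%:R ^+ 2 + eps * p * n%:R ^+ 2.
have ubb (i j : 'I_#|P|) : #|G' :&: edges_between (block i) (block j)|%:R <= d.
  by rewrite /d expr2; apply: ub; rewrite (card_block bP).
have d0 : 0 <= d by rewrite addr_ge0 ?mulr_ge0 ?exprn_ge0.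
have := double_edge_count P sG2.
rewrite -(ler_nat R) [X in X <= _]natrM [X in _ <= X]natrD [X in _ <= X + _]natrD.
rewrite [X in _ <= X + _ + _]natrM [X in _ <= _ + X + _]natrM !natr_sum => /le_trans; apply.
rewrite -addrA; apply: lerD; first by rewrite ler_wpM2l // ub ?cardsT ?card_ord.
have h1 : \sum_(i < #|P|) (#|G' :&: edges_between (block i) (block i)|%:R : R) <= #|P|%:R * d.
  apply: le_trans (ler_sum _ (fun i _ => ubb i i)) _.
  by rewrite sumr_const card_ord mulr_natl.
have h2 : \sum_(ij in linked G' P) (#|G' :&: edges_between (block ij.1) (block ij.2)|%:R : R)
    <= #|linked G' P|%:R * d.
  apply: le_trans (ler_sum _ (fun ij _ => ubb ij.1 ij.2)) _.
  by rewrite sumr_const mulr_natl.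
have h3 : #|linked G' P|%:R * d <= (N%:R + (nholed (adj G') E P)%:R) * d.
  by rewrite -natrD ler_wpM2r // ler_nat.
rewrite -[2 * _ + _ + _]addrA [X in _ <= X]mulrDl -[2 * #|P|%:R * d]mulrA.
by apply: lerD; [rewrite ler_wpM2l|apply: le_trans h2 h3].
Qed.

(** * Concentration *)

(** The lower bound on the total serves to give a dense [G'] many edges; between sets only the upper
    bound is asked for. *)
Definition pseudorandom (R : realType) (n : nat) (p eps : R) : pred {set {set 'I_n}} :=
  fun G => [forall A : {set 'I_n}, forall B : {set 'I_n},
     #|G :&: edges_between A B|%:R <= p * #|edges_between A B|%:R + eps * p * n%:R ^+ 2] &&
   (p * #|complete n|%:R - eps * p * n%:R ^+ 2 <= #|G|%:R).

Lemma sum_subsets_prod (R : comRingType) (T : finType) (K : {set T}) (a b : T -> R) :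
  \sum_(J : {set T} | J \subset K) \prod_(i in K) (if i \in J then a i else b i) =
  \prod_(i in K) (a i + b i).
Proof.
rewrite [RHS]big_mkcond /=.
have -> : \prod_i (if i \in K then a i + b i else 1) =
    \prod_i ((if i \in K then a i else 0) + (if i \in K then b i else 1)).
  by apply: eq_bigr => i _; case: (i \in K); rewrite ?add0r.
rewrite bigA_distr [LHS]big_mkcond /=; apply: eq_bigr => J _.
case: (boolP (J \subset K)) => [JK|/subsetPn[i iJ iK]].
  rewrite big_mkcond /=; apply: eq_bigr => i _.
  by case: (boolP (i \in J)) => [/(subsetP JK)->|_]; case: (i \in K).
by rewrite (bigD1 i) //= iJ (negbTE iK) mul0r.
Qed.

Lemma card_complete_le n : (#|complete n| <= n ^ 2)%N.
Proof.
apply: leq_trans (_ : #|edges_between [set: 'I_n] [set: 'I_n]| <= _)%N.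
  apply/subset_leq_card/subsetP => f fK; rewrite inE fK.
  have := fK; rewrite inE => /cards2P[x [y [_ ->]]].
  by apply/exists_inP; exists x; rewrite ?inE //; apply/exists_inP; exists y; rewrite ?inE.
by apply: leq_trans (card_edges_between _ _) _; rewrite cardsT card_ord mulnn.
Qed.

Lemma card_complete n : #|complete n| = 'C(n, 2).
Proof. by rewrite /complete card_draws card_ord. Qed.

Section Tail.
Variables (R : realType) (n : nat) (p : R).
Hypothesis p01 : 0 <= p <= 1.
Local Notation K := (complete n).

Definition weight (G : {set {set 'I_n}}) : R :=
  \prod_(f in K) (if f \in G then p else 1 - p).

Let p0 : 0 <= p. Proof. by case/andP: p01. Qed.
Let p1 : 0 <= 1 - p. Proof. by rewrite subr_ge0; case/andP: p01. Qed.

Lemma weight_ge0 G : 0 <= weight G.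
Proof. by apply: prodr_ge0 => f _; case: ifP. Qed.

Lemma gnp_probE (Q : pred {set {set 'I_n}}) : gnp_prob p Q = \sum_(G : {set {set 'I_n}} | (G \subset K) && Q G) weight G.
Proof. by []. Qed.

Lemma gnp_prob_total : \sum_(G : {set {set 'I_n}} | G \subset K) weight G = 1.
Proof. by rewrite sum_subsets_prod big1 // => f _; rewrite addrC subrK. Qed.

Lemma exp_moment (F : {set {set 'I_n}}) x : F \subset K ->
  \sum_(G : {set {set 'I_n}} | G \subset K) weight G * x ^+ #|G :&: F| = (1 + p * (x - 1)) ^+ #|F|.
Proof.
move=> FK.
transitivity (\sum_(G : {set {set 'I_n}} | G \subset K)
   \prod_(f in K) (if f \in G then p * (if f \in F then x else 1) else 1 - p)).
  apply: eq_bigr => G GK; rewrite -prodr_const /weight big_mkcond [X in _ * X]big_mkcond.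
  rewrite [RHS]big_mkcond -big_split /=; apply: eq_bigr => f _.
  rewrite in_setI; case: (boolP (f \in G)) => [/(subsetP GK)->|_] /=.
    by case: ifP.
  by rewrite mulr1.
rewrite sum_subsets_prod -prodr_const big_mkcond [RHS]big_mkcond /=.
apply: eq_bigr => f _; case: (boolP (f \in F)) => [/(subsetP FK)->|_]; first by ring.
by case: ifP => // _; ring.
Qed.

(** From [1 - a <= expR (- a)] one gets [expR a <= 1 / (1 - a)], and the product of [1 - a] with the
    right side is [1 + a ^+ 2 * (1 - 2 * a)]. *)
Lemma expR_quadratic (a : R) : -1 / 2 <= a <= 1 / 2 -> expR a <= 1 + a + 2 * a ^+ 2.
Proof.
move=> /andP[a1 a2]; have := expR_ge1Dx (- a).
rewrite expRN => h; have e0 := expR_gt0 a.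
have h1 : (1 - a) * expR a <= 1.
  by rewrite -ler_pdivlMr // div1r.
have h2 : 1 <= (1 - a) * (1 + a + 2 * a ^+ 2).
  have : 0 <= a ^+ 2 * (1 - 2 * a) by rewrite mulr_ge0 ?sqr_ge0 //; lra.
  have -> : (1 - a) * (1 + a + 2 * a ^+ 2) = 1 + a ^+ 2 * (1 - 2 * a) by ring.
  lra.
by rewrite -(ler_pM2l (_ : 0 < 1 - a)); [apply: le_trans h1 h2|lra].
Qed.

(** Markov's inequality for the exponential moment; the sign of [a] selects the tail. *)
Lemma chernoff (F : {set {set 'I_n}}) (Q : pred {set {set 'I_n}}) (a s : R) :
  F \subset K -> -1 / 2 <= a <= 1 / 2 ->
  (forall G : {set {set 'I_n}}, Q G -> a * (p * #|F|%:R) + s <= a * #|G :&: F|%:R) ->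
  gnp_prob p Q <= expR (2 * a ^+ 2 * (p * #|F|%:R) - s).
Proof.
move=> FK a12 QP; set mu := p * #|F|%:R.
have step : gnp_prob p Q * expR (a * mu + s) <= (1 + p * (expR a - 1)) ^+ #|F|.
  rewrite -exp_moment // gnp_probE mulr_suml.
  rewrite [X in _ <= X](bigID Q) /=.
  rewrite -[X in X <= _]addr0; apply: lerD; last first.
    by apply: sumr_ge0 => G _; rewrite mulr_ge0 ?weight_ge0 ?exprn_ge0 ?expR_ge0.
  apply: ler_sum => G /andP[_ QG]; apply: ler_wpM2l; first exact: weight_ge0.
  by rewrite -expRM_natr ler_expR QP.
have ex : (1 + p * (expR a - 1)) ^+ #|F| <= expR (mu * (a + 2 * a ^+ 2)).
  apply: le_trans (_ : expR (p * (a + 2 * a ^+ 2)) ^+ #|F| <= _).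
    have q0 : 0 <= 1 + p * (expR a - 1).
      have -> : 1 + p * (expR a - 1) = (1 - p) + p * expR a by ring.
      by rewrite addr_ge0 ?mulr_ge0 ?expR_ge0.
    apply: lerXn2r => //; rewrite ?nnegrE ?expR_ge0 //.
    apply: le_trans (expR_ge1Dx _); rewrite lerD2l ler_wpM2l //.
    by rewrite lerBlDl addrA expR_quadratic.
  by rewrite -expRM_natr ler_expR /mu mulrAC.
have := le_trans step ex; rewrite -ler_pdivlMr ?expR_gt0 // -expRN -expRD => /le_trans.
apply; rewrite ler_expR le_eqVlt; apply/orP; left; apply/eqP; ring.
Qed.

Lemma gnp_prob_complement (Q : pred {set {set 'I_n}}) : 1 - gnp_prob p (predC Q) = gnp_prob p Q.
Proof.
rewrite -gnp_prob_total !gnp_probE (bigID Q) /= addrK //.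
Qed.

Lemma gnp_prob_mono (Q Q' : pred {set {set 'I_n}}) :
  (forall G : {set {set 'I_n}}, G \subset K -> Q G -> Q' G) -> gnp_prob p Q <= gnp_prob p Q'.
Proof.
move=> QQ; rewrite !gnp_probE [X in _ <= X](bigID Q) /=.
rewrite -[X in X <= _]addr0; apply: lerD; last by apply: sumr_ge0 => G _; apply: weight_ge0.
rewrite le_eqVlt; apply/orP; left; apply/eqP; apply: eq_bigl => G.
by case: (boolP (G \subset K)) => //= GK; case: (boolP (Q G)) => [/(QQ _ GK)->|]; rewrite ?andbF.
Qed.

Lemma gnp_prob_union (J : finType) (Q : J -> pred {set {set 'I_n}}) :
  gnp_prob p (fun G => [exists j, Q j G]) <= \sum_j gnp_prob p (Q j).
Proof.
rewrite gnp_probE; under [X in _ <= X]eq_bigr => j _ do rewrite gnp_probE big_mkcondr.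
rewrite exchange_big /= big_mkcondr; apply: ler_sum => G _ /=.
case: ifP => [/existsP[j Qj]|_]; last first.
  by apply: sumr_ge0 => j _; case: ifP => // _; apply: weight_ge0.
rewrite (bigD1 j) //= Qj lerDl; apply: sumr_ge0 => i _; case: ifP => // _.
exact: weight_ge0.
Qed.

End Tail.

(** With [a] equal to [eps / 4] or its negative, the exponent in [chernoff] is at most
    $-\frac18\varepsilon^2 p n^2$, hence at most $-6n$ once $pn \ge 48/\varepsilon^2$. This beats
    the $4^n + 1 \le e^{3n}$ events of the union bound. *)
Lemma pseudorandom_whp (R : realType) (eps : R) : 0 < eps <= 1 ->
  exists2 C : R, 0 < C & forall (n : nat) (p : R), (0 < n)%N -> 0 <= p <= 1 ->
    C / n%:R <= p -> 1 - expR (- n%:R) <= gnp_prob p (@pseudorandom R n p eps).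
Proof.
move=> /andP[e0 e1]; exists (48 / eps ^+ 2); first by rewrite divr_gt0 ?exprn_gt0.
move=> n p n0 p01 Cp; have nR : 0 < n%:R :> R by rewrite ltr0n.
have /andP[p0 p1] := p01.
have np : 6 * n%:R <= eps ^+ 2 / 8 * (p * n%:R ^+ 2).
  have : 48 / eps ^+ 2 * n%:R <= p * n%:R ^+ 2.
    rewrite ler_pdivrMr // in Cp.
    by rewrite expr2 mulrA ler_wpM2r // ltW.
  move=> h; have e2 : 0 < eps ^+ 2 / 8 by rewrite divr_gt0 ?exprn_gt0.
  apply: le_trans (ler_wpM2l (ltW e2) h).
  by rewrite le_eqVlt; apply/orP; left; apply/eqP; field; rewrite gt_eqF.
pose d := eps * p * n%:R ^+ 2.
have tail (F : {set {set 'I_n}}) (Q : pred {set {set 'I_n}}) (a : R) :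
    F \subset complete n -> (a = eps / 4) \/ (a = - (eps / 4)) ->
    (forall G : {set {set 'I_n}}, Q G ->
        a * (p * #|F|%:R) + eps / 4 * d <= a * #|G :&: F|%:R) ->
    gnp_prob p Q <= expR (- (6 * n%:R)).
  move=> FK aa QP; have a12 : -1 / 2 <= a <= 1 / 2 by case: aa => ->; lra.
  apply: le_trans (chernoff p01 FK a12 QP) _; rewrite ler_expR.
  have -> : a ^+ 2 = eps ^+ 2 / 16 by case: aa => ->; field.
  have Fn : p * #|F|%:R <= p * n%:R ^+ 2.
    rewrite ler_wpM2l // -natrX ler_nat; apply: leq_trans (card_complete_le n).
    exact: subset_leq_card.
  have h : eps ^+ 2 / 16 * (p * #|F|%:R) <= eps ^+ 2 / 16 * (p * n%:R ^+ 2).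
    by rewrite ler_wpM2l // divr_ge0 ?sqr_ge0.
  have -> : eps / 4 * d = 4 * (eps ^+ 2 / 16 * (p * n%:R ^+ 2)) by rewrite /d; field.
  have -> : 2 * (eps ^+ 2 / 16) * (p * #|F|%:R) = 2 * (eps ^+ 2 / 16 * (p * #|F|%:R)) by ring.
  by lra.
rewrite -gnp_prob_complement lerD2l lerN2.
(* [None] stands for the lower bound on the total number of edges. *)
pose bad (u : option ({set 'I_n} * {set 'I_n})) : pred {set {set 'I_n}} := fun G =>
  if u is Some (A, B) then p * #|edges_between A B|%:R + d < #|G :&: edges_between A B|%:R
  else #|G :&: complete n|%:R < p * #|complete n|%:R - d.
apply: le_trans (gnp_prob_mono p01 (Q' := fun G => [exists u, bad u G]) _) _.
  move=> G GK; rewrite /= /pseudorandom negb_and => /orP[|].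
    rewrite negb_forall => /existsP[A]; rewrite negb_forall => /existsP[B].
    by rewrite -ltNge => h; apply/existsP; exists (Some (A, B)).
  rewrite -ltNge => h; apply/existsP; exists None; rewrite /=.
  by move/setIidPl: GK => ->.
apply: le_trans (gnp_prob_union p01 _) _.
have eachb u : gnp_prob p (bad u) <= expR (- (6 * n%:R)).
  case: u => [[A B]|] /=.
    apply: (@tail (edges_between A B) _ (eps / 4)); [|by left|].
      by apply/subsetP => f; rewrite inE => /andP[].
    move=> G /ltW h; rewrite -mulrDr ler_wpM2l // divr_ge0 // ltW //.
  apply: (@tail (complete n) _ (- (eps / 4))); [by []|by right|].
  move=> G /ltW h; set X := p * _ in h *; set Y := _%:R in h *.
  have -> : - (eps / 4) * X + eps / 4 * d = - (eps / 4) * (X - d) by ring.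
  by rewrite ler_wnM2l // oppr_le0 divr_ge0 // ltW.
apply: le_trans (ler_sum _ (fun u _ => eachb u)) _.
rewrite sumr_const card_option card_prod card_set_type card_ord -[X in X <= _]mulr_natl.
have two : (2 ^ n)%:R <= expR n%:R :> R.
  rewrite natrX -[n%:R]mul1r expRM_natr lerXn2r ?nnegrE ?expR_ge0 //.
  by have := expR_ge1Dx (1 : R).
have one : 1 <= expR n%:R :> R by apply: le_trans two; rewrite ler1n expn_gt0.
have two1 : 2 <= expR n%:R :> R.
  by apply: le_trans two; rewrite ler_nat -[X in (X <= _)%N]expn1 leq_exp2l.
set x := expR n%:R in two one two1.
have x0 : 0 < x by apply: expR_gt0.
have cnt : ((2 ^ n * 2 ^ n).+1)%:R <= x ^+ 3.
  rewrite -natr1 natrM; set y := (2 ^ n)%:R in two *.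
  have y0 : 0 <= y by apply: ler0n.
  have : y * y <= x * x by apply: ler_pM.
  have : x * x * 2 <= x * x * x by rewrite ler_wpM2l // mulr_ge0 // ltW.
  have : 1 <= x * x by rewrite -[1]mulr1; apply: ler_pM.
  have -> : x ^+ 3 = x * x * x by ring.
  by lra.
have -> : expR (- (6 * n%:R)) = (x ^+ 6)^-1 by rewrite expRN /x -expRM_natl.
have -> : expR (- n%:R) = x^-1 by rewrite expRN.
rewrite ler_pdivrMr ?exprn_gt0 // ; apply: le_trans cnt _.
have -> : x^-1 * x ^+ 6 = x ^+ 3 * x ^+ 2 by field; rewrite gt_eqF.
by rewrite ler_peMr ?exprn_ge0 ?exprn_ege1 // ltW.
Qed.

(** * Densities *)

Lemma bin2_double n : (2 * 'C(n, 2) = n * n.-1)%N.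
Proof. by rewrite -mul_bin_diag bin1. Qed.

Lemma bin2_real (R : realType) (n : nat) : (0 < n)%N ->
  'C(n, 2)%:R * 2 = n%:R * (n%:R - 1) :> R.
Proof. by case: n => // n _; rewrite mulrC -natrM bin2_double natrM /= -natr1 addrK. Qed.

(** The cases of $g^\gamma$ collapse to two limit densities: [tau], and
    [sigma ^+ 2 + (1 - sigma) ^+ 2], which at [sigma = 1 / 2] is also the value for small odd [t].
    The slack [beta / 4] absorbs lower order terms, and makes the first bound trivial when [t] is
    even and below [beta / 8 * n]. *)
Lemma gdens_lower (R : realType) (beta : R) (n t : nat) (tau := t%:R / n%:R : R) :
  0 < beta < 1 / 4 -> 12 / beta <= n%:R -> (0 < t)%N -> t%:R <= (1 - beta) * n%:R ->
  (~~ odd t /\ tau - beta / 4 <= gdens (beta / 8) t n) \/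
  (exists sigma, [/\ 1 / 2 <= sigma, tau <= sigma, sigma <= 1 - beta &
     sigma ^+ 2 + (1 - sigma) ^+ 2 - beta / 4 <= gdens (beta / 8) t n]).
Proof.
move=> /andP[b0 b1] nb t0 tn; have n48 : 48 < n%:R :> R.
  by apply: lt_le_trans nb; rewrite ltr_pdivlMr //; lra.
have nR : 0 < n%:R :> R by lra.
have n0 : (0 < n)%N by rewrite -(ltr0n R).
have tauE : tau * n%:R = t%:R by rewrite /tau divfK ?gt_eqF.
have tau0 : 0 <= tau by rewrite divr_ge0 ?ler0n.
have tau1 : tau <= 1 - beta by rewrite -(ler_pM2r nR) tauE.
have nbeta : 12 <= beta * n%:R by rewrite mulrC -ler_pdivrMr.
have C0 : 0 < 'C(n, 2)%:R :> R by rewrite ltr0n bin_gt0 -(ltr_nat R); lra.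
have C2 := bin2_real R n0.
have Cn : 'C(n, 2)%:R * 2 <= n%:R * n%:R :> R by rewrite C2 ler_pM2l //; lra.
have low (x : R) N : 0 <= N -> x * (n%:R * n%:R) <= 2 * N -> x <= N / 'C(n, 2)%:R.
  move=> N0 h; case: (leP 0 x) => x0; last first.
    by apply: le_trans (ltW x0) _; rewrite divr_ge0 // ltW.
  rewrite ler_pdivlMr //.
  have h2 : x * ('C(n, 2)%:R * 2) <= x * (n%:R * n%:R) by rewrite ler_wpM2l.
  by have := le_trans h2 h; rewrite mulrA [2 * N]mulrC ler_pM2r.
have nn3 : 3 * n%:R <= beta / 4 * (n%:R * n%:R).
  by rewrite mulrA ler_pM2r //; lra.
have tnR : t%:R <= n%:R :> R.
  apply: le_trans tn _; rewrite ler_piMl ?ler0n //; lra.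
rewrite /gdens /gdens_num.
case: (lerP ((n%:R + 3) / 2) t%:R) => tbig.
  right; exists tau; have t2 : 1 / 2 <= tau.
    by rewrite -(ler_pM2r nR) tauE; lra.
  split=> //; apply: low; first exact: ler0n.
  have ->: (tau ^+ 2 + (1 - tau) ^+ 2 - beta / 4) * (n%:R * n%:R) =
     (tau * n%:R) ^+ 2 + (n%:R - tau * n%:R) ^+ 2 - beta / 4 * (n%:R * n%:R) by ring.
  have t2n : (1 < t)%N by rewrite -(ltr_nat R); lra.
  have tn2 : (t <= n)%N by rewrite -(ler_nat R).
  rewrite tauE !natrD.
  have a1 : 'C(t - 1, 2)%:R * 2 = (t%:R - 1) * (t%:R - 2) :> R.
    by rewrite bin2_real ?subn_gt0 // natrB //; ring.
  have a2 : 'C(n + 2 - t, 2)%:R * 2 = (n%:R + 2 - t%:R) * (n%:R + 1 - t%:R) :> R.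
    rewrite bin2_real ?subn_gt0; last by apply: leq_ltn_trans tn2 _; rewrite addn2 ltnS leqnSn.
    rewrite natrB; last by apply: leq_trans tn2 (leq_addr _ _).
    by rewrite natrD; ring.
  move: a1 a2; set c1 := 'C(t - 1, 2)%:R; set c2 := 'C(n + 2 - t, 2)%:R => a1 a2.
  have -> : 2 * (c1 + c2 + 1%:R) = c1 * 2 + c2 * 2 + 2 by ring.
  rewrite a1 a2; move: tnR nn3; move: (t%:R) (n%:R) => T N; nra.
have half (x : R) : 2 * (x / 2) = x by field.
case: ifP => oddt.
  (* Since [t < (n + 3) / 2], this exceeds [1 / 2] by at most [3 / (2 * n)]. *)
  right; exists (Num.max tau (1 / 2)); split.
  - by rewrite le_max lexx orbT.
  - by rewrite le_max lexx.
  - by rewrite ge_max tau1; lra.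
  apply: low; first exact: ler0n.
  have e4 : n%:R * n%:R <= 4 * ((n ^ 2 %/ 4 + 1)%:R : R).
    rewrite -!natrM ler_nat; apply: ltnW; have := ltn_ceil (n ^ 2) (isT : (0 < 4)%N).
    by rewrite mulnn addn1 mulnC.
  set s := Num.max _ _.
  have s12 : 1 / 2 <= s <= 1 / 2 + 3 / 2 / n%:R.
    rewrite /s le_max lexx orbT ge_max /=; apply/andP; split; last first.
      by rewrite lerDl divr_ge0 ?ltW //; lra.
    rewrite -(ler_pM2r nR) tauE mulrDl divfK ?gt_eqF //; lra.
  have s2 : (s ^+ 2 + (1 - s) ^+ 2 - beta / 4) <= 1 / 2.
    have -> : s ^+ 2 + (1 - s) ^+ 2 = 1 / 2 + 2 * (s - 1 / 2) ^+ 2 by field.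
    have q0 : 0 <= s - 1 / 2 by lra.
    have q1 : s - 1 / 2 <= 3 / 2 / n%:R by lra.
    have q2 : (s - 1 / 2) ^+ 2 <= 1 / 32 * (3 / 2 / n%:R).
      rewrite expr2; apply: ler_pM => //; apply: le_trans q1 _.
      by rewrite ler_pdivrMr //; lra.
    have q3 : 3 / 2 / n%:R <= beta / 8 by rewrite ler_pdivrMr //; lra.
    lra.
  apply: le_trans (ler_wpM2r _ s2) _; first by rewrite mulr_ge0 ?ler0n.
  lra.
left; split; first by [].
case: ifP => tg; last first.
  rewrite mul0r subr_le0 -(ler_pM2r nR) tauE.
  move/negbT: tg; rewrite -ltNge; lra.
apply: low; first exact: ler0n.
have -> : (tau - beta / 4) * (n%:R * n%:R) = (tau * n%:R) * n%:R - beta / 4 * (n%:R * n%:R) by ring.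
have e2 : n%:R * (t%:R - 1) <= 2 * ((n * (t - 1) %/ 2 + 1)%:R : R).
  have -> : t%:R - 1 = (t - 1)%:R :> R by rewrite natrB.
  rewrite -!natrM ler_nat; apply: ltnW; have := ltn_ceil (n * (t - 1)) (isT : (0 < 2)%N).
  by rewrite addn1 [(2 * _)%N]mulnC.
rewrite tauE; move: e2 nn3; move: (_ + 1)%:R (t%:R) (n%:R) nR => X T N nR'; nra.
Qed.

(** The count is divided by [p * n ^+ 2] and scaled by [K ^+ 2]. Every error is a small multiple of
    [beta / 1000 * K ^+ 2], and together they stay below 100 such units. *)
Lemma density_arith (R : realFieldType) (n p eps beta w K N nh m g X Y c : R) :
  0 < n -> 0 < p -> 0 < eps -> 0 < beta -> 0 <= w -> 1 <= K -> 0 <= N -> 0 <= nh -> 0 <= m ->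
  0 <= g <= 2 ->
  2 * c = n * (n - 1) -> p * c - eps * p * n ^+ 2 <= Y -> g * Y <= X ->
  2 * X <= 2 * (p * (w * n) + eps * p * n ^+ 2) +
           (2 * K + N + nh) * (p * m ^+ 2 + eps * p * n ^+ 2) ->
  K * m <= n -> N <= K ^+ 2 -> w <= beta / 100 * n -> nh <= beta / 100 * K ^+ 2 ->
  nh <= K ^+ 2 -> 1 <= beta / 1000 * K -> 1 <= beta / 1000 * n ->
  eps * K ^+ 2 <= beta / 1000 -> (g - beta / 10) * K ^+ 2 <= N.
Proof.
move=> n0 p0 e0 b0 w0 K1 N0 nh0 m0 /andP[g0 g2] hc hY hX h2X Km NK wn nhK nhK' bK bn eK.
have K0 : 0 <= K by apply: le_trans K1.
have K2 : K <= K ^+ 2 by rewrite expr2 ler_peMr.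
have K20 : 1 <= K ^+ 2 by apply: le_trans K2.
have eb : eps <= beta / 1000 by apply: le_trans eK; rewrite ler_peMr // ltW.
set S := 2 * K + N + nh in h2X.
have S0 : 0 <= S by rewrite /S !addr_ge0 // mulr_ge0.
have S4 : S <= 4 * K ^+ 2 by rewrite /S; move: NK nhK' K2; clear; lra.
have i1 : g * (n * (n - 1) - 2 * eps * n ^+ 2) <= 2 * (w * n + eps * n ^+ 2) + S * (m ^+ 2 + eps * n ^+ 2).
  rewrite -(ler_pM2l p0).
  have -> : p * (2 * (w * n + eps * n ^+ 2) + S * (m ^+ 2 + eps * n ^+ 2)) =
    2 * (p * (w * n) + eps * p * n ^+ 2) + S * (p * m ^+ 2 + eps * p * n ^+ 2) by ring.
  apply: le_trans h2X; rewrite -hc.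
  have -> : p * (g * (2 * c - 2 * eps * n ^+ 2)) = 2 * (g * (p * c - eps * p * n ^+ 2)) by ring.
  rewrite ler_pM2l //; apply: le_trans hX; exact: ler_wpM2l.
have km : K ^+ 2 * m ^+ 2 <= n ^+ 2.
  by rewrite -exprMn lerXn2r ?nnegrE ?mulr_ge0 // ltW.
have n20 : 0 < n ^+ 2 by rewrite exprn_gt0.
have i2 : g * (1 - beta / 1000 - 2 * eps) * K ^+ 2 <= 2 * (beta / 100 + eps) * K ^+ 2 + S * (1 + eps * K ^+ 2).
  rewrite -(ler_pM2r n20).
  have j1 : g * (1 - beta / 1000 - 2 * eps) * K ^+ 2 * n ^+ 2 <= g * (n * (n - 1) - 2 * eps * n ^+ 2) * K ^+ 2.
    have -> : g * (1 - beta / 1000 - 2 * eps) * K ^+ 2 * n ^+ 2 =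
      g * ((1 - beta / 1000 - 2 * eps) * n ^+ 2) * K ^+ 2 by ring.
    rewrite ler_wpM2r ?exprn_ge0 // ler_wpM2l // -subr_ge0.
    have -> : n * (n - 1) - 2 * eps * n ^+ 2 - (1 - beta / 1000 - 2 * eps) * n ^+ 2 =
      n * (beta / 1000 * n - 1) by ring.
    by rewrite mulr_ge0 ?subr_ge0 // ltW.
  apply: le_trans j1 _; apply: le_trans (ler_wpM2r _ i1) _; first exact: exprn_ge0.
  have j2 : S * (K ^+ 2 * m ^+ 2) <= S * n ^+ 2 by apply: ler_wpM2l.
  have j3 : w * n <= beta / 100 * n ^+ 2 by rewrite expr2 mulrA ler_wpM2r // ltW.
  have j4 : w * n * K ^+ 2 <= beta / 100 * n ^+ 2 * K ^+ 2 by rewrite ler_wpM2r ?exprn_ge0.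
  have -> : (2 * (w * n + eps * n ^+ 2) + S * (m ^+ 2 + eps * n ^+ 2)) * K ^+ 2 =
    2 * (w * n * K ^+ 2) + S * (K ^+ 2 * m ^+ 2) + (2 * eps * n ^+ 2 * K ^+ 2 + S * eps * n ^+ 2 * K ^+ 2) by ring.
  have -> : (2 * (beta / 100 + eps) * K ^+ 2 + S * (1 + eps * K ^+ 2)) * n ^+ 2 =
    2 * (beta / 100 * n ^+ 2 * K ^+ 2) + S * n ^+ 2 + (2 * eps * n ^+ 2 * K ^+ 2 + S * eps * n ^+ 2 * K ^+ 2) by ring.
  by rewrite lerD2r lerD // ler_pM2l.
have i3 : S * (eps * K ^+ 2) <= 4 * K ^+ 2 * (beta / 1000).
  by apply: ler_pM; rewrite // mulr_ge0 ?ltW ?(lt_le_trans _ K20).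
have i4 : g * (beta / 1000 + 2 * eps) * K ^+ 2 <= 2 * (3 * (beta / 1000)) * K ^+ 2.
  rewrite ler_wpM2r ?exprn_ge0 //.
  apply: ler_pM => //; last by move: eb; clear; lra.
  by move: e0 b0; clear; lra.
have i5 : eps * K ^+ 2 <= beta / 1000 * K ^+ 2 by rewrite ler_wpM2r ?exprn_ge0.
have i6 : K <= beta / 1000 * K ^+ 2.
  by rewrite expr2 mulrA -[X in X <= _]mul1r ler_wpM2r.
rewrite [S * (1 + _)]mulrDr mulr1 in i2.
have e1 : g * (1 - beta / 1000 - 2 * eps) * K ^+ 2 = g * K ^+ 2 - g * (beta / 1000 + 2 * eps) * K ^+ 2 by ring.
have e2 : 2 * (beta / 100 + eps) * K ^+ 2 = 2 * (beta / 100 * K ^+ 2) + 2 * (eps * K ^+ 2) by ring.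
have e3 : (g - beta / 10) * K ^+ 2 = g * K ^+ 2 - 100 * (beta / 1000 * K ^+ 2) by field.
have e4 : 4 * K ^+ 2 * (beta / 1000) = 4 * (beta / 1000 * K ^+ 2) by ring.
have e5 : 2 * (3 * (beta / 1000)) * K ^+ 2 = 6 * (beta / 1000 * K ^+ 2) by ring.
have e6 : beta / 100 * K ^+ 2 = 10 * (beta / 1000 * K ^+ 2) by field.
have bK0 : 0 <= beta / 1000 * K ^+ 2 by rewrite mulr_ge0 ?exprn_ge0 // divr_ge0 // ltW.
rewrite e1 e2 in i2; rewrite e4 in i3; rewrite e5 in i4; rewrite e6 in i2 nhK; rewrite e3.
rewrite /S in i2 i3.
move: i2 i3 i4 i5 i6 nhK bK0; clear.
move: (g * K ^+ 2) (g * _ * _) (eps * K ^+ 2) (beta / 1000 * K ^+ 2) ((_ + _ + _) * _) => a a1 a2 a3 a4; lra.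
Qed.

(** [3 / 5 * beta] is less than what remains of [beta] after the losses [beta / 4] in [gdens_lower]
    and [beta / 10] in [density_arith]. The surplus [beta / 20] of the matching pays for the waste
    and for the parts of the blocks not filled by long paths. *)
Lemma even_matching (R : realType) (I : finType) (r : rel I) (beta : R) (tau : R)
  (K := #|I|%:R : R) (N := adjs r (enum I) (enum I)) :
  symmetric r -> irreflexive r -> 0 < beta < 1 / 4 -> 1000 <= beta * K ->
  0 <= tau -> (tau + 3 / 5 * beta) * K ^+ 2 <= N%:R ->
  exists x M, matching r (component r x) M /\ (tau + beta / 20) * K <= 2 * (size M)%:R.
Proof.
move=> rsym rirr b0 bK tau0 dens; have /andP[bpos b4] := b0.
have K0 : 0 <= K by apply: ler0n.
have y0 : 0 <= (tau + beta / 20) * K / 2 by rewrite divr_ge0 ?mulr_ge0 ?addr_ge0 ?divr_ge0 // ltW.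
have /andP[s1 s2] := truncn_itv y0; set s := (Num.truncn _).+1 in s2.
have s3 : s%:R <= (tau + beta / 20) * K / 2 + 1 by rewrite /s -[_.+1%:R]natr1 lerD2r.
have [|x [M [mM sM]]] := @component_with_matching _ r rsym rirr s.
  rewrite -(ltr_nat R) natrM natrD natrM; apply: lt_le_trans dens.
  have -> : (tau + 3 / 5 * beta) * K ^+ 2 =
    (tau + beta / 20) * K * K + 11 / 20 * (beta * K) * K by field.
  have h : (2 * s%:R + 2) * K <= ((tau + beta / 20) * K + 4) * K.
    by rewrite ler_wpM2r //; move: s3; clear; lra.
  apply: le_lt_trans h _; rewrite mulrDl ltrD2l ltr_pM2r; last first.
    rewrite lt0r K0 andbT; apply: contraTneq bK => ->; rewrite mulr0 -ltNge; clear; lra.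
  by move: bK; clear; lra.
exists x, M; split=> //; rewrite sM; move: s2; clear; lra.
Qed.

Lemma odd_matching (R : realType) (I : finType) (r : rel I) (beta : R) (sigma : R)
  (K := #|I|%:R : R) (N := adjs r (enum I) (enum I)) :
  symmetric r -> irreflexive r -> 0 < beta < 1 / 4 -> 1000 <= beta * K ->
  1 / 2 <= sigma <= 1 - beta ->
  (sigma ^+ 2 + (1 - sigma) ^+ 2 + 3 / 5 * beta) * K ^+ 2 <= N%:R ->
  exists x M, [/\ matching r (component r x) M, (sigma + beta / 20) * K <= 2 * (size M)%:R &
    connect (double_cover r) (x, false) (x, true)].
Proof.
move=> rsym rirr b0 bK /andP[sg1 sg2] dens; have /andP[bpos b4] := b0.
have K0 : 0 <= K by apply: ler0n.
have y0 : 0 <= (sigma + beta / 20) * K / 2.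
  by rewrite divr_ge0 ?mulr_ge0 //; move: sg1 bpos; clear; lra.
have /andP[s1 s2] := truncn_itv y0; set s := (Num.truncn _).+1 in s2.
have s3 : s%:R <= (sigma + beta / 20) * K / 2 + 1 by rewrite /s -[_.+1%:R]natr1 lerD2r.
(* The overshoot [d] is a small fraction of [beta * K]. As $x^2 + (1-x)^2$ has slope at most 2 on
   $[\frac12, 1]$, it costs less than the available [3 / 5 * beta]. *)
pose d := 2 * s%:R - sigma * K.
have d1 : 0 <= d by rewrite /d; move: s2 (mulr_ge0 (ltW bpos) K0); clear; lra.
have d2 : d <= 13 / 250 * (beta * K) by rewrite /d; move: s3 bK; clear; lra.
have sK : (1 - sigma) * K >= beta * K by rewrite ler_wpM2r //; move: sg2; clear; lra.
have sK2 : (sigma - 1 / 2) * K >= 0 by rewrite mulr_ge0 ?subr_ge0.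
have s2K : (2 * s <= #|I|)%N.
  by rewrite -(ler_nat R) natrM; move: d2 sK bK; rewrite /d; clear; lra.
have K4s : (#|I| <= 4 * s)%N.
  by rewrite -(ler_nat R) natrM; move: d1 sK2; rewrite /d; clear; lra.
have [|x [M [mM sM cc]]] := @nonbipartite_component_with_matching _ r rsym rirr s s2K K4s.
  rewrite -!mulnn -(ltr_nat R) !natrD !natrM (natrB _ s2K) natrM -!expr2; apply: lt_le_trans dens.
  have -> : s%:R = (sigma * K + d) / 2 by rewrite /d; field.
  have -> : 4 * ((sigma * K + d) / 2) ^+ 2 + (K - 2 * ((sigma * K + d) / 2)) ^+ 2 +
      8 * ((sigma * K + d) / 2) = (sigma ^+ 2 + (1 - sigma) ^+ 2) * K ^+ 2 +
      (2 * (2 * sigma - 1) * (d * K) + 2 * (d * d) + 4 * (sigma * K) + 4 * d) by field.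
  rewrite [X in _ < X]mulrDl ltrD2l.
  have bKK : 0 < 3 / 5 * beta * K ^+ 2.
    have Kp : 0 < K.
      by rewrite lt0r K0 andbT; apply: contraTneq bK => ->; rewrite mulr0 -ltNge; clear; lra.
    by rewrite !mulr_gt0 // ?invr_gt0.
  have bK2 : 0 <= beta * K by rewrite mulr_ge0 // ltW.
  have q0 : beta * K * K = beta * K ^+ 2 by rewrite expr2 mulrA.
  have q1 : d * K <= 13 / 250 * (beta * K ^+ 2) by rewrite -q0 mulrA ler_wpM2r.
  have q1' : 0 <= d * K by rewrite mulr_ge0.
  have q2 : 2 * (2 * sigma - 1) * (d * K) <= 2 * (d * K).
    by rewrite ler_wpM2r //; move: sg2 bpos; clear; lra.
  have dK : d <= K.
    apply: le_trans d2 _; rewrite mulrA ler_piMl //; move: b4; clear; lra.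
  have q3 : d * d <= d * K by rewrite ler_wpM2l.
  have q4 : sigma * K <= K by rewrite ler_piMl //; move: sg2 bpos; clear; lra.
  have q5 : 1000 * K <= beta * K ^+ 2 by rewrite -q0 ler_wpM2r.
  rewrite -[3 / 5 * beta * _]mulrA in bKK *.
  move: q1 q2 q3 q4 q5 dK bKK; move: (d * d) (d * K) (sigma * K) (beta * K ^+ 2) (_ * (_ - 1) * _).
  by clear => a a1 a2 a3 a4; lra.
exists x, M; split=> //; rewrite sM; move: s2; clear; lra.
Qed.

(** * Long cycles *)

Local Close Scope ring_scope.

Lemma has_cycle_of_seq n (G : {set {set 'I_n}}) (c : seq 'I_n) : 2 < size c ->
  cycle (adj G) c -> uniq c -> has_cycle G (size c).
Proof.
move=> c3 cyc uc; rewrite /has_cycle c3; apply/existsP; exists (in_tuple c).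
by rewrite /ucycleb cyc uc.
Qed.

(** With [D = B], the depth [j] is the least one for which [k = B ^ (2 * j)] is at least [m / E], so
    that reduced pairs are hole-free for [k]. Minimality bounds [k] from above up to a factor
    [B ^ 2], which [E] contains; hence the [(8 * B + 63) * k] vertices lost per matching edge are
    less than [m / (100 * B)]. *)
Lemma has_cycle_of_matching n (G : {set {set 'I_n}}) (P : {set {set 'I_n}}) (m B t : nat)
    (E := 100 * B * ((8 * B + 63) * B ^ 2)) (K := #|P|) x M :
  G \subset complete n -> blocks m P -> 2 <= B -> 0 < K ->
  matching (@reduced n G P E) (component (@reduced n G P E) x) M -> 0 < size M ->
  2 * K ^ 2 * E < m -> (forall j, B ^ (2 * j) <= n -> 4 * j + 3 + 2 * K <= t) ->
  100 * B * t + 3 * n <= 100 * B * (2 * (size M * m)) ->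
  ~~ odd t || connect (double_cover (@reduced n G P E)) (x, false) (x, true) ->
  has_cycle G t.
Proof.
move=> sG bP B2 K0 mM M0 mK tj tot par; set r := @reduced n G P E in mM par.
have B0 : 0 < B by apply: leq_trans B2.
have E0 : 0 < E by rewrite /E !muln_gt0 B0 addn_gt0 !orbT.
have mn : m <= n.
  have : K * m <= n by rewrite /K (blocks_cover bP) -[X in _ <= X]card_ord max_card.
  by apply: leq_trans; rewrite leq_pmull.
have Kmn : K * m <= n by rewrite /K (blocks_cover bP) -[X in _ <= X]card_ord max_card.
have m0 : 0 < m by apply: leq_ltn_trans mK.
have [j mj hj] : exists2 j, m <= E * B ^ (2 * j) & forall i, i < j -> E * B ^ (2 * i) < m.
  have ex : exists j, m <= E * B ^ (2 * j).
    exists m; apply: leq_trans (leq_pmull _ E0); apply: ltnW.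
    by apply: leq_trans (ltn_expl _ B2) _; rewrite leq_exp2l // leq_pmull.
  case: (ex_minnP ex) => j mj min; exists j => // i ij; rewrite ltnNge; apply/negP => /min.
  by rewrite leqNgt ij.
set k := B ^ (2 * j) in mj.
have k0 : 0 < k by rewrite expn_gt0 B0.
have Kk : 2 * K ^ 2 <= k.
  by rewrite -(leq_pmul2l E0) mulnC (leq_trans _ mj) // ltnW.
have K2 : 2 <= k by apply: leq_trans Kk; rewrite leq_pmulr // expn_gt0 K0.
have j0 : 0 < j by rewrite lt0n; apply: contraTneq K2; rewrite /k => ->.
pose z := (8 * B + 63) * k.
have zm : 100 * B * z < m.
  have := hj j.-1; rewrite prednK // leqnn => /(_ isT); apply: leq_ltn_trans.
  have kE : k = B ^ 2 * B ^ (2 * j.-1) by rewrite /k -expnD -mulnS prednK.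
  by rewrite /z /E kE !mulnA.
have zk : 63 * k <= z by rewrite leq_mul2r leq_addl orbT.
have zk2 : (4 * B + 24) * k + 9 * k + 1 <= z.
  by rewrite /z; move: k0; move: (k); clear => k' *; nia.
have zB : z <= 100 * B * z by rewrite leq_pmull // muln_gt0.
pose q := m - 1 - (4 * B + 24) * k.
have qE : q + 1 + (4 * B + 24) * k = m by rewrite /q; move: zk2 zB zm; clear; lia.
have k8 : 8 * k <= q by rewrite /q; move: zk2 zB zm k0; clear; lia.
have kn : B ^ (2 * j) <= n by rewrite -/k; move: zk zB zm mn; clear; lia.
have tj1 := tj j kn.
pose d0 := t - (4 * j + 2).
have tE : t = d0 + 4 * j + 2 by rewrite /d0; move: tj1; clear; lia.
have d0t : d0 <= t by rewrite leq_subr.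
have Kd0 : 2 * #|'I_K| <= d0 by rewrite card_ord /d0; move: tj1; clear; lia.
have [eM uM CM] := and3P mM.
have sMK : size M <= K.
  have := max_card (mem (ends M)); rewrite (card_uniqP uM) size_ends card_ord -/K.
  by clear; lia.
have KM : 2 * #|'I_K| * size M <= k.
  by apply: leq_trans Kk; rewrite card_ord -mulnn mulnA leq_mul2l sMK orbT.
have tot2 : d0 + 4 * k <= size M * (2 * q - 14 * k).
  (* Two blocks lose [(8 * B + 48) * k + 2] vertices to the reserves and [14 * k] to cutting; the
     last [k] in [z] covers the 2. *)
  have q2 : 2 * m - z <= 2 * q - 14 * k.
    by rewrite /z; move: qE K2 k8; move: (k); clear => k' *; nia.
  apply: leq_trans (leq_mul (leqnn _) q2).
  have B1 : 0 < 100 * B by rewrite muln_gt0.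
  rewrite -(leq_pmul2l B1) mulnDr mulnBr mulnBr.
  have s1 : 100 * B * (size M * z) <= n.
    rewrite mulnCA; apply: leq_trans Kmn; apply: leq_mul => //; exact: ltnW.
  have s2 : 100 * B * (4 * k) <= 2 * n.
    have : 100 * B * (63 * k) <= n.
      by apply: leq_trans mn; apply: leq_trans (ltnW zm); rewrite leq_mul2l zk orbT.
    by move: (k); clear => k'; nia.
  have s3 : 100 * B * d0 <= 100 * B * t by rewrite leq_mul2l d0t orbT.
  rewrite (mulnCA (size M)); move: tot s1 s2 s3; clear.
  move: (100 * B * t) (100 * B * d0) (100 * B * (4 * k)) (100 * B * (2 * (size M * m))).
  by move=> a1 a2 a3 a4; move: (100 * B * (size M * z)); lia.
have odd_d0 : odd t = odd d0.
  have -> : t = d0 + 2 * (2 * j + 1) by rewrite [LHS]tE; clear; lia.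
  by rewrite oddD [2 * (_ + _)]mul2n odd_double addbF.
have [||||||||||c [cyc uc sc]] := @cycle_of_matching _ _ (adj G) r (@block n P) B j x M q d0
  B2 (@adj_sym _ G) (@reduced_sym _ _ _ _) (@reduced_irr _ _ _ _) (@block_inj _ _ _ bP).
- by move=> i i'; apply: (reduced_holefree bP mj).
- by move=> i; rewrite (card_block bP); apply: eq_leq; exact: qE.
- by case: (M) M0.
- move=> u uM'; rewrite (allP eM u uM') /=.
  suff : u.1 \in component r x by rewrite inE.
  by apply: (allP CM); apply/flatten_mapP; exists u; rewrite // !inE eqxx.
- exact: uM.
- exact: k8.
- exact: Kd0.
- exact: KM.
- exact: tot2.
- by rewrite -odd_d0.
rewrite tE -sc; apply: has_cycle_of_seq => //.
by rewrite sc; move: Kd0 K0; rewrite card_ord; clear; lia.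
Qed.

Local Open Scope ring_scope.

(** As [1 / beta <= B], the trees cost [4 * j <= 2 * ln n / ln (1 / beta)]. The other half of the
    lower bound on [t] exceeds [2 * K + 4] for large [n]. *)
Lemma log_depth (R : realType) (beta : R) (B K t n j : nat) :
  0 < beta < 1 -> 1 / beta <= B%:R -> expR (ln (1 / beta) * (K + 2)%:R) <= n%:R ->
  4 / ln (1 / beta) * ln n%:R <= t%:R :> R -> (B ^ (2 * j) <= n)%N ->
  (4 * j + 3 + 2 * K <= t)%N.
Proof.
move=> /andP[b0 b1] bB nbig tbig Bj; set L := ln (1 / beta) in nbig tbig *.
have ib : 1 < 1 / beta by rewrite ltr_pdivlMr // mul1r.
have L0 : 0 < L by apply: ln_gt0.
have Bp : 0 < B%:R :> R by apply: lt_le_trans bB; apply: lt_trans ib.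
have LB : L <= ln B%:R by rewrite ler_ln // posrE; apply: lt_trans ib.
have np : 0 < n%:R :> R by apply: lt_le_trans nbig; apply: expR_gt0.
have l1 : L * (K + 2)%:R <= ln n%:R by rewrite -[X in X <= _]expRK ler_ln // posrE expR_gt0.
have l2 : (2 * j)%:R * L <= ln n%:R.
  apply: le_trans (_ : (2 * j)%:R * ln B%:R <= _); first by rewrite ler_wpM2l.
  rewrite mulr_natl -lnXn // ler_ln ?posrE ?exprn_gt0 //.
  by rewrite -natrX ler_nat.
have l3 : (2 * (2 * j) + 2 * (K + 2))%:R * L <= 4 * ln n%:R.
  have -> : (2 * (2 * j) + 2 * (K + 2))%:R = 2 * (2 * j)%:R + 2 * (K + 2)%:R :> R.
    by rewrite natrD [X in X + _]natrM [X in _ + X]natrM.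
  rewrite mulrDl -[2 * _ * L]mulrA -[2 * (K + 2)%:R * L]mulrA [(K + 2)%:R * L]mulrC.
  by move: l1 l2; move: (_ * L) (L * _) => a a' l1 l2; lra.
have l4 : (2 * (2 * j) + 2 * (K + 2))%:R <= t%:R :> R.
  apply: le_trans tbig; rewrite mulrAC ler_pdivlMr //.
by move: l4; rewrite ler_nat; clear; lia.
Qed.

Lemma dense_subgraphs_of_pseudorandom (R : realType) (beta : R) : 0 < beta < 1 / 4 ->
  exists eps : R, 0 < eps <= 1 /\ exists N0 : nat, forall n p (G : {set {set 'I_n}}) t,
    (N0 <= n)%N -> 0 < p -> G \subset complete n -> pseudorandom p eps G ->
    4 / ln (1 / beta) * ln n%:R <= t%:R -> t%:R <= (1 - beta) * n%:R ->
    @all_dense_subgraphs_have_cycle R n (gdens (beta / 8) t n + beta) t G.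
Proof.
move=> b14; have /andP[b0 b1] := b14.
have ib4 : 4 < 1 / beta by rewrite ltr_pdivlMr //; lra.
have [B bB] : exists B : nat, 1 / beta <= B%:R.
  have /andP[_ h] := truncn_itv (ltW (lt_trans (ltr0n R 4) ib4)).
  by exists (Num.truncn (1 / beta)).+1; apply: ltW.
have B4 : (4 < B)%N by rewrite -(ltr_nat R); apply: lt_le_trans bB.
have betaB : 1 <= beta * B%:R by rewrite mulrC -ler_pdivrMr.
pose E := (100 * B * ((8 * B + 63) * B ^ 2))%N.
have E0 : (0 < E)%N by rewrite /E !muln_gt0 addn_gt0 !orbT; case: (B) B4.
have H0 : (0 < 1000 * B)%N by case: (B) B4.
(* At most [n / (100 * B)] vertices are wasted, at most a fraction [1 / (1000 * B)] of the pairs is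
   holed, and at least [1000 * B] blocks make the edges inside blocks negligible. *)
have [Kmax reg] := hole_regularity (100 * B) (1000 * B) E0 H0.
pose eps : R := 1 / (1000 * B%:R * (Kmax + 1)%:R ^+ 2).
have B0 : 0 < B%:R :> R by rewrite ltr0n; case: (B) B4.
have B1 : 1 <= B%:R :> R by rewrite ler1n; case: (B) B4.
have Km0 : 1 <= (Kmax + 1)%:R ^+ 2 :> R by rewrite exprn_ege1 // ler1n addn1.
have den1 : 1 <= 1000 * B%:R * (Kmax + 1)%:R ^+ 2 :> R.
  rewrite -[X in X <= _]mulr1; apply: ler_pM => //; move: B1; clear; lra.
have eps0 : 0 < eps by rewrite divr_gt0 // (lt_le_trans _ den1).
exists eps; split.
  by rewrite eps0 /eps ler_pdivrMr ?mul1r // (lt_le_trans _ den1).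
pose X := expR (ln (1 / beta) * (Kmax + 2)%:R) : R.
exists (Kmax + 1000 * B + (2 * Kmax * (2 * Kmax ^ 2 * E)).+1 + (Num.truncn X).+1)%N.
move=> n p G t nbig p0 sG /andP[up lowG] tlow tup.
have nX : X <= n%:R.
  have /andP[_ /ltW h] := truncn_itv (expR_ge0 (ln (1 / beta) * (Kmax + 2)%:R)).
  apply: le_trans h _; rewrite ler_nat; apply: leq_trans nbig; exact: leq_addl.
have nK : (Kmax <= #|'I_n|)%N by rewrite card_ord; move: nbig; clear; lia.
have nB : (1000 * B <= n)%N by move: nbig; clear; lia.
have nE : (2 * Kmax * (2 * Kmax ^ 2 * E) < n)%N.
  by move: nbig; move: (2 * Kmax * _)%N; clear; lia.
have tj K j : (K <= Kmax)%N -> (B ^ (2 * j) <= n)%N -> (4 * j + 3 + 2 * K <= t)%N.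
  move=> KK Bj; have b01 : 0 < beta < 1 by rewrite b0; move: b1; clear; lra.
  have := log_depth b01 bB nX tlow Bj; move: KK; clear; lia.
have n0 : (0 < n)%N by move: nB B4; clear; lia.
have t0 : (0 < t)%N.
  by have := tj 0%N 0%N (leq0n _); rewrite muln0 expn0 => /(_ n0); apply: leq_trans.
have nR : 0 < n%:R :> R by rewrite ltr0n.
apply/forallP => G'; apply/implyP => sG'; apply/implyP => dens.
have sG2 : G' \subset complete n := subset_trans sG' sG.
have [P [m [bP m0 /andP[K0 K1] wQ nhH]]] := reg _ (adj G') nK.
set K := #|P| in K0 K1 nhH; rewrite card_ord in wQ.
have Kpos : (0 < K)%N by apply: leq_trans K0; case: (B) B4.
have KmV : (K * m + waste P = n)%N by rewrite /K (blocks_cover bP) /waste cardsC card_ord.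
have Kmn : (K * m <= n)%N by apply: leq_trans (leq_addr (waste P) _) _; rewrite KmV.
have upper (A A' : {set 'I_n}) : #|G :&: edges_between A A'|%:R <=
     p * #|edges_between A A'|%:R + eps * p * n%:R ^+ 2.
  by have /forallP/(_ A') := forallP up A.
have edge := reduced_edge_bound E (ltW p0) (ltW eps0) sG' sG bP upper.
set r := @reduced n G' P E in edge; set N := adjs _ _ _ in edge.
have rsym : symmetric r by apply: reduced_sym.
have rirr : irreflexive r by apply: reduced_irr.
have BK : 1000 <= beta * K%:R.
  apply: le_trans (_ : beta * (1000 * B)%:R <= _); last by rewrite ler_pM2l // ler_nat.
  by rewrite natrM mulrCA ler_peMr.
have m2 : (2 * K ^ 2 * E < m)%N.
  rewrite ltnNge; apply/negP => mE; move: nE; rewrite ltnNge => /negP; apply.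
  have w2 : (2 * waste P <= n)%N.
    by apply: leq_trans wQ; rewrite mulnC leq_mul2l; apply/orP; right; move: B4; clear; lia.
  apply: (@leq_trans (2 * (K * m)))%N; first by move: KmV w2; move: (K * m)%N; clear; lia.
  rewrite mulnA; apply: leq_mul; first by rewrite leq_mul2l.
  apply: leq_trans mE _; rewrite leq_mul2r; apply/orP; right.
  by rewrite leq_mul2l /= leq_exp2r.
have density (g : R) : 0 <= g <= 2 -> g <= gdens (beta / 8) t n + beta ->
    (g - beta / 10) * K%:R ^+ 2 <= N%:R.
  move=> g02 gg.
  apply: (density_arith nR p0 eps0 b0 (ler0n _ (waste P)) _ (ler0n _ _) (ler0n _ (nholed (adj G') E P))
    (ler0n _ m) g02 (X := #|G'|%:R) (Y := #|G|%:R) (c := 'C(n, 2)%:R)) edge _ _ _ _ _ _ _ _.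
  - by rewrite ler1n.
  - by rewrite mulrC bin2_real.
  - by rewrite -card_complete.
  - by apply: le_trans dens; rewrite ler_wpM2r.
  - by rewrite -natrM ler_nat.
  - by rewrite -natrX ler_nat -mulnn; apply: leq_trans (adjs_le _ _ _) _; rewrite -cardE card_ord.
  - have h : (waste P)%:R * (100 * B%:R) <= n%:R :> R by rewrite -!natrM ler_nat.
    rewrite mulrAC ler_pdivlMr //; apply: le_trans (_ : (waste P)%:R * 100 * (beta * B%:R) <= _).
      by rewrite ler_peMr // mulr_ge0.
    have -> : (waste P)%:R * 100 * (beta * B%:R) = beta * ((waste P)%:R * (100 * B%:R)) by ring.
    by rewrite ler_pM2l.
  - have h : (nholed (adj G') E P)%:R * (1000 * B%:R) <= K%:R ^+ 2 :> R.
      by rewrite -natrX -!natrM ler_nat.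
    rewrite mulrAC ler_pdivlMr //.
    apply: le_trans (_ : (nholed (adj G') E P)%:R * 1000 * (beta * B%:R) <= _).
      apply: le_trans (ler_wpM2l (mulr_ge0 (ler0n _ _) (ler0n _ _)) betaB).
      rewrite mulr1 ler_wpM2l // ler_nat //.
    have -> : (nholed (adj G') E P)%:R * 1000 * (beta * B%:R) =
      beta * ((nholed (adj G') E P)%:R * (1000 * B%:R)) by ring.
    by rewrite ler_pM2l.
  - rewrite -natrX ler_nat; apply: leq_trans nhH; rewrite leq_pmulr //.
  - by move: BK; clear; lra.
  - rewrite mulrAC ler_pdivlMr // mul1r.
    apply: le_trans (_ : beta * (1000 * B)%:R <= _); last by rewrite ler_pM2l // ler_nat.
    by rewrite natrM mulrCA ler_peMr.
  - rewrite /eps div1r mulrC ler_pdivrMr ?(lt_le_trans _ den1) //.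
    have -> : beta / 1000 * (1000 * B%:R * (Kmax + 1)%:R ^+ 2) =
      beta * B%:R * (Kmax + 1)%:R ^+ 2 by field.
    apply: le_trans (_ : (Kmax + 1)%:R ^+ 2 <= _).
      by rewrite -!natrX ler_nat leq_exp2r // (leq_trans K1) // leq_addr.
    by rewrite ler_peMl // (le_trans _ Km0).
(* After multiplication by [100 * B], the surplus [beta / 20] is worth [5 * n]: at most [2 * n] of
   it goes to the waste, and [3 * n] is what [has_cycle_of_matching] requires. *)
have finish x M (y : R) : matching r (component r x) M -> t%:R / n%:R <= y -> y <= 1 ->
   (y + beta / 20) * K%:R <= 2 * (size M)%:R ->
   ~~ odd t || connect (double_cover r) (x, false) (x, true) -> has_cycle G' t.
  move=> mM ty y1 sM par.
  have tyn : t%:R <= y * n%:R by rewrite -ler_pdivrMr.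
  have y0 : 0 <= y by apply: le_trans ty; rewrite divr_ge0.
  have KR : 0 < K%:R :> R by rewrite ltr0n.
  apply: (has_cycle_of_matching sG2 bP _ Kpos mM) par => //.
  - by apply: leq_trans B4.
  - rewrite -(ltr0n R) -(pmulr_rgt0 _ (ltr0n R 2)); apply: lt_le_trans sM.
    by rewrite mulr_gt0 // ltr_wpDl // divr_gt0.
  - by move=> j; apply: tj.
  rewrite -(ler_nat R) natrD !natrM.
  have h1 : (y + beta / 20) * (n%:R - (waste P)%:R) <= 2 * ((size M)%:R * m%:R).
    have -> : n%:R - (waste P)%:R = K%:R * m%:R :> R.
      have := congr1 (fun z : nat => z%:R : R) KmV; rewrite /= natrD natrM => <-.
      by rewrite addrK.
    by rewrite !mulrA ler_wpM2r.
  have h2 : 100 * B%:R * (waste P)%:R <= n%:R :> R by rewrite -!natrM ler_nat mulnC.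
  have BB : 0 <= 100 * B%:R :> R by rewrite mulr_ge0.
  apply: le_trans (ler_wpM2l BB h1).
  have h3 : (y + beta / 20) * (100 * B%:R * (waste P)%:R) <= 2 * n%:R.
    have [yb1 yb2] : 0 <= y + beta / 20 /\ y + beta / 20 <= 2.
      by move: y0 y1 b0 b1; clear => *; split; lra.
    by apply: ler_pM; rewrite // !mulr_ge0.
  have h4 : 100 * B%:R * t%:R <= 100 * B%:R * (y * n%:R) by rewrite ler_wpM2l.
  have h5 : 5 * n%:R <= 100 * B%:R * (beta / 20 * n%:R).
    have -> : 100 * B%:R * (beta / 20 * n%:R) = 5 * (beta * B%:R) * n%:R by field.
    by rewrite ler_pM2r // ler_pMr.
  have -> : 100 * B%:R * ((y + beta / 20) * (n%:R - (waste P)%:R)) =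
    100 * B%:R * (y * n%:R) + 100 * B%:R * (beta / 20 * n%:R) -
    (y + beta / 20) * (100 * B%:R * (waste P)%:R) by ring.
  move: h3 h4 h5; set a := _ * (y * _); set c := (y + _) * _; set d := _ * (_ * n%:R).
  by move: a c d (100 * B%:R * t%:R) => a c d f; clear; lra.
have IK : #|'I_K|%:R = K%:R :> R by rewrite card_ord.
have b12 : 12 / beta <= n%:R.
  rewrite ler_pdivrMr //; apply: le_trans (_ : beta * (1000 * B)%:R <= _); last first.
    by rewrite mulrC ler_pM2r // ler_nat.
  by rewrite natrM mulrCA; move: betaB; clear; lra.
have [[tev gl]|[sg [sg1 sg2 sg3 gl]]] := gdens_lower b14 b12 t0 tup.
- have tau0 : 0 <= t%:R / n%:R :> R by rewrite divr_ge0.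
  have tau1 : t%:R / n%:R <= 1 :> R.
    by rewrite ler_pdivrMr // mul1r; apply: le_trans tup _; rewrite ler_piMl //; move: b0; clear; lra.
  have [||x [M [mM sM]]] := @even_matching R 'I_K r beta (t%:R / n%:R) rsym rirr b14 _ tau0.
  + by rewrite IK.
  + rewrite IK; apply: le_trans (density (t%:R / n%:R - beta / 4 + beta) _ _).
    * by rewrite ler_wpM2r ?exprn_ge0 //; move: b0; clear; lra.
    * by move: tau0 tau1 b0 b1; clear; move: (_ / _) => a *; apply/andP; split; lra.
    * by rewrite lerD2r.
  by apply: (finish x M (t%:R / n%:R)) => //; rewrite ?tev // -IK.
- have sgq : 0 <= sg ^+ 2 + (1 - sg) ^+ 2 <= 1.
    have q1 : 0 <= sg * (1 - sg) by rewrite mulr_ge0 //; move: sg1 sg3 b0; clear; lra.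
    have -> : sg ^+ 2 + (1 - sg) ^+ 2 = 1 - 2 * (sg * (1 - sg)) by ring.
    rewrite -{1}[1](_ : sg ^+ 2 + (1 - sg) ^+ 2 + 2 * (sg * (1 - sg)) = 1); last by ring.
    by rewrite addrK addr_ge0 ?sqr_ge0 //= gerBl mulr_ge0.
  have [|||x [M [mM sM cc]]] := @odd_matching R 'I_K r beta sg rsym rirr b14 _ _.
  + by rewrite IK.
  + by rewrite sg1.
  + rewrite IK; apply: le_trans (density (sg ^+ 2 + (1 - sg) ^+ 2 - beta / 4 + beta) _ _).
    * by rewrite ler_wpM2r ?exprn_ge0 //; move: b0; clear; lra.
    * by move: sgq b0 b1; clear; move: (_ + _) => a *; apply/andP; split; lra.
    * by rewrite lerD2r.
  apply: (finish x M sg) => //; rewrite ?cc ?orbT // -?IK //.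
  by apply: le_trans sg3 _; rewrite gerBl ltW.
Qed.

From mathcomp Require Import classical_sets topology normedtype.

Local Open Scope classical_set_scope.

Theorem corollary1p9 (R : realType) :
  exists C1 C2 : R, [/\ 0 < C1, 0 < C2 &
  forall beta : R, 0 < beta < 1 / 4 ->
  exists C gamma : R, [/\ 0 < C, 0 < gamma &
  exists c : R, 0 < c /\
  forall p : nat -> R,
    (forall n : nat, 0 <= p n <= 1) ->
    (\forall n \near \oo, C / n%:R <= p n) ->
  \forall n \near \oo, forall t : nat,
    C1 / ln (1 / beta) * ln n%:R <= t%:R ->
    t%:R <= (1 - C2 * beta) * n%:R ->
    1 - expR (- (c * n%:R)) <=
      gnp_prob (p n)
        (@all_dense_subgraphs_have_cycle R n (gdens gamma t n + beta) t)]].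
Proof.
(* The pseudorandom event does not depend on [t], so one event of probability at least $1 - e^{-n}$
   serves all lengths. *)
exists 4, 1; split=> // beta b14; have /andP[b0 _] := b14.
have [eps [eps01 [N0 dense]]] := dense_subgraphs_of_pseudorandom b14.
have [C C0 whp] := pseudorandom_whp eps01.
exists C, (beta / 8); split=> //; first by rewrite divr_gt0.
exists 1; split=> // p p01 [N1 _ pC]; exists (N0 + N1 + 1)%N => // n /= nbig t tlow tup.
have n0 : (0 < n)%N by apply: leq_trans nbig; rewrite addn1.
have nN0 : (N0 <= n)%N by apply: leq_trans nbig; rewrite -addnA leq_addr.
have nN1 : (N1 <= n)%N by apply: leq_trans nbig; rewrite addnAC leq_addl.
have Cp := pC n nN1; rewrite mul1r; rewrite mul1r in tup.
have pn0 : 0 < p n by apply: lt_le_trans Cp; rewrite divr_gt0 // ltr0n.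
apply: le_trans (whp n (p n) n0 (p01 n) Cp) _.
by apply: (gnp_prob_mono (p01 n)) => G sG psG; apply: (dense n (p n)).
Qed.
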